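(* For every $r\ge0$ and $2\le n\le\infty$, the category $\mathrm{Ch}_n$ of $n$-multicomplexes admits a right proper cofibrantly generated model structure (the $r$-model structure) in which: the weak equivalences are the $E_r$-quasi-isomorphisms; the fibrations are the morphisms $f\colon A\to B$ such that $E_i(f)$ is bidegree-wise surjective for every $0\le i\le r$; and the sets of generating cofibrations and generating trivial cofibrations are $(I^n_r)'=\bigcup_{k=1}^{r-1}J^n_k\cup I^n_r$ and $(J^n_r)'=\bigcup_{k=0}^rJ^n_k$ respectively.
   Context: Throughout, $R$ is a commutative unital ring. For $1\le n\le\infty$, an $n$-multicomplex is a $\mathbb Z\times\mathbb Z$-bigraded $R$-module $A=\{A^{p,q}\}$ with $R$-linear maps $d_i\colon A\to A$ ($i\ge0$) of bidegree $(-i,1-i)$ such that $\sum_{i+j=l}(-1)^id_id_j=0$ for all $l\ge0$, and $d_i=0$ for all $i\ge n$. Morphisms are bidegree $(0,0)$ maps commuting with all $d_i$; category $\mathrm{Ch}_n$. Spectral sequence: $Z_0^{p,q}(A)=A^{p,q}$; for $r\ge1$, $Z_r^{p,q}(A)$ is the set of $a_0\in A^{p,q}$ for which there exist $a_j\in A^{p-j,q-j}$ ($1\le j\le r-1$) with $\sum_{i+j=l}(-1)^id_ia_j=0$ for $0\le l\le r-1$. $B_0=0$, $B_1^{p,q}(A)=A^{p,q}\cap\operatorname{im}d_0$, and for $r\ge2$, $B_r^{p,q}(A)$ is the set of $x\in A^{p,q}$ for which there exist $b_i\in A^{p+r-1-i,q+r-2-i}$ ($0\le i\le r-1$) with $x=\sum_{i=0}^{r-1}(-1)^id_ib_{r-1-i}$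 and $\sum_{i=0}^l(-1)^id_ib_{l-i}=0$ for $0\le l\le r-2$. $E_r^{p,q}(A)=Z_r^{p,q}(A)/B_r^{p,q}(A)$, the spectral sequence of the column-filtered total complex. A morphism $f$ is an $E_r$-quasi-isomorphism if $E_{r+1}(f)$ is an isomorphism. Representing objects: $\mathbb D^n(p,q)$ is the free $n$-multicomplex on one generator in bidegree $(p,q)$. $\mathcal ZW^n_0(p,q)=\mathbb D^n(p,q)$ with generator $a_0$; for $r\ge1$, $\mathcal ZW^n_r(p,q)$ is the $n$-multicomplex generated by $a_0,\dots,a_{r-1}$, $a_i$ in bidegree $(p-i,q-i)$, subject to the relations $\sum_{i+j=l}(-1)^id_ia_j=0$ for $0\le l\le r-1$ (equivalently the iterated pushout construction of the paper). $\mathcal BW^n_1(p,q-1)=\mathbb D^n(p,q-1)$, and for $r\ge2$, $\mathcal BW^n_r(p,q-1)=\mathcal ZW^n_{r-1}(p+r-1,q+r-2)\oplus\mathbb D^n(p,q-1)\oplus\mathcal ZW^n_{r-1}(p-1,q-1)$. The morphism $\iota_r\colon\mathcal ZW^n_r(p,q)\to\mathcal BW^n_r(p,q-1)$ for $r\ge1$: $\iota_1(a_0)=d_0e$ where $e$ generates $\mathbb D^n(p,q-1)$; for $r\ge2$, writing $b_0,\dots,b_{r-2}$, $e$, $c_0,\dots,c_{r-2}$ for the generators of the three summands, $\iota_r(a_j)=d_je+(-1)^j\sum_{i=j+1}^{r+j-1}(-1)^id_ib_{r+j-1-i}+c_{j-1}$ ($0\le j\le r-1$, $c_{-1}:=0$).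 Generating sets: $I^n_r=\{\iota_{r+1}\colon\mathcal ZW^n_{r+1}(p,q)\to\mathcal BW^n_{r+1}(p,q-1)\}_{p,q\in\mathbb Z}$ and $J^n_k=\{0\to\mathcal ZW^n_k(p,q)\}_{p,q\in\mathbb Z}$. *)

(* Defs.v *)
From HB Require Import structures.
From mathcomp Require Import all_boot all_order all_algebra.
Set Implicit Arguments.
Unset Strict Implicit.
Unset Printing Implicit Defensive.
Import Order.TTheory GRing.Theory Num.Theory.
Local Open Scope ring_scope.

Inductive extnat := ENat of nat | EInf.

Definition ext_le (n : extnat) (i : nat) : Prop :=
  match n with ENat m => (m <= i)%N | EInf => False end.

Definition two_le (n : extnat) : Prop :=
  match n with ENat m => (2 <= m)%N | EInf => True end.

(* Transport between bidegrees: identity when the bidegrees agree      *)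
(* (propositionally), zero otherwise.  Only ever used at the correct   *)
(* bidegree; it exists to avoid dependent-type casts.                   *)
Definition transp (R : pzRingType) (A : int -> int -> lmodType R)
    (p q : int) (x : A p q) (p' q' : int) : A p' q' :=
  match p =P p', q =P q' with
  | ReflectT e1, ReflectT e2 =>
      eq_rect q (fun y => A p' y) (eq_rect p (fun z => A z q) x p' e1) q' e2
  | _, _ => 0
  end.
Arguments transp {R A p q} x p' q'.

Section Multicomplexes.
Variable R : comPzRingType.
Variable n : extnat.

Record mcx := Mcx {
  mobj :> int -> int -> lmodType R;
  md : forall (i : nat) (p q : int),
         {linear mobj p q -> mobj (p - i%:Z) (q + 1 - i%:Z)};
  md_vanish : forall (i : nat) (p q : int) (x : mobj p q),
      ext_le n i -> md i p q x = 0;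
  md_rel : forall (l : nat) (p q : int) (x : mobj p q),
      \sum_(j < l.+1)
        (-1) ^+ (l - j) *:
          transp (md (l - j) _ _ (md j p q x)) (p - l%:Z) (q + 2 - l%:Z) = 0
}.

Record hom (A B : mcx) := Hom {
  hfun :> forall p q : int, {linear A p q -> B p q};
  hcomm : forall (i : nat) (p q : int) (x : A p q),
      hfun _ _ (md A i p q x) = md B i p q (hfun p q x)
}.

Definition hom_eq (A B : mcx) (f g : hom A B) : Prop :=
  forall p q (x : A p q), f p q x = g p q x.

Program Definition hcomp (A B C : mcx) (g : hom B C) (f : hom A B) : hom A C :=
  @Hom A C (fun p q => (g p q) \o (f p q)) _.
Next Obligation. by move=> A B C g f i p q x /=; rewrite !hcomm. Qed.

Program Definition hid (A : mcx) : hom A A :=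
  @Hom A A (fun p q => idfun) _.
Next Obligation. by []. Qed.

(* The element  sum_{i+j=l} (-1)^i d_i a_j  in A^{p-l,q+1-l}, where
   a_0 = x in A^{p,q} and a_j = a j in A^{p-j,q-j} for j >= 1.          *)
Definition zsum (A : mcx) (p q : int) (x : A p q)
    (a : forall j : nat, A (p - j%:Z) (q - j%:Z)) (l : nat)
  : A (p - l%:Z) (q + 1 - l%:Z) :=
  (-1) ^+ l *: md A l p q x +
  \sum_(1 <= j < l.+1)
     (-1) ^+ (l - j) *: transp (md A (l - j) _ _ (a j)) (p - l%:Z) (q + 1 - l%:Z).

Definition zrel (A : mcx) (p q : int) (r : nat) (x : A p q)
    (a : forall j : nat, A (p - j%:Z) (q - j%:Z)) : Prop :=
  forall l : nat, (l < r)%N -> zsum x a l = 0.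

Definition Zr (A : mcx) (r : nat) (p q : int) (x : A p q) : Prop :=
  exists a : forall j : nat, A (p - j%:Z) (q - j%:Z), zrel r x a.

Definition Br (A : mcx) (r : nat) (p q : int) (x : A p q) : Prop :=
  match r with
  | 0 => x = 0
  | _ =>
    exists b : forall k : nat, A (p + r%:Z - 1 - k%:Z) (q + r%:Z - 2 - k%:Z),
      x = \sum_(i < r) (-1) ^+ i *: transp (md A i _ _ (b (r - 1 - i)%N)) p q
      /\ forall l : nat, (l.+1 < r)%N ->
         \sum_(i < l.+1) (-1) ^+ i *:
            transp (md A i _ _ (b (l - i)%N))
                   (p + r%:Z - 1 - l%:Z) (q + r%:Z - 1 - l%:Z) = 0
  end.

(* E_r(f) is an isomorphism: the induced map Z_r/B_r -> Z_r/B_r is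
   injective and surjective in every bidegree.                          *)
Definition Er_inj (A B : mcx) (f : hom A B) (r : nat) : Prop :=
  forall p q (x : A p q), Zr r x -> Br r (f p q x) -> Br r x.

Definition Er_surj (A B : mcx) (f : hom A B) (r : nat) : Prop :=
  forall p q (y : B p q), Zr r y ->
    exists x : A p q, Zr r x /\ Br r (f p q x - y).

Definition Er_iso (A B : mcx) (f : hom A B) (r : nat) : Prop :=
  Er_inj f r /\ Er_surj f r.

Definition Er_qiso (r : nat) (A B : mcx) (f : hom A B) : Prop :=
  Er_iso f r.+1.

Definition r_fib (r : nat) (A B : mcx) (f : hom A B) : Prop :=
  forall i : nat, (i <= r)%N -> Er_surj f i.

Definition hclass := forall A B : mcx, hom A B -> Prop.

Definition csquare (A B X Y : mcx) (i : hom A B) (g : hom X Y)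
   (u : hom A X) (v : hom B Y) : Prop :=
  hom_eq (hcomp g u) (hcomp v i).

Definition llp (A B X Y : mcx) (i : hom A B) (g : hom X Y) : Prop :=
  forall (u : hom A X) (v : hom B Y), csquare i g u v ->
    exists h : hom B X, hom_eq (hcomp h i) u /\ hom_eq (hcomp g h) v.

Definition retract (A B C D : mcx) (f : hom A B) (g : hom C D) : Prop :=
  exists (i1 : hom A C) (r1 : hom C A) (i2 : hom B D) (r2 : hom D B),
    [/\ hom_eq (hcomp r1 i1) (hid A), hom_eq (hcomp r2 i2) (hid B),
        hom_eq (hcomp g i1) (hcomp i2 f) & hom_eq (hcomp f r1) (hcomp r2 g)].

Definition retract_closed (K : hclass) : Prop :=
  forall (A B C D : mcx) (f : hom A B) (g : hom C D),
    retract f g -> K C D g -> K A B f.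

Definition two_of_three (W : hclass) : Prop :=
  forall (A B C : mcx) (f : hom A B) (g : hom B C),
    [/\ W _ _ f -> W _ _ g -> W _ _ (hcomp g f),
        W _ _ f -> W _ _ (hcomp g f) -> W _ _ g &
        W _ _ g -> W _ _ (hcomp g f) -> W _ _ f].

(* small products and equalizers (hence all small limits) *)
Definition has_products : Prop :=
  forall (I : Type) (X : I -> mcx),
    exists (P : mcx) (pr : forall i, hom P (X i)),
      forall (T : mcx) (t : forall i, hom T (X i)),
        (exists u : hom T P, forall i, hom_eq (hcomp (pr i) u) (t i)) /\
        (forall u v : hom T P, (forall i, hom_eq (hcomp (pr i) u) (hcomp (pr i) v)) ->
            hom_eq u v).

Definition has_coproducts : Prop :=
  forall (I : Type) (X : I -> mcx),
    exists (S : mcx) (inj : forall i, hom (X i) S),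
      forall (T : mcx) (t : forall i, hom (X i) T),
        (exists u : hom S T, forall i, hom_eq (hcomp u (inj i)) (t i)) /\
        (forall u v : hom S T, (forall i, hom_eq (hcomp u (inj i)) (hcomp v (inj i))) ->
            hom_eq u v).

Definition has_equalizers : Prop :=
  forall (A B : mcx) (f g : hom A B),
    exists (E : mcx) (e : hom E A), hom_eq (hcomp f e) (hcomp g e) /\
      forall (T : mcx) (t : hom T A), hom_eq (hcomp f t) (hcomp g t) ->
        (exists u : hom T E, hom_eq (hcomp e u) t) /\
        (forall u v : hom T E, hom_eq (hcomp e u) (hcomp e v) -> hom_eq u v).

Definition has_coequalizers : Prop :=
  forall (A B : mcx) (f g : hom A B),
    exists (Q : mcx) (c : hom B Q), hom_eq (hcomp c f) (hcomp c g) /\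
      forall (T : mcx) (t : hom B T), hom_eq (hcomp t f) (hcomp t g) ->
        (exists u : hom Q T, hom_eq (hcomp u c) t) /\
        (forall u v : hom Q T, hom_eq (hcomp u c) (hcomp v c) -> hom_eq u v).

(* Model structure with weak equivalences W, cofibrations C, fibrations F
   (Quillen's closed model category axioms, as in Hovey, Def. 1.1.3, but
   with non-functorial factorizations). *)
Definition model_structure (W C F : hclass) : Prop :=
  [/\ (has_products /\ has_equalizers) /\ (has_coproducts /\ has_coequalizers),
      two_of_three W,
      retract_closed W /\ retract_closed C /\ retract_closed F,
      (forall (A B X Y : mcx) (i : hom A B) (g : hom X Y),
          C _ _ i -> W _ _ g -> F _ _ g -> llp i g) /\
      (forall (A B X Y : mcx) (i : hom A B) (g : hom X Y),
          C _ _ i -> W _ _ i -> F _ _ g -> llp i g) &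
      (forall (A B : mcx) (f : hom A B),
          exists (M : mcx) (i : hom A M) (p : hom M B),
            hom_eq (hcomp p i) f /\ [/\ C _ _ i, W _ _ p & F _ _ p]) /\
      (forall (A B : mcx) (f : hom A B),
          exists (M : mcx) (i : hom A M) (p : hom M B),
            hom_eq (hcomp p i) f /\ [/\ C _ _ i, W _ _ i & F _ _ p])].

Definition is_pullback (P A B C : mcx) (pa : hom P A) (pb : hom P B)
    (f : hom A C) (g : hom B C) : Prop :=
  hom_eq (hcomp f pa) (hcomp g pb) /\
  forall (T : mcx) (ta : hom T A) (tb : hom T B),
    hom_eq (hcomp f ta) (hcomp g tb) ->
    (exists u : hom T P, hom_eq (hcomp pa u) ta /\ hom_eq (hcomp pb u) tb) /\
    (forall u v : hom T P, hom_eq (hcomp pa u) (hcomp pa v) ->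
        hom_eq (hcomp pb u) (hcomp pb v) -> hom_eq u v).

Definition right_proper (W F : hclass) : Prop :=
  forall (P A B C : mcx) (pa : hom P A) (pb : hom P B) (f : hom A C) (g : hom B C),
    is_pullback pa pb f g -> W _ _ f -> F _ _ g -> W _ _ pb.

(* Smallness of domains: D is finitely presentable (compact), i.e.
   Hom(D,-) commutes with directed colimits. *)
Definition compact (D : mcx) : Prop :=
  forall (I : Type) (le : I -> I -> Prop)
         (X : I -> mcx) (t : forall i j, le i j -> hom (X i) (X j))
         (Cl : mcx) (c : forall i, hom (X i) Cl),
    (exists i : I, True) ->
    (forall i, le i i) ->
    (forall i j k, le i j -> le j k -> le i k) ->
    (forall i j, exists k, le i k /\ le j k) ->
    (forall i (e : le i i), hom_eq (t i i e) (hid (X i))) ->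
    (forall i j k (e1 : le i j) (e2 : le j k) (e3 : le i k),
        hom_eq (t i k e3) (hcomp (t j k e2) (t i j e1))) ->
    (forall i j (e : le i j), hom_eq (hcomp (c j) (t i j e)) (c i)) ->
    (forall (T : mcx) (s : forall i, hom (X i) T),
        (forall i j (e : le i j), hom_eq (hcomp (s j) (t i j e)) (s i)) ->
        (exists u : hom Cl T, forall i, hom_eq (hcomp u (c i)) (s i)) /\
        (forall u v : hom Cl T, (forall i, hom_eq (hcomp u (c i)) (hcomp v (c i))) ->
            hom_eq u v)) ->
    (forall g : hom D Cl, exists i (h : hom D (X i)), hom_eq (hcomp (c i) h) g) /\
    (forall i (h h' : hom D (X i)), hom_eq (hcomp (c i) h) (hcomp (c i) h') ->
        exists j (e : le i j), hom_eq (hcomp (t i j e) h) (hcomp (t i j e) h')).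

Record mapset := MapSet {
  ms_idx : Type;
  ms_dom : ms_idx -> mcx;
  ms_cod : ms_idx -> mcx;
  ms_map : forall t, hom (ms_dom t) (ms_cod t)
}.

Definition rlp (S : mapset) : hclass :=
  fun X Y g => forall t : ms_idx S, llp (ms_map t) g.

Definition cofibrantly_generated (W C F : hclass) (I J : mapset) : Prop :=
  [/\ model_structure W C F,
      (forall t, compact (@ms_dom I t)),
      (forall t, compact (@ms_dom J t)),
      (forall X Y (g : hom X Y), F _ _ g <-> rlp J g) &
      (forall X Y (g : hom X Y), (W _ _ g /\ F _ _ g) <-> rlp I g)].

Definition initial (O : mcx) : Prop :=
  forall A : mcx, (exists f : hom O A, True) /\ (forall f g : hom O A, hom_eq f g).

(* ZW^n_r(p,q): generated by a_0 = g0 in bidegree (p,q) and a_j = g j in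
   bidegree (p-j,q-j), 1 <= j <= r-1, subject to the relations
   sum_{i+j=l} (-1)^i d_i a_j = 0, 0 <= l <= r-1.  (For r = 0 this is
   D^n(p,q), free on g0.)                                                *)
Definition is_ZW (r : nat) (p q : int) (Z : mcx) (g0 : Z p q)
    (g : forall j : nat, Z (p - j%:Z) (q - j%:Z)) : Prop :=
  [/\ zrel r g0 g,
      (forall (A : mcx) (a0 : A p q) (a : forall j : nat, A (p - j%:Z) (q - j%:Z)),
          zrel r a0 a ->
          exists f : hom Z A, f p q g0 = a0 /\
            forall j : nat, (1 <= j < r)%N -> f _ _ (g j) = a j) &
      (forall (A : mcx) (f f' : hom Z A), f p q g0 = f' p q g0 ->
          (forall j : nat, (1 <= j < r)%N -> f _ _ (g j) = f' _ _ (g j)) ->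
          hom_eq f f')].

(* BW^n_s(p,q-1).  For s = 1 it is D^n(p,q-1), free on e.  For s >= 2 it is
   ZW_{s-1}(p+s-1,q+s-2) (+) D(p,q-1) (+) ZW_{s-1}(p-1,q-1), i.e. generated
   by b_0 = b0, b_k = b k (bidegree (p+s-1-k,q+s-2-k)), e (bidegree (p,q-1)),
   c_0 = c0, c_k = c k (bidegree (p-1-k,q-1-k)), 0 <= k <= s-2, with the
   ZW_{s-1} relations on the b's and on the c's.                          *)
Definition is_BW (s : nat) (p q : int) (Bo : mcx)
    (b0 : Bo (p + s%:Z - 1) (q + s%:Z - 2))
    (b : forall k : nat, Bo (p + s%:Z - 1 - k%:Z) (q + s%:Z - 2 - k%:Z))
    (e : Bo p (q - 1))
    (c0 : Bo (p - 1) (q - 1))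
    (c : forall k : nat, Bo (p - 1 - k%:Z) (q - 1 - k%:Z)) : Prop :=
  let gens_agree (A : mcx) (f f' : hom Bo A) :=
    f _ _ e = f' _ _ e /\
    ((2 <= s)%N ->
      [/\ f _ _ b0 = f' _ _ b0,
          (forall k : nat, (1 <= k < s.-1)%N -> f _ _ (b k) = f' _ _ (b k)),
          f _ _ c0 = f' _ _ c0 &
          (forall k : nat, (1 <= k < s.-1)%N -> f _ _ (c k) = f' _ _ (c k))]) in
  [/\ (2 <= s)%N -> zrel s.-1 b0 b /\ zrel s.-1 c0 c,
      (forall (A : mcx) (e' : A p (q - 1))
              (b0' : A (p + s%:Z - 1) (q + s%:Z - 2))
              (b' : forall k : nat, A (p + s%:Z - 1 - k%:Z) (q + s%:Z - 2 - k%:Z))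
              (c0' : A (p - 1) (q - 1))
              (c' : forall k : nat, A (p - 1 - k%:Z) (q - 1 - k%:Z)),
          ((2 <= s)%N -> zrel s.-1 b0' b' /\ zrel s.-1 c0' c') ->
          exists f : hom Bo A,
            f _ _ e = e' /\
            ((2 <= s)%N ->
              [/\ f _ _ b0 = b0',
                  (forall k : nat, (1 <= k < s.-1)%N -> f _ _ (b k) = b' k),
                  f _ _ c0 = c0' &
                  (forall k : nat, (1 <= k < s.-1)%N -> f _ _ (c k) = c' k)])) &
      (forall (A : mcx) (f f' : hom Bo A), gens_agree A f f' -> hom_eq f f')].

(* The image of the generator a_j under iota_s, placed in bidegree (P,Q)
   (= (p-j,q-j)):
     d_j e + (-1)^j sum_{i=j+1}^{s+j-1} (-1)^i d_i b_{s+j-1-i} + c_{j-1},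
   with c_{-1} := 0 (and the b, c terms absent when s = 1).            *)
Definition iota_img (s : nat) (p q : int) (Bo : mcx)
    (b0 : Bo (p + s%:Z - 1) (q + s%:Z - 2))
    (b : forall k : nat, Bo (p + s%:Z - 1 - k%:Z) (q + s%:Z - 2 - k%:Z))
    (e : Bo p (q - 1))
    (c0 : Bo (p - 1) (q - 1))
    (c : forall k : nat, Bo (p - 1 - k%:Z) (q - 1 - k%:Z))
    (j : nat) (P Q : int) : Bo P Q :=
  transp (md Bo j _ _ e) P Q +
  (if (2 <= s)%N then
     (-1) ^+ j *:
       \sum_(j.+1 <= i < s + j)
         (-1) ^+ i *:
           (let k := (s + j - 1 - i)%N in
            if k == 0%N then transp (md Bo i _ _ b0) P Q
            else transp (md Bo i _ _ (b k)) P Q)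
     + (match j with
        | 0 => 0
        | 1 => transp c0 P Q
        | j'.+1 => transp (c j') P Q
        end)
   else 0).

Definition is_iota (s : nat) (p q : int) (Z : mcx) (g0 : Z p q)
    (g : forall j : nat, Z (p - j%:Z) (q - j%:Z)) (Bo : mcx)
    (b0 : Bo (p + s%:Z - 1) (q + s%:Z - 2))
    (b : forall k : nat, Bo (p + s%:Z - 1 - k%:Z) (q + s%:Z - 2 - k%:Z))
    (e : Bo p (q - 1))
    (c0 : Bo (p - 1) (q - 1))
    (c : forall k : nat, Bo (p - 1 - k%:Z) (q - 1 - k%:Z))
    (f : hom Z Bo) : Prop :=
  f p q g0 = iota_img b0 b e c0 c 0 p q /\
  forall j : nat, (1 <= j < s)%N ->
    f _ _ (g j) = iota_img b0 b e c0 c j (p - j%:Z) (q - j%:Z).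

Record gen_data (r : nat) := GenData {
  gd_O : mcx;
  gd_ZW : nat -> int -> int -> mcx;
  gd_zg0 : forall k p q, gd_ZW k p q p q;
  gd_zg : forall k p q (j : nat), gd_ZW k p q (p - j%:Z) (q - j%:Z);
  gd_BW : int -> int -> mcx;
  gd_b0 : forall p q, gd_BW p q (p + (r.+1)%:Z - 1) (q + (r.+1)%:Z - 2);
  gd_b : forall p q (k : nat),
      gd_BW p q (p + (r.+1)%:Z - 1 - k%:Z) (q + (r.+1)%:Z - 2 - k%:Z);
  gd_e : forall p q, gd_BW p q p (q - 1);
  gd_c0 : forall p q, gd_BW p q (p - 1) (q - 1);
  gd_c : forall p q (k : nat), gd_BW p q (p - 1 - k%:Z) (q - 1 - k%:Z);
  gd_zero : forall k p q, hom gd_O (gd_ZW k p q);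
  gd_iota : forall p q, hom (gd_ZW r.+1 p q) (gd_BW p q)
}.

Definition gen_data_ok (r : nat) (G : gen_data r) : Prop :=
  [/\ initial (gd_O G),
      (forall k p q, is_ZW k (gd_zg0 G k p q) (gd_zg G k p q)),
      (forall p q, is_BW (gd_b0 G p q) (gd_b G p q) (gd_e G p q)
                         (gd_c0 G p q) (gd_c G p q)) &
      (forall p q, is_iota (gd_zg0 G r.+1 p q) (gd_zg G r.+1 p q)
                     (gd_b0 G p q) (gd_b G p q) (gd_e G p q)
                     (gd_c0 G p q) (gd_c G p q) (gd_iota G p q))].

Definition J_range (r : nat) (G : gen_data r) (lo hi : nat) : mapset :=
  @MapSet {x : nat * int * int | (lo <= x.1.1 <= hi)%N}
          (fun _ => gd_O G)
          (fun x => gd_ZW G (sval x).1.1 (sval x).1.2 (sval x).2)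
          (fun x => gd_zero G (sval x).1.1 (sval x).1.2 (sval x).2).

Definition I_prime (r : nat) (G : gen_data r) : mapset :=
  @MapSet ({x : nat * int * int | (1 <= x.1.1 <= r.-1)%N} + (int * int))
    (fun t => match t with inl _ => gd_O G | inr pq => gd_ZW G r.+1 pq.1 pq.2 end)
    (fun t => match t with
              | inl x => gd_ZW G (sval x).1.1 (sval x).1.2 (sval x).2
              | inr pq => gd_BW G pq.1 pq.2 end)
    (fun t => match t with
              | inl x => gd_zero G (sval x).1.1 (sval x).1.2 (sval x).2
              | inr pq => gd_iota G pq.1 pq.2 end).

Definition J_prime (r : nat) (G : gen_data r) : mapset := J_range G 0 r.

End Multicomplexes.

(* Main.v *)
Require Import Defs.
From HB Require Import structures.
From mathcomp Require Import all_boot all_order all_algebra.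
From mathcomp Require Import boolp zify ring.
Import Defs.
Set Implicit Arguments.
Unset Strict Implicit.
Unset Printing Implicit Defensive.
Import Order.TTheory GRing.Theory Num.Theory.
Local Open Scope ring_scope.

(** Elements of a multicomplex are organised into formal series, on which
    D(t) = sum_i (-1)^i d_i t^i acts; the multicomplex relations say exactly
    D(t) D(-t) = 0. An r-cycle is the constant term of a series s with
    D s = O(t^r), and an (r+1)-boundary is an x with D s = t^r x + O(t^(r+1)).

    Fibrations are the maps along which k-cycles lift, series and all, for
    k <= r: correct the constant term by a boundary dc, lift c, and divide the
    rest by t. The same splitting of cycles gives right properness and
    identifies the trivial fibrations with the maps having the right lifting
    property against (I_r)'.

    Colimits, the representing objects and both factorizations come from one
    construction: closed terms modulo equality in all models of a class. The
    factorization through a trivial fibration is the initial object over B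
    with chosen lifts and fillers, which replaces the transfinite small object
    argument. The trivial cofibrations A -> M of the other factorization are
    E_r-quasi-isomorphisms because M minus A lifts to a cone built from a
    staircase of length r: this cone has zero E_(r+1) page and maps to M by a
    fibration. The staircase uses d_0 and d_1 only, hence n >= 2. *)

(** * Formal series in a multicomplex *)

(** The components of a multicomplex are indexed by bidegrees that agree only up to arithmetic.
    Computations therefore take place in the product [Tot] of all components, where every d_i is an
    endomorphism. A series in [Tot] splits into strands, one for each bidegree of the constant term,
    and D maps strands to strands. A statement about pages concerns one bidegree, so its
    consequences are found strand by strand and then glued.

    Term models avoid transfinite iteration because a filler is an operation applied to the element
    to be filled: it applies as well to elements that already contain fillers.

    The length of the staircase is forced from both sides. A k-cycle m lifts to the cone as the sum
    of the t^a m on b_a, and the error at the last arrow is t^r m, harmless exactly because k <= r.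
    Conversely, contracting an (r+1)-cycle of the cone means solving for the b-components from the
    last arrow backwards, with at most r divisions of t^r by t. *)

Section DependentFunctions.
Variables (R : pzRingType) (I : Type) (V : I -> lmodType R).

Definition dfun := forall i, V i.

HB.instance Definition _ := gen_eqMixin dfun.
HB.instance Definition _ := gen_choiceMixin dfun.

Program Definition dfun_zmodMixin := @GRing.isZmodule.Build dfun
  (fun i => 0) (fun f i => - f i) (fun f g i => f i + g i) _ _ _ _.
Next Obligation. by move=> f g h; apply: functional_extensionality_dep => i; rewrite addrA. Qed.
Next Obligation. by move=> f g; apply: functional_extensionality_dep => i; rewrite addrC. Qed.
Next Obligation. by move=> f; apply: functional_extensionality_dep => i; rewrite add0r. Qed.
Next Obligation. by move=> f; apply: functional_extensionality_dep => i; rewrite addNr. Qed.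
HB.instance Definition _ := dfun_zmodMixin.

Program Definition dfun_lmodMixin := @GRing.Zmodule_isLmodule.Build R dfun
  (fun a f i => a *: f i) _ _ _ _.
Next Obligation. by move=> *; apply: functional_extensionality_dep => i; rewrite scalerA. Qed.
Next Obligation. by move=> *; apply: functional_extensionality_dep => i; rewrite scale1r. Qed.
Next Obligation. by move=> *; apply: functional_extensionality_dep => i; rewrite scalerDr. Qed.
Next Obligation. by move=> *; apply: functional_extensionality_dep => i; rewrite scalerDl. Qed.
HB.instance Definition _ := dfun_lmodMixin.

Lemma dfun_ext (f g : dfun) : (forall i, f i = g i) -> f = g.
Proof. exact: functional_extensionality_dep. Qed.

Lemma dfun0E i : (0 : dfun) i = 0. Proof. by []. Qed.
Lemma dfunDE (f g : dfun) i : (f + g) i = f i + g i. Proof. by []. Qed.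
Lemma dfunNE (f : dfun) i : (- f) i = - f i. Proof. by []. Qed.
Lemma dfunZE a (f : dfun) i : (a *: f) i = a *: f i. Proof. by []. Qed.

Lemma dfun_sumE (J : Type) (r : seq J) (P : pred J) (F : J -> dfun) i :
  (\sum_(j <- r | P j) F j) i = \sum_(j <- r | P j) F j i.
Proof. by elim/big_rec2: _ => // j f g _ <-. Qed.
End DependentFunctions.

Definition dfunE := (dfun0E, dfunDE, dfunNE, dfunZE, dfun_sumE).

Section Transport.
Variable R : pzRingType.
Implicit Types A B : int -> int -> lmodType R.

Lemma transp_id A p q (x : A p q) : transp x p q = x.
Proof.
rewrite /transp; case: eqP => // e1; case: eqP => // e2.
by rewrite (eq_irrelevance e1 erefl) (eq_irrelevance e2 erefl).
Qed.

Lemma transp_neq A p q (x : A p q) p' q' :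
  ~~ ((p == p') && (q == q')) -> transp x p' q' = 0.
Proof. by rewrite /transp; case: eqP => // e1; case: eqP => // e2. Qed.

Lemma transp_fun A (X : forall p q, A p q) p q p' q' :
  transp (X p q) p' q' = if (p == p') && (q == q') then X p' q' else 0.
Proof.
case: ifP => [/andP[/eqP<- /eqP<-]|/negbT]; first exact: transp_id.
exact: transp_neq.
Qed.

Lemma transp_nat A B (h : forall p q, A p q -> B p q) p q (x : A p q) p' q' :
  h p' q' 0 = 0 -> h p' q' (transp x p' q') = transp (h p q x) p' q'.
Proof.
case e : ((p == p') && (q == q')); last by move=> h0; rewrite !transp_neq ?e.
by case/andP: e => /eqP e1 /eqP e2; subst p' q'; rewrite !transp_id.
Qed.

Lemma transp_is_linear A p q p' q' :
  linear (fun x : A p q => transp x p' q').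
Proof.
move=> a x y; case e : ((p == p') && (q == q')).
  by case/andP: e => /eqP e1 /eqP e2; subst p' q'; rewrite !transp_id.
by rewrite !transp_neq ?e // scaler0 addr0.
Qed.

Lemma transp0 A p q p' q' : transp (0 : A p q) p' q' = 0.
Proof. by rewrite -(@transp_nat A A (fun p q _ => 0) p q 0). Qed.

Lemma transpZ A a p q (x : A p q) p' q' :
  transp (a *: x) p' q' = a *: transp x p' q'.
Proof. by rewrite -[a *: x]addr0 transp_is_linear transp0 addr0. Qed.

Lemma transp_sum A p q p' q' (J : Type) (r : seq J) (P : pred J) (F : J -> A p q) :
  transp (\sum_(j <- r | P j) F j) p' q' = \sum_(j <- r | P j) transp (F j) p' q'.
Proof.
elim/big_rec2: _ => [|j y z _ <-]; first exact: transp0.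
by rewrite -[F j]scale1r transp_is_linear !scale1r.
Qed.

End Transport.

(** * Total families, their series, and the operator D *)

Section Tot.
Variables (R : comPzRingType) (n : extnat).
Implicit Types A B : mcx R n.

(** A product and not a direct sum, so that lifts chosen independently in all bidegrees still form
    one element. *)
Definition Tot A : lmodType R :=
  @dfun R int (fun p => @dfun R int (fun q => A p q)).
Definition ser A : lmodType R := @dfun R nat (fun _ => Tot A).

Lemma tot_ext A (x y : Tot A) : (forall p q, x p q = y p q) -> x = y.
Proof. by move=> e; apply: dfun_ext => p; apply: dfun_ext => q. Qed.

Lemma ser_ext A (s t : ser A) : (forall l, s l = t l) -> s = t.
Proof. exact: dfun_ext. Qed.

Definition homog A p q (x : A p q) : Tot A := fun p' q' => transp x p' q'.

Lemma homog_id A p q (x : A p q) : homog x p q = x.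
Proof. exact: transp_id. Qed.

Definition delta A i (x : Tot A) : Tot A :=
  fun p q => transp (md A i (p + i%:Z) (q - 1 + i%:Z) (x (p + i%:Z) (q - 1 + i%:Z))) p q.

Lemma delta_is_linear A i : linear (@delta A i).
Proof.
move=> a x y; apply: tot_ext => p q; rewrite /delta !dfunE linearP.
exact: transp_is_linear.
Qed.
HB.instance Definition _ A i :=
  GRing.isLinear.Build R (Tot A) (Tot A) _ (@delta A i) (@delta_is_linear A i).

Lemma deltaE A i (x : Tot A) p q p' q' : p' = p - i%:Z -> q' = q + 1 - i%:Z ->
  delta i x p' q' = transp (md A i p q (x p q)) p' q'.
Proof.
move=> -> ->; rewrite /delta.
have -> : p - i%:Z + i%:Z = p by ring.
by have -> : q + 1 - i%:Z - 1 + i%:Z = q by ring.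
Qed.

Lemma md_delta A i (x : Tot A) p q :
  md A i p q (x p q) = delta i x (p - i%:Z) (q + 1 - i%:Z).
Proof. by rewrite (deltaE x erefl erefl) transp_id. Qed.

Lemma transp_md A i p q (x : A p q) p' q' :
  transp (md A i p q x) p' q' = delta i (homog x) p' q'.
Proof.
rewrite -[x in LHS]homog_id md_delta transp_fun.
case: ifP => // e; rewrite /delta /homog (transp_neq x) ?linear0 ?transp0 //.
apply: contraFN e => /andP[/eqP-> /eqP->]; apply/andP; split; apply/eqP; ring.
Qed.

Lemma delta_vanish A i (x : Tot A) : ext_le n i -> delta i x = 0.
Proof.
move=> h; apply: tot_ext => p q; rewrite /delta md_vanish //.
exact: transp0.
Qed.

Lemma delta_rel A l (x : Tot A) :
  \sum_(j < l.+1) (-1) ^+ (l - j) *: delta (l - j) (delta j x) = 0.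
Proof.
apply: tot_ext => p q; rewrite !dfunE.
have := md_rel l (x (p + l%:Z) (q - 2 + l%:Z)).
move=> /(congr1 (fun z => transp z p q)); rewrite transp0 transp_sum => e.
rewrite -[RHS]e; apply: eq_bigr => j _; rewrite !dfunE [in RHS]transpZ; congr (_ *: _).
rewrite !md_delta; set y := delta _ _; rewrite [in RHS]transp_fun.
have lj := ltn_ord j; rewrite ifT; last first.
  by apply/andP; split; apply/eqP; lia.
rewrite transp_fun ifT //; by apply/andP; split; apply/eqP; lia.
Qed.

(* A series s stands for sum_l s_l t^l, and [ser_neg] below for t -> -t. *)
Definition ser_d A (s : ser A) : ser A :=
  fun l => \sum_(i < l.+1) (-1) ^+ i *: delta i (s (l - i)%N).

Lemma ser_d_is_linear A : linear (@ser_d A).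
Proof.
move=> a s t; apply: ser_ext => l; rewrite /ser_d dfunE dfunE scaler_sumr -big_split /=.
apply: eq_bigr => i _; rewrite !dfunE linearP scalerDr !scalerA; congr (_ *: _ + _).
by rewrite mulrC.
Qed.
HB.instance Definition _ A :=
  GRing.isLinear.Build R (ser A) (ser A) _ (@ser_d A) (@ser_d_is_linear A).

Definition ser_neg A (s : ser A) : ser A := fun l => (-1) ^+ l *: s l.

Lemma ser_neg_is_linear A : linear (@ser_neg A).
Proof.
move=> a s t; apply: ser_ext => l; rewrite /ser_neg !dfunE scalerDr !scalerA.
by rewrite mulrC.
Qed.
HB.instance Definition _ A :=
  GRing.isLinear.Build R (ser A) (ser A) _ (@ser_neg A) (@ser_neg_is_linear A).

Lemma ser_negK A : involutive (@ser_neg A).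
Proof. by move=> s; apply: ser_ext => l; rewrite /ser_neg scalerA -expr2 sqrr_sign scale1r. Qed.

Lemma ser_neg0 A (s : ser A) : ser_neg s 0%N = s 0%N.
Proof. by rewrite /ser_neg expr0 scale1r. Qed.

Definition ser_shift A (s : ser A) : ser A :=
  fun l => if l is l'.+1 then s l' else 0.
Lemma ser_shift_is_linear A : linear (@ser_shift A).
Proof. by move=> a s t; apply: ser_ext => -[|l] //=; rewrite !dfunE scaler0 addr0. Qed.
HB.instance Definition _ A :=
  GRing.isLinear.Build R (ser A) (ser A) _ (@ser_shift A) (@ser_shift_is_linear A).

Lemma ser_d_shift A (s : ser A) : ser_d (ser_shift s) = ser_shift (ser_d s).
Proof.
apply: ser_ext => -[|l]; rewrite /ser_d /=; first by rewrite big_ord1 linear0 scaler0.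
rewrite big_ord_recr /= subnn linear0 scaler0 addr0; apply: eq_bigr => i _.
by rewrite subSn // -ltnS.
Qed.

(** In the coefficient of t^l the term d_i d_j s_(l-m), with m = i + j, has sign (-1)^(l+j) =
    (-1)^(l+m) (-1)^(m-j). For fixed m the sum over j is thus, up to a global sign, the multicomplex
    relation in degree m. *)
Lemma ser_dND A (s : ser A) : ser_d (ser_neg (ser_d s)) = 0.
Proof.
apply: ser_ext => l; rewrite /ser_d /ser_neg.
have -> : (0 : ser A) l =
    \sum_(m < l.+1) (-1) ^+ (l + m) *: \sum_(j < m.+1) (-1) ^+ (m - j) *: delta (m - j) (delta j (s (l - m)%N)).
  by rewrite big1 // => m _; rewrite delta_rel scaler0.
transitivity (\sum_(i < l.+1) \sum_(j < l.+1 | (i + j <= l)%N)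
    (-1) ^+ (l + j) *: delta i (delta j (s (l - (i + j))%N))).
  apply: eq_bigr => i _; rewrite linearZ scalerA /= raddf_sum scaler_sumr.
  have le : ((l - i).+1 <= l.+1)%N by lia.
  rewrite (big_ord_widen _ (fun j => (-1) ^+ i * (-1) ^+ (l - i) *: delta i ((-1) ^+ j *: delta j (s (l - i - j)%N))) le).
  apply: eq_big => [j|j _]; first by have := ltn_ord i; lia.
  rewrite linearZ scalerA -!exprD subnDA; congr (_ ^+ _ *: _).
  by have := ltn_ord i; lia.
transitivity (\sum_(j < l.+1) \sum_(m < l.+1 | (j <= m)%N)
    (-1) ^+ (l + j) *: delta (m - j) (delta j (s (l - m)%N))); last first.
  rewrite (exchange_big_dep xpredT) //=; apply: eq_bigr => m _.
  rewrite scaler_sumr.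
  rewrite (big_ord_widen _ (fun j => (-1) ^+ (l + m) *: ((-1) ^+ (m - j) *: delta (m - j) (delta j (s (l - m)%N)))) (ltn_ord m)).
  apply: eq_big => [j|j /= le]; first by rewrite ltnS.
  rewrite scalerA -!exprD -[in LHS]signr_odd -[in RHS]signr_odd; congr (_ ^+ _ *: _).
  by move: le; lia.
rewrite (exchange_big_dep xpredT) //=; apply: eq_bigr => j _.
have le : ((l - j).+1 <= l.+1)%N by lia.
transitivity (\sum_(i < (l - j).+1) (-1) ^+ (l + j) *: delta i (delta j (s (l - (i + j))%N))).
  rewrite (big_ord_widen _ (fun i => (-1) ^+ (l + j) *: delta i (delta j (s (l - (i + j))%N))) le).
  by apply: eq_bigl => i; have := ltn_ord j; lia.
rewrite -[in LHS](big_mkord xpredT (fun i => (-1) ^+ (l + j) *: delta i (delta j (s (l - (i + j))%N)))).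
rewrite -(big_mkord (fun m => (j <= m)%N) (fun m => (-1) ^+ (l + j) *: delta (m - j) (delta j (s (l - m)%N)))).
rewrite [RHS](big_cat_nat (n := j)) //=; last by have := ltn_ord j; lia.
rewrite [X in _ = X + _]big_nat_cond [X in _ = X + _]big1 ?add0r; last by move=> i; lia.
have sh F : \sum_(j <= m < l.+1 | (j <= m)%N) F m = \sum_(0 <= i < (l - j).+1) F (i + j)%N :> Tot A.
  rewrite -{1}[j : nat]add0n big_addn subSn; last by have := ltn_ord j; lia.
  by apply: eq_bigl => i; lia.
by rewrite sh; apply: eq_bigr => i _; rewrite addnK.
Qed.

Definition ord_ge A k (s : ser A) := forall l, (l < k)%N -> s l = 0.

Lemma ord_geD A k (s t : ser A) : ord_ge k s -> ord_ge k t -> ord_ge k (s + t).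
Proof. by move=> hs ht l lk; rewrite dfunE hs // ht // addr0. Qed.
Lemma ord_geN A k (s : ser A) : ord_ge k s -> ord_ge k (- s).
Proof. by move=> hs l lk; rewrite dfunE hs // oppr0. Qed.
Lemma ord_geB A k (s t : ser A) : ord_ge k s -> ord_ge k t -> ord_ge k (s - t).
Proof. by move=> hs ht; apply: ord_geD => //; apply: ord_geN. Qed.
Lemma ord_ge0 A k : ord_ge k (0 : ser A). Proof. by []. Qed.
Lemma ord_ge_le A k k' (s : ser A) : (k <= k')%N -> ord_ge k' s -> ord_ge k s.
Proof. by move=> le h l lk; apply: h; apply: leq_trans le. Qed.
Lemma ord_ge_shift A k (s : ser A) : ord_ge k s -> ord_ge k.+1 (ser_shift s).
Proof. by move=> h [|l] //= lk; apply: h. Qed.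
Lemma ord_geS A k (s : ser A) : ord_ge k s -> s k = 0 -> ord_ge k.+1 s.
Proof. by move=> h h0 l; rewrite ltnS leq_eqVlt => /orP[/eqP->|/h]. Qed.

Lemma ser_d_ord A k (s : ser A) : ord_ge k s -> ord_ge k (ser_d s).
Proof.
move=> h l lk; rewrite /ser_d big1 // => i _; rewrite h ?linear0 ?scaler0 //.
exact: leq_ltn_trans (leq_subr _ _) lk.
Qed.

Definition ser_drop A k (s : ser A) : ser A := fun l => s (k + l)%N.

Lemma ser_drop1K A (s : ser A) : s 0%N = 0 -> ser_shift (ser_drop 1 s) = s.
Proof. by move=> h; apply: ser_ext => -[|l] //=. Qed.

Lemma ser_d_drop1 A (s : ser A) k : s 0%N = 0 -> ord_ge k.+1 (ser_d s) ->
  ord_ge k (ser_d (ser_drop 1 s)).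
Proof.
move=> /ser_drop1K e h l lk.
by have := h l.+1 lk; rewrite -e ser_d_shift.
Qed.

(* [ser_drop k (ser_d s)] is the value on [s] of the k-th differential of the
   spectral sequence; it is a permanent cycle up to the substitution t -> -t. *)
Lemma ser_d_neg_drop A k (s : ser A) : ord_ge k (ser_d s) ->
  ser_d (ser_neg (ser_drop k (ser_d s))) = 0.
Proof.
move: (ser_d s) (ser_dND s) => {s}; elim: k => [|k IH] s e h.
  rewrite (_ : ser_drop 0 s = s) //; exact: ser_ext.
have s0 : s 0%N = 0 by apply: h.
rewrite (_ : ser_drop k.+1 s = ser_drop k (ser_drop 1 s)); last first.
  by apply: ser_ext => l; rewrite /ser_drop add1n addSn.
apply: IH; last by move=> l lk; apply: h.
move: e; rewrite -{1}(ser_drop1K s0).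
rewrite (_ : ser_neg _ = - ser_shift (ser_neg (ser_drop 1 s))); last first.
  apply: ser_ext => -[|l]; rewrite !dfunE /ser_neg /= ?scaler0 ?oppr0 //.
  by rewrite exprS mulN1r scaleNr.
rewrite (linearN (@ser_d A)) /= ser_d_shift => e.
by apply: ser_ext => l; have := congr1 (fun z : ser A => - z l.+1) e; rewrite !dfunE /= opprK oppr0.
Qed.

Definition ser_trunc A k (s : ser A) : ser A := fun l => if (l < k)%N then s l else 0.
Lemma ser_d_eq A k (s t : ser A) : (forall l, (l < k)%N -> s l = t l) ->
  forall l, (l < k)%N -> ser_d s l = ser_d t l.
Proof.
move=> h l lk; rewrite /ser_d; apply: eq_bigr => i _; rewrite h //.
exact: leq_ltn_trans (leq_subr _ _) lk.
Qed.

(** Coefficient l in bidegree (p,q) belongs to the strand whose constant term lies in (p+l,q+l).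
    Each strand is taken from the series assigned to its starting bidegree. As D raises q by one,
    the same strand of the image starts one step higher in q. *)
Definition glue A (s : int -> int -> ser A) : ser A :=
  fun l p q => s (p + l%:Z) (q + l%:Z) l p q.

Lemma ser_dE A (s : ser A) l p q :
  ser_d s l p q = \sum_(i < l.+1) (-1) ^+ i *: delta i (s (l - i)%N) p q.
Proof. by rewrite /ser_d !dfunE; apply: eq_bigr => i _; rewrite !dfunE. Qed.

Lemma ser_d_glue A (s : int -> int -> ser A) l p q :
  ser_d (glue s) l p q = ser_d (s (p + l%:Z) (q - 1 + l%:Z)) l p q.
Proof.
rewrite !ser_dE; apply: eq_bigr => i _; congr (_ *: _).
have le := ltn_ord i; rewrite /delta /glue.
have -> : p + i%:Z + (l - i)%N%:Z = p + l%:Z by lia.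
by have -> : q - 1 + i%:Z + (l - i)%N%:Z = q - 1 + l%:Z by lia.
Qed.

Definition strand A p q (s : ser A) : ser A :=
  glue (fun p' q' => if (p' == p) && (q' == q) then s else 0).

Lemma strandE A p q (s : ser A) l p' q' : strand p q s l p' q' =
  if (p' == p - l%:Z) && (q' == q - l%:Z) then s l p' q' else 0.
Proof.
rewrite /strand /glue (_ : (p' + _ == _) = (p' == p - l%:Z)); last by lia.
by rewrite (_ : (q' + _ == _) = (q' == q - l%:Z)); [case: ifP | lia].
Qed.

Lemma ser_d_strand A p q (s : ser A) :
  ser_d (strand p q s) = strand p (q + 1) (ser_d s).
Proof.
apply: ser_ext => l; apply: tot_ext => p' q'; rewrite ser_d_glue strandE.
have -> : (p' + l%:Z == p) = (p' == p - l%:Z) by lia.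
have -> : (q' - 1 + l%:Z == q) = (q' == q + 1 - l%:Z) by lia.
by case: ifP => //; rewrite linear0.
Qed.
End Tot.
Arguments delta {R n A}.

(** * Pages of the spectral sequence *)

Section Pages.
Variables (R : comPzRingType) (n : extnat).
Implicit Types A B C : mcx R n.

Definition hser A B (f : hom A B) (s : ser A) : ser B := fun l p q => f p q (s l p q).

Lemma hser_is_linear A B (f : hom A B) : linear (hser f).
Proof.
move=> a s t; apply: ser_ext => l; apply: tot_ext => p q.
by rewrite /hser !dfunE linearP.
Qed.
HB.instance Definition _ A B (f : hom A B) :=
  GRing.isLinear.Build R (ser A) (ser B) _ (hser f) (hser_is_linear f).

Lemma hom_transp A B (f : hom A B) p q (x : A p q) p' q' :
  f p' q' (transp x p' q') = transp (f p q x) p' q'.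
Proof. by rewrite (transp_nat (h := fun p q => f p q)) // linear0. Qed.

Lemma hser_d A B (f : hom A B) (s : ser A) : ser_d (hser f s) = hser f (ser_d s).
Proof.
apply: ser_ext => l; apply: tot_ext => p q; rewrite /hser !ser_dE linear_sum.
by apply: eq_bigr => i _; rewrite linearZ /= /delta hom_transp hcomm.
Qed.

Lemma hser_shift A B (f : hom A B) (s : ser A) :
  hser f (ser_shift s) = ser_shift (hser f s).
Proof.
apply: ser_ext => -[|l] //=; apply: tot_ext => p q.
by rewrite /hser /= !dfunE linear0.
Qed.

Lemma hser_neg A B (f : hom A B) (s : ser A) :
  hser f (ser_neg s) = ser_neg (hser f s).
Proof.
apply: ser_ext => l; apply: tot_ext => p q.
by rewrite /hser /ser_neg !dfunE linearZ.
Qed.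

Lemma hser_homog A B (f : hom A B) p q (x : A p q) (s : ser A) l :
  s l = homog x -> hser f s l = homog (f p q x).
Proof. by move=> e; apply: tot_ext => p' q'; rewrite /hser e /homog hom_transp. Qed.

Lemma ord_ge_hser A B (f : hom A B) k (s : ser A) :
  ord_ge k s -> ord_ge k (hser f s).
Proof.
by move=> h l lk; apply: tot_ext => p q; rewrite /hser h // !dfunE linear0.
Qed.

Lemma ser_drE A (s : ser A) l : ser_d s l = (-1) ^+ l *: delta l (s 0%N) +
  \sum_(1 <= j < l.+1) (-1) ^+ (l - j) *: delta (l - j) (s j).
Proof.
rewrite /ser_d (reindex_inj rev_ord_inj) /=.
rewrite (eq_bigr (fun j : 'I_l.+1 => (-1) ^+ (l - j) *: delta (l - j) (s j))); last first.
  by move=> j _; have := ltn_ord j; rewrite subSS ltnS => /subKn ->.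
rewrite -(big_mkord xpredT (fun j => (-1) ^+ (l - j) *: delta (l - j) (s j))).
by rewrite big_ltn // subn0.
Qed.

Lemma ser_drcE A (s : ser A) l p q : ser_d s l p q = (-1) ^+ l *: delta l (s 0%N) p q +
  \sum_(1 <= j < l.+1) (-1) ^+ (l - j) *: delta (l - j) (s j) p q.
Proof. by rewrite ser_drE !dfunE; congr (_ + _); apply: eq_bigr => i _; rewrite !dfunE. Qed.

Lemma zsum_strand A (s : ser A) p q l :
  zsum (s 0%N p q) (fun j => s j (p - j%:Z) (q - j%:Z)) l
  = ser_d s l (p - l%:Z) (q + 1 - l%:Z).
Proof.
rewrite ser_drcE /zsum md_delta; congr (_ + _).
rewrite !big_nat; apply: eq_bigr => j /andP[_ jl]; congr (_ *: _).
by rewrite -(deltaE (s j)) //; lia.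
Qed.

Definition seq_of A p q (x : A p q) (a : forall j : nat, A (p - j%:Z) (q - j%:Z)) : ser A :=
  fun j => if j is 0 then homog x else homog (a j).

Lemma zsum_seq A p q (x : A p q) a l :
  zsum x a l = ser_d (seq_of x a) l (p - l%:Z) (q + 1 - l%:Z).
Proof.
rewrite ser_drcE /zsum /= -{1}(transp_id (md A l p q x)) transp_md; congr (_ + _).
rewrite !big_nat; apply: eq_bigr => -[|j] // _.
by rewrite transp_md.
Qed.

Lemma strand_seq A p q (x : A p q) a : strand p q (seq_of x a) = seq_of x a.
Proof.
apply: ser_ext => l; apply: tot_ext => p' q'; rewrite strandE.
case: ifP => // /negbT ne; case: l ne => [|l] ne; rewrite /= /homog transp_neq //;
  by apply: contraNN ne; rewrite ?subr0 => /andP[/eqP <- /eqP <-]; rewrite !eqxx.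
Qed.

(** [zrel] tests each coefficient in a single bidegree. This is enough because [seq_of x a] is equal
    to its own strand through (p,q), so D of it vanishes in all other bidegrees. *)
Lemma zrelP A p q r (x : A p q) a : zrel r x a <-> ord_ge r (ser_d (seq_of x a)).
Proof.
split=> h l lr; last by rewrite zsum_seq h.
apply: tot_ext => p' q'; rewrite -strand_seq ser_d_strand strandE.
by case: ifP => // /andP[/eqP-> /eqP->]; rewrite -zsum_seq h.
Qed.

Lemma zrel_strand A (s : ser A) p q r :
  (forall l, (l < r)%N -> ser_d s l (p - l%:Z) (q + 1 - l%:Z) = 0) ->
  zrel r (s 0%N p q) (fun j => s j (p - j%:Z) (q - j%:Z)).
Proof. by move=> h l lr; rewrite zsum_strand h. Qed.

Lemma Zr_comp A r (s : ser A) p q : ord_ge r (ser_d s) -> Zr r (s 0%N p q).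
Proof. by move=> h; eexists; apply: zrel_strand => l /h ->. Qed.

Lemma ZrP A r p q (x : A p q) :
  Zr r x <-> exists2 s : ser A, s 0%N = homog x & ord_ge r (ser_d s).
Proof.
split=> [[a /zrelP h]|[s e h]]; first by exists (seq_of x a).
by rewrite -(homog_id x) -e; apply: Zr_comp.
Qed.

Lemma Br_comp A r (s : ser A) p q :
  ord_ge r (ser_d s) -> Br r.+1 (ser_d s r p q).
Proof.
move=> h; exists (fun k : nat => s k (p + r.+1%:Z - 1 - k%:Z) (q + r.+1%:Z - 2 - k%:Z)).
split=> [|l lr]; last first.
  transitivity (ser_d s l (p + r.+1%:Z - 1 - l%:Z) (q + r.+1%:Z - 1 - l%:Z)); last by rewrite h.
  rewrite ser_dE; apply: eq_bigr => i _; congr (_ *: _).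
  by rewrite -(deltaE (s (l - i)%N)) //; have := ltn_ord i; lia.
rewrite ser_dE subn1 /=; apply: eq_bigr => i _; congr (_ *: _).
by rewrite -(deltaE (s (r - i)%N)) //; have := ltn_ord i; lia.
Qed.

Lemma BrP A r p q (x : A p q) :
  Br r.+1 x <-> exists2 s : ser A, ord_ge r (ser_d s) & ser_d s r = homog x.
Proof.
split=> [[b [ex h]]|[s h e]]; last by rewrite -(homog_id x) -e; apply: Br_comp.
pose s : ser A := fun k => homog (b k).
have sE l p' q' : ser_d s l p' q' = \sum_(i < l.+1) (-1) ^+ i *: transp (md A i _ _ (b (l - i)%N)) p' q'.
  by rewrite ser_dE; apply: eq_bigr => i _; rewrite transp_md.
have s0 l p' q' : ~~ ((p + r.+1%:Z - 1 - l%:Z == p') && (q + r.+1%:Z - 1 - l%:Z == q')) ->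
    ser_d s l p' q' = 0.
  move=> ne; rewrite sE big1 // => i _; rewrite transp_neq ?scaler0 //.
  have li := ltn_ord i; apply: contraNN ne; lia.
exists s.
  move=> l lr; apply: tot_ext => p' q'.
  case: (boolP ((p + r.+1%:Z - 1 - l%:Z == p') && (q + r.+1%:Z - 1 - l%:Z == q'))) => [|/s0->//].
  by case/andP=> /eqP<- /eqP<-; rewrite sE h.
apply: tot_ext => p' q'.
case: (boolP ((p == p') && (q == q'))) => [|ne].
  case/andP=> /eqP<- /eqP<-; rewrite sE homog_id [x]ex; apply: eq_bigr => i _.
  by rewrite !subn1.
by rewrite s0 ?/homog ?transp_neq //; apply: contraNN ne; lia.
Qed.

Lemma Zr_hom A B (f : hom A B) r p q (x : A p q) : Zr r x -> Zr r (f p q x).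
Proof.
move=> /ZrP[s e h]; apply/ZrP; exists (hser f s); first exact: hser_homog.
by rewrite hser_d; apply: ord_ge_hser.
Qed.

Lemma Br_hom A B (f : hom A B) r p q (x : A p q) : Br r x -> Br r (f p q x).
Proof.
case: r => [-> |r]; first by rewrite /= linear0.
move=> /BrP[s h e]; apply/BrP; exists (hser f s); rewrite hser_d; first exact: ord_ge_hser.
exact: hser_homog.
Qed.

Lemma homog_is_linear A p q : linear (@homog R n A p q).
Proof. by move=> a x y; apply: tot_ext => p' q'; rewrite /homog !dfunE transp_is_linear. Qed.
HB.instance Definition _ A p q :=
  GRing.isLinear.Build R (A p q) (Tot A) _ (@homog R n A p q) (@homog_is_linear A p q).

Lemma ZrB A r p q (x y : A p q) : Zr r x -> Zr r y -> Zr r (x - y).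
Proof.
move=> /ZrP[s e h] /ZrP[s' e' h']; apply/ZrP; exists (s - s').
  by rewrite !dfunE e e' linearB.
by rewrite linearB; apply: ord_geB.
Qed.

Lemma Br0 A r p q : Br r (0 : A p q).
Proof.
case: r => // r; apply/BrP; exists 0; first by rewrite linear0.
by rewrite !linear0.
Qed.

Lemma BrB A r p q (x y : A p q) : Br r x -> Br r y -> Br r (x - y).
Proof.
case: r => [-> ->|r]; first by rewrite /= subr0.
move=> /BrP[s h e] /BrP[s' h' e']; apply/BrP; exists (s - s').
  by rewrite linearB; apply: ord_geB.
by rewrite linearB /= !dfunE e e' linearB.
Qed.

Lemma BrN A r p q (x : A p q) : Br r x -> Br r (- x).
Proof. by move=> h; rewrite -sub0r; apply: BrB => //; apply: Br0. Qed.

Lemma BrD A r p q (x y : A p q) : Br r x -> Br r y -> Br r (x + y).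
Proof. by move=> hx /BrN hy; rewrite -[y]opprK; apply: BrB. Qed.

Lemma choice2 (T : int -> int -> Type) (P : forall p q, T p q -> Prop) :
  (forall p q, exists x, P p q x) -> exists x : forall p q, T p q, forall p q, P p q (x p q).
Proof. by move=> h; exists (fun p q => projT1 (cid (h p q))) => p q; case: cid. Qed.

Lemma Er_surj_ser A B (f : hom A B) k : Er_surj f k.+1 ->
  forall g : ser B, ord_ge k.+1 (ser_d g) ->
  exists (a : ser A) (c : ser B), [/\ ord_ge k.+1 (ser_d a), ord_ge k (ser_d c) &
    g 0%N = hser f a 0%N + ser_d c k].
Proof.
move=> fs g hg.
have /(@choice2 (fun _ _ => (ser A * ser B)%type)) [ac hac] p q : exists ac : ser A * ser B,
    [/\ ord_ge k.+1 (ser_d ac.1), ord_ge k (ser_d ac.2) &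
      g 0%N p q = f p q (ac.1 0%N p q) + ser_d ac.2 k p q].
  have /fs[x [/ZrP[a ea ha] /BrP[c hc ec]]] := Zr_comp p q hg.
  exists (a, - c); split=> //=; first by rewrite linearN; apply: ord_geN.
  by rewrite ea homog_id linearN /= !dfunE ec homog_id opprB addrC subrK.
(* A strand of c starting in (p,q) has the k-th coefficient of its image under D in (p-k,q+1-k), so
   it must be the one chosen for that bidegree. *)
exists (glue (fun p q => (ac p q).1)), (glue (fun p q => (ac (p - k%:Z) (q + 1 - k%:Z)).2)).
split.
- move=> l lk; apply: tot_ext => p q; rewrite ser_d_glue.
  by have [h _ _] := hac (p + l%:Z) (q - 1 + l%:Z); rewrite h.
- move=> l lk; apply: tot_ext => p q; rewrite ser_d_glue.
  by have [_ h _] := hac (p + l%:Z - k%:Z) (q - 1 + l%:Z + 1 - k%:Z); rewrite h.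
apply: tot_ext => p q; rewrite !dfunE ser_d_glue /hser /glue !addr0.
have -> : p + k%:Z - k%:Z = p by ring.
have -> : q - 1 + k%:Z + 1 - k%:Z = q by ring.
by case: (hac p q).
Qed.

Definition lifts k A B (f : hom A B) := forall b : ser B, ord_ge k (ser_d b) ->
  exists2 a : ser A, ord_ge k (ser_d a) & hser f a = b.

Lemma lifts0 A B (f : hom A B) : lifts 0 f <-> forall p q (y : B p q), exists x, f p q x = y.
Proof.
split=> [h p q y|h b _].
  have [//|a _ e] := h (fun _ => homog y); exists (a 0%N p q).
  by rewrite -[LHS]/(hser f a 0%N p q) e homog_id.
have := fun l => choice2 (fun p q => h p q (b l p q)).
move=> /choice[a ha]; exists a => //.
by apply: ser_ext => l; apply: tot_ext => p q; apply: ha.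
Qed.

(* A cycle of length k+1 in C is, up to the image of f, of the form dc + t b':
   the k-cycle c and the k-cycle b' lift along g. *)
Lemma lift_split A B C (f : hom A C) (g : hom B C) k :
  Er_surj f k.+1 -> lifts k g ->
  forall s : ser C, ord_ge k.+1 (ser_d s) ->
  exists (a : ser A) (b c : ser B),
    [/\ ord_ge k.+1 (ser_d a), ord_ge k.+1 (ser_d b), ord_ge k (ser_d c),
        b 0%N = ser_d c k & s = hser f a + hser g b].
Proof.
move=> fs gl s hs; have [a [c [ha hc e0]]] := Er_surj_ser fs hs.
have [c' hc' ec'] := gl c hc.
(* The boundary of c is the image of the k-th differential of c'. Completed in this way it is a
   cycle of every length, so subtracting it leaves a (k+1)-cycle, now with zero constant term. *)
pose b1 := ser_neg (ser_drop k (ser_d c')).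
have db1 : ser_d b1 = 0 by apply: ser_d_neg_drop.
have b10 : b1 0%N = ser_d c' k by rewrite /b1 ser_neg0 /ser_drop addn0.
pose s2 := s - hser f a - hser g b1.
have s20 : s2 0%N = 0.
  rewrite /s2 !dfunE e0 [hser f a _ + _]addrC addrK.
  apply/eqP; rewrite subr_eq0 -ec' hser_d; apply/eqP; apply: tot_ext => p q.
  by rewrite /hser b10.
have hs2 : ord_ge k.+1 (ser_d s2).
  rewrite /s2 !linearB /= !hser_d db1 linear0 subr0; apply: ord_geB => //.
  exact: ord_ge_hser.
have [b3 hb3 e3] := gl _ (ser_d_drop1 s20 hs2).
exists a, (b1 + ser_shift b3), c'; split=> //.
- by rewrite linearD /= db1 add0r ser_d_shift; apply: ord_ge_shift.
- by rewrite dfunE b10 addr0.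
rewrite linearD /= hser_shift e3 ser_drop1K // /s2.
by rewrite [hser g b1 + _]addrC subrK addrC subrK.
Qed.

Lemma lifts_Er_surj A B (f : hom A B) k : lifts k f -> Er_surj f k.
Proof.
move=> h p q y /ZrP[s e /h[a ha ea]]; exists (a 0%N p q); split; first exact: Zr_comp.
by rewrite -[f p q _]/(hser f a 0%N p q) ea e homog_id subrr; apply: Br0.
Qed.

Lemma r_fib_lifts r A B (f : hom A B) :
  r_fib r f <-> forall k, (k <= r)%N -> lifts k f.
Proof.
split=> h k kr; last exact/lifts_Er_surj/h.
elim: k kr => [|k IH] kr.
  apply/lifts0 => p q y; have [|x [_ /eqP]] := h _ kr p q y; first by exists (fun _ => 0).
  by rewrite subr_eq0 => /eqP; exists x.
move=> s hs; have [a [b [_ [ha hb _ _ ->]]]] := lift_split (h _ kr) (IH (ltnW kr)) hs.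
exists (a + b); first by rewrite linearD; apply: ord_geD.
by rewrite linearD.
Qed.

(** A strict form of injectivity on the page r+1: the given witness b that the image of x is a
    boundary lifts to a witness for x itself. *)
Definition fills r A B (f : hom A B) := forall p q (x : A p q) (b : ser B),
  Zr r.+1 x -> ord_ge r (ser_d b) -> ser_d b r = homog (f p q x) ->
  exists a : ser A, [/\ hser f a = b, ord_ge r (ser_d a) & ser_d a r = homog x].

Lemma triv_fibP r A B (f : hom A B) : (Er_qiso r f /\ r_fib r f) <->
  ((forall k, (k <= r.+1)%N -> lifts k f) /\ fills r f).
Proof.
split=> [[[inj_f surj_f] fib]|[lf ff]].
  have lf : forall k, (k <= r.+1)%N -> lifts k f.
    apply/r_fib_lifts => i; rewrite leq_eqVlt => /orP[/eqP->//|]; exact: fib.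
  split=> // p q x b zx hb eb.
  have /BrP[a ha ea] : Br r.+1 x by apply: inj_f => //; apply/BrP; exists b.
  (* Two witnesses for the same boundary differ by an (r+1)-cycle. Its lift c corrects a without
     changing the coefficient r of D. *)
  have [|c hc ec] := lf r.+1 (leqnn _) (b - hser f a).
    rewrite linearB /= hser_d; apply: ord_geS.
      by apply: ord_geB => //; apply: ord_ge_hser.
    by rewrite !dfunE eb (hser_homog f ea) subrr.
  exists (a + c); split.
  - by rewrite linearD /= ec addrC subrK.
  - by rewrite linearD; apply: ord_geD => //; apply: ord_ge_le hc.
  - by rewrite linearD /= dfunE ea hc // addr0.
split; last by apply/r_fib_lifts => k kr; apply: lf; apply: leqW.
split; last by apply: lifts_Er_surj; apply: lf.
move=> p q x zx /BrP[b hb eb]; have [a [_ ha ea]] := ff _ _ _ _ zx hb eb.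
by apply/BrP; exists a.
Qed.

Lemma Er_iso_two_of_three r : two_of_three (fun A B (f : hom A B) => Er_iso f r).
Proof.
move=> A B C f g; split.
- move=> [fi fs] [gi gs]; split=> [p q x zx bx|p q z zz].
    by apply: fi => //; apply: gi => //; apply: Zr_hom.
  have [y [zy by_]] := gs _ _ _ zz; have [x [zx bx]] := fs _ _ _ zy.
  exists x; split=> //=; have -> : g p q (f p q x) - z = g p q (f p q x - y) + (g p q y - z).
    by rewrite linearB addrA subrK.
  by apply: BrD => //; apply: Br_hom.
- move=> [fi fs] [gfi gfs]; split=> [p q y zy by_|p q z zz]; last first.
    have [x [zx bx]] := gfs _ _ _ zz.
    by exists (f p q x); split=> //; apply: Zr_hom.
  have [x [zx bx]] := fs _ _ _ zy.
  have bfx : Br r x.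
    apply: gfi => //=; have -> : g p q (f p q x) = g p q (f p q x - y) + g p q y.
      by rewrite linearB subrK.
    by apply: BrD => //; apply: Br_hom.
  have -> : y = f p q x - (f p q x - y) by rewrite opprB addrC subrK.
  by apply: BrB => //; apply: Br_hom.
- move=> [gi gs] [gfi gfs]; split=> [p q x zx bx|p q y zy].
    by apply: gfi => //; apply: (Br_hom g).
  have [x [zx bx]] := gfs _ _ _ (Zr_hom g zy); exists x; split=> //.
  apply: gi; last by rewrite linearB.
  by apply: ZrB => //; apply: Zr_hom.
Qed.

Lemma Er_surj_retract r : retract_closed (fun A B (f : hom A B) => Er_surj f r).
Proof.
move=> A B C D f g [i1 [r1 [i2 [r2 [e1 e2 e3 e4]]]]] gs p q y zy.
have [x [zx bx]] := gs _ _ _ (Zr_hom i2 zy); exists (r1 p q x); split; first exact: Zr_hom.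
have -> : f p q (r1 p q x) - y = r2 p q (g p q x - i2 p q y); last exact: Br_hom.
by rewrite linearB; congr (_ - _); [exact: e4 | rewrite -[RHS]/(hcomp r2 i2 p q y) e2].
Qed.

Lemma Er_inj_retract r : retract_closed (fun A B (f : hom A B) => Er_inj f r).
Proof.
move=> A B C D f g [i1 [r1 [i2 [r2 [e1 e2 e3 e4]]]]] gi p q x zx bx.
have -> : x = r1 p q (i1 p q x) by rewrite -[RHS]/(hcomp r1 i1 p q x) e1.
apply: Br_hom; apply: gi; first exact: Zr_hom.
by rewrite -[g p q _]/(hcomp g i1 p q x) e3; apply: (Br_hom i2).
Qed.

Lemma Er_qiso_retract r : retract_closed (@Er_qiso R n r).
Proof.
move=> A B C D f g h [gi gs]; split; first exact: Er_inj_retract h gi.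
exact: Er_surj_retract h gs.
Qed.

Lemma r_fib_retract r : retract_closed (@r_fib R n r).
Proof. by move=> A B C D f g h gf i ir; apply: Er_surj_retract h (gf i ir). Qed.

Lemma llp_retract A B C D X Y (i : hom A B) (j : hom C D) (g : hom X Y) :
  retract i j -> llp j g -> llp i g.
Proof.
move=> [i1 [r1 [i2 [r2 [e1 e2 e3 e4]]]]] h u v sq.
have [|w [w1 w2]] := h (hcomp u r1) (hcomp v r2).
  move=> p q x /=; rewrite -[r2 p q (j p q x)]/(hcomp r2 j p q x) -e4.
  exact: (sq p q (r1 p q x)).
exists (hcomp w i2); split=> p q x /=.
  rewrite -[i2 p q (i p q x)]/(hcomp i2 i p q x) -e3 -[LHS]/(hcomp w j p q (i1 p q x)) w1 /=.
  by rewrite -[r1 p q _]/(hcomp r1 i1 p q x) e1.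
rewrite -[LHS]/(hcomp g w p q (i2 p q x)) w2 /=.
by rewrite -[r2 p q _]/(hcomp r2 i2 p q x) e2.
Qed.
End Pages.

(** * Quotients, limits and right properness *)

(** The filter says on which sets of indices two families must agree in order to be identified.
    [pf_all] serves limits and term models, and the filter of tails gives eventual equality along a
    directed system. *)
Record pfilter (S : Type) := PFilter {
  pf :> (S -> Prop) -> Prop;
  pfT : pf (fun _ => True);
  pfI : forall P Q, pf P -> pf Q -> pf (fun s => P s /\ Q s);
  pfS : forall P Q : S -> Prop, (forall s, P s -> Q s) -> pf P -> pf Q
}.

Definition pf_all (S : Type) : pfilter S :=
  @PFilter S (fun P => forall s, P s) (fun _ => I)
    (fun P Q hP hQ s => conj (hP s) (hQ s)) (fun P Q PQ hP s => PQ s (hP s)).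

(** The operations satisfy no laws of their own. After identification of elements with the same
    values, the laws are inherited from the modules W s. *)
Record rawmod (R : pzRingType) (S : Type) (W : S -> lmodType R) := RawMod {
  rawT :> Type;
  raw0 : rawT;
  rawD : rawT -> rawT -> rawT;
  rawZ : R -> rawT -> rawT;
  rawev : forall s, rawT -> W s;
  rawev0 : forall s, rawev s raw0 = 0;
  rawevD : forall s t u, rawev s (rawD t u) = rawev s t + rawev s u;
  rawevZ : forall s a t, rawev s (rawZ a t) = a *: rawev s t
}.

Section QuotientModule.
Variables (R : pzRingType) (S : Type) (F : pfilter S).
Variables (W : S -> lmodType R) (M : rawmod W).
Implicit Types t u : M.

Definition qeq t u : Prop := F (fun s => rawev s t = rawev s u).

(** A class is encoded as the predicate [qeq t], so the size of the quotient depends on M and not on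
    S. This permits S to be a class of multicomplexes which is itself large. *)
Definition qmod : Type := {P : M -> Prop | exists t, P = qeq t}.

Definition qpi t : qmod := exist _ (qeq t) (ex_intro _ t erefl).
Definition qrepr (x : qmod) : M := projT1 (cid (proj2_sig x)).

Lemma qreprK x : qpi (qrepr x) = x.
Proof. by case: x => P h; apply: eq_exist; rewrite /qrepr; case: cid. Qed.

Lemma qpiP t u : qpi t = qpi u <-> qeq t u.
Proof.
split=> [/(congr1 sval)/= /(congr1 (fun P => P u))|h].
  by move=> ->; apply: pfS (pfT F).
apply: eq_exist; apply: funext => v; apply: propext; split=> h'.
  by apply: pfS (pfI h h') => s [-> ->].
by apply: pfS (pfI h h') => s [-> ->].
Qed.

Lemma qrepr_pi t : qeq (qrepr (qpi t)) t.
Proof. by apply/qpiP; rewrite qreprK. Qed.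

HB.instance Definition _ := gen_eqMixin qmod.
HB.instance Definition _ := gen_choiceMixin qmod.

Definition qadd (x y : qmod) : qmod := qpi (rawD (qrepr x) (qrepr y)).
Definition qscale a (x : qmod) : qmod := qpi (rawZ a (qrepr x)).

(** Identities in the quotient are proved by exhibiting one family w that represents both sides. The
    family is computed in the W s, and no raw element has to be inspected. *)
Definition qrep (x : qmod) (w : forall s, W s) : Prop :=
  F (fun s => rawev s (qrepr x) = w s).

Lemma qrep_pi t : qrep (qpi t) (fun s => rawev s t).
Proof. exact: qrepr_pi. Qed.

Lemma qrep_refl x : qrep x (fun s => rawev s (qrepr x)).
Proof. by apply: pfS (pfT F). Qed.

Lemma qrep_inj x y w : qrep x w -> qrep y w -> x = y.
Proof.
move=> hx hy; rewrite -[x]qreprK -[y]qreprK; apply/qpiP.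
by apply: pfS (pfI hx hy) => s [-> ->].
Qed.

Lemma qrep_eq x w w' : (forall s, w s = w' s) -> qrep x w -> qrep x w'.
Proof. by move=> e; apply: pfS => s ->. Qed.

Lemma qrep_add x y w w' : qrep x w -> qrep y w' -> qrep (qadd x y) (fun s => w s + w' s).
Proof.
move=> hx hy; apply: pfS (pfI (qrepr_pi (rawD (qrepr x) (qrepr y))) (pfI hx hy)) => s [-> [<- <-]].
exact: rawevD.
Qed.

Lemma qrep_scale a x w : qrep x w -> qrep (qscale a x) (fun s => a *: w s).
Proof.
by move=> hx; apply: pfS (pfI (qrepr_pi (rawZ a (qrepr x))) hx) => s [-> <-]; apply: rawevZ.
Qed.

Lemma qrep_zero : qrep (qpi (raw0 M)) (fun s => 0).
Proof. by apply: pfS (qrepr_pi (raw0 M)) => s ->; apply: rawev0. Qed.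

Program Definition qmod_zmodMixin := @GRing.isZmodule.Build qmod
  (qpi (raw0 M)) (qscale (-1)) qadd _ _ _ _.
Next Obligation.
move=> x y z; apply: qrep_inj; first exact: (qrep_add (qrep_refl x) (qrep_add (qrep_refl y) (qrep_refl z))).
apply: qrep_eq (qrep_add (qrep_add (qrep_refl x) (qrep_refl y)) (qrep_refl z)) => s.
by rewrite addrA.
Qed.
Next Obligation.
move=> x y; apply: qrep_inj (qrep_add (qrep_refl x) (qrep_refl y)) _.
by apply: qrep_eq (qrep_add (qrep_refl y) (qrep_refl x)) => s; rewrite addrC.
Qed.
Next Obligation.
move=> x; apply: qrep_inj (qrep_refl x).
by apply: qrep_eq (qrep_add qrep_zero (qrep_refl x)) => s; rewrite add0r.
Qed.
Next Obligation.
move=> x; apply: qrep_inj qrep_zero.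
apply: qrep_eq (qrep_add (qrep_scale (-1) (qrep_refl x)) (qrep_refl x)) => s.
by rewrite scaleN1r addNr.
Qed.
HB.instance Definition _ := qmod_zmodMixin.

Lemma qscaleA a b x : qscale a (qscale b x) = qscale (a * b) x.
Proof.
apply: (qrep_inj _ (qrep_scale (a * b) (qrep_refl x))).
by apply: qrep_eq (qrep_scale a (qrep_scale b (qrep_refl x))) => s; rewrite scalerA.
Qed.
Lemma qscale1 : left_id 1 qscale.
Proof.
move=> x; apply: (qrep_inj _ (qrep_refl x)).
by apply: qrep_eq (qrep_scale 1 (qrep_refl x)) => s; rewrite scale1r.
Qed.
Lemma qscaleDr : right_distributive qscale +%R.
Proof.
move=> a x y.
apply: (qrep_inj (qrep_scale a (qrep_add (qrep_refl x) (qrep_refl y)))).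
apply: qrep_eq (qrep_add (qrep_scale a (qrep_refl x)) (qrep_scale a (qrep_refl y))) => s.
by rewrite scalerDr.
Qed.
Lemma qscaleDl x : {morph qscale^~ x : a b / a + b}.
Proof.
move=> a b; apply: (qrep_inj (qrep_scale (a + b) (qrep_refl x))).
apply: qrep_eq (qrep_add (qrep_scale a (qrep_refl x)) (qrep_scale b (qrep_refl x))) => s.
by rewrite scalerDl.
Qed.
HB.instance Definition _ := GRing.Zmodule_isLmodule.Build R qmod
  qscaleA qscale1 qscaleDr qscaleDl.

Lemma qrep0 : qrep 0 (fun s => 0).
Proof. exact: qrep_zero. Qed.

Lemma qrepD (x y : qmod) w w' : qrep x w -> qrep y w' -> qrep (x + y) (fun s => w s + w' s).
Proof. exact: qrep_add. Qed.

Lemma qrepZ a (x : qmod) w : qrep x w -> qrep (a *: x) (fun s => a *: w s).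
Proof. exact: qrep_scale. Qed.

Lemma qrep_sum (J : Type) (r : seq J) (x : J -> qmod) (w : J -> forall s, W s) :
  (forall j, qrep (x j) (w j)) ->
  qrep (\sum_(j <- r) x j) (fun s => \sum_(j <- r) w j s).
Proof.
move=> h; elim: r => [|j r IH].
  by rewrite big_nil; apply: qrep_eq qrep0 => s; rewrite big_nil.
by rewrite big_cons; apply: qrep_eq (qrepD (h j) IH) => s; rewrite big_cons.
Qed.

Lemma qpiD t u : qpi (rawD t u) = qpi t + qpi u.
Proof.
apply: qrep_inj (qrep_pi _) _.
by apply: qrep_eq (qrepD (qrep_pi t) (qrep_pi u)) => s; rewrite rawevD.
Qed.

Lemma qpiZ a t : qpi (rawZ a t) = a *: qpi t.
Proof.
apply: qrep_inj (qrep_pi _) _.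
by apply: qrep_eq (qrepZ a (qrep_pi t)) => s; rewrite rawevZ.
Qed.
End QuotientModule.
Arguments qpi {R S} F {W M}.

Section QuotientMulticomplex.
Variables (R : comPzRingType) (n : extnat) (S : Type) (F : pfilter S) (U : S -> mcx R n).

Record rawmcx := RawMcx {
  rawg :> forall p q, rawmod (fun s => U s p q);
  rawd : forall (i : nat) p q, rawg p q -> rawg (p - i%:Z) (q + 1 - i%:Z);
  rawevd : forall s i p q (t : rawg p q), rawev s (rawd i t) = md (U s) i p q (rawev s t)
}.

Variable M : rawmcx.

Definition qobj (p q : int) : lmodType R := qmod F (M p q).

Definition qd (i : nat) p q (x : qobj p q) : qobj (p - i%:Z) (q + 1 - i%:Z) :=
  qpi F (rawd i (qrepr x)).

Lemma qrep_d i p q (x : qobj p q) w : qrep x w ->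
  qrep (qd i x) (fun s => md (U s) i p q (w s)).
Proof.
by move=> h; apply: pfS (pfI (qrepr_pi F (rawd i (qrepr x))) h) => s [-> <-]; apply: rawevd.
Qed.

Lemma qd_is_linear i p q : linear (@qd i p q).
Proof.
move=> a x y.
apply: (qrep_inj (qrep_d i (qrepD (qrepZ a (qrep_refl x)) (qrep_refl y)))).
apply: qrep_eq (qrepD (qrepZ a (qrep_d i (qrep_refl x))) (qrep_d i (qrep_refl y))) => s.
by rewrite linearP.
Qed.
HB.instance Definition _ i p q :=
  GRing.isLinear.Build R (qobj p q) (qobj (p - i%:Z) (q + 1 - i%:Z)) _ (@qd i p q) (@qd_is_linear i p q).

Lemma qrep_transp p q (x : qobj p q) w p' q' : qrep x w ->
  qrep (transp x p' q') (fun s => transp (w s) p' q').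
Proof.
case e : ((p == p') && (q == q')) => h.
  case/andP: e => /eqP e1 /eqP e2; subst p' q'; rewrite transp_id.
  by apply: qrep_eq h => s; rewrite transp_id.
rewrite transp_neq ?e //; apply: qrep_eq (qrep0 _ _) => s.
by rewrite transp_neq ?e.
Qed.

Program Definition qmcx : mcx R n := @Mcx R n qobj (fun i p q => @qd i p q) _ _.
Next Obligation.
apply: (qrep_inj (qrep_d i (qrep_refl x))).
by apply: qrep_eq (qrep0 _ _) => s; rewrite md_vanish.
Qed.
Next Obligation.
apply: (qrep_inj (qrep_sum _ (fun j => qrepZ _ (qrep_transp _ _ (qrep_d _ (qrep_d _ (qrep_refl x))))))).
by apply: qrep_eq (qrep0 _ _) => s; rewrite md_rel.
Qed.

Definition qcl p q (t : M p q) : qmcx p q := qpi F t.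

Lemma qcl_d i p q (t : M p q) : qcl (rawd i t) = md qmcx i p q (qcl t).
Proof.
apply: (qrep_inj (qrep_pi F (rawd i t))).
by apply: qrep_eq (qrep_d i (qrep_pi F t)) => s; rewrite rawevd.
Qed.

Lemma qclP p q (x : qmcx p q) : exists t, x = qcl t.
Proof. by exists (qrepr x); rewrite [qcl _]qreprK. Qed.

Lemma qmcx_hom (A : mcx R n) (t : forall p q, A p q -> M p q) :
  (forall a p q (x y : A p q), qeq F (t p q (a *: x + y)) (rawD (rawZ a (t p q x)) (t p q y))) ->
  (forall i p q (x : A p q), qeq F (t _ _ (md A i p q x)) (rawd i (t p q x))) ->
  exists u : hom A qmcx, forall p q x, u p q x = qcl (t p q x).
Proof.
move=> tl td.
have lin p q : linear (fun x => qcl (t p q x)).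
  by move=> a x y; rewrite /qcl -qpiZ -qpiD; apply/qpiP.
pose u p q : {linear A p q -> qmcx p q} := HB.pack (fun x => qcl (t p q x))
  (GRing.isLinear.Build R (A p q) (qmcx p q) _ _ (lin p q)).
have uc i p q (x : A p q) : u _ _ (md A i p q x) = md qmcx i p q (u p q x).
  by rewrite /= -qcl_d; apply/qpiP.
by exists (Hom uc).
Qed.
End QuotientMulticomplex.

Section JointlyInjective.
Variables (R : comPzRingType) (n : extnat) (S : Type) (U : S -> mcx R n) (M : rawmcx U).
Local Notation Q := (qmcx (pf_all S) M).

Definition qev_fun s p q (x : Q p q) : U s p q := rawev s (qrepr x).

Lemma qev_fun_cl s p q (t : M p q) : qev_fun s (qcl (pf_all S) t) = rawev s t.
Proof. exact: (qrepr_pi (pf_all S) t). Qed.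

Lemma qev_is_linear s p q : linear (@qev_fun s p q).
Proof.
move=> a x y; have := qrepD (qrepZ a (qrep_refl x)) (qrep_refl y).
by move=> /(_ s).
Qed.
HB.instance Definition _ s p q :=
  GRing.isLinear.Build R (Q p q) (U s p q) _ (@qev_fun s p q) (@qev_is_linear s p q).

Program Definition qev s : hom Q (U s) := @Hom R n Q (U s) (fun p q => @qev_fun s p q) _.
Next Obligation. by move: (qrep_d i (qrep_refl x)) => /(_ s). Qed.

Lemma qev_ext p q (x y : Q p q) : (forall s, qev s p q x = qev s p q y) -> x = y.
Proof. by move=> h; apply: (qrep_inj _ (qrep_refl y)) => s; apply: h. Qed.

Lemma qev_hom (A : mcx R n) (t : forall s, hom A (U s)) (h : forall p q, A p q -> M p q) :
  (forall s p q x, rawev s (h p q x) = t s p q x) ->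
  exists u : hom A Q, forall s, hom_eq (hcomp (qev s) u) (t s).
Proof.
move=> ht; have [||u ue] := @qmcx_hom R n S (pf_all S) U M A h.
- by move=> a p q x y s; rewrite rawevD rawevZ !ht linearP.
- by move=> i p q x s; rewrite rawevd !ht hcomm.
by exists u => s p q x /=; rewrite ue qev_fun_cl ht.
Qed.
End JointlyInjective.

Section SubProducts.
Variables (R : comPzRingType) (n : extnat) (I : Type) (X : I -> mcx R n).

(** Graded submodules of a product, stable under the differentials: products, equalizers and
    pullbacks are all of this kind. *)
Record gsub := GSub {
  gP :> forall p q, (forall i, X i p q) -> Prop;
  gP0 : forall p q, gP (fun i => 0 : X i p q);
  gPD : forall p q (x y : forall i, X i p q), gP x -> gP y -> gP (fun i => x i + y i);
  gPZ : forall p q a (x : forall i, X i p q), gP x -> gP (fun i => a *: x i);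
  gPd : forall k p q (x : forall i, X i p q), gP x -> gP (fun i => md (X i) k p q (x i))
}.

Variable P : gsub.

Definition sub_rawmod p q : rawmod (fun i => X i p q) :=
  @RawMod R I (fun i => X i p q) {x : forall i, X i p q | P p q x}
   (exist _ _ (gP0 P p q))
   (fun x y => exist _ _ (gPD (proj2_sig x) (proj2_sig y)))
   (fun a x => exist _ _ (gPZ a (proj2_sig x)))
   (fun i x => sval x i) (fun _ => erefl) (fun _ _ _ => erefl) (fun _ _ _ => erefl).

Definition sub_raw : rawmcx X :=
  @RawMcx R n I X sub_rawmod (fun k p q x => exist _ _ (gPd k (proj2_sig x)))
    (fun _ _ _ _ _ => erefl).

Definition subprod : mcx R n := qmcx (pf_all I) sub_raw.
Definition subpr i : hom subprod (X i) := qev sub_raw i.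

Lemma subpr_ext p q (x y : subprod p q) :
  (forall i, subpr i p q x = subpr i p q y) -> x = y.
Proof. exact: qev_ext. Qed.

Lemma subprP p q (x : subprod p q) : P p q (fun i => subpr i p q x).
Proof. exact: (proj2_sig (qrepr x)). Qed.

Lemma subprod_el p q (x : forall i, X i p q) : P p q x ->
  exists y : subprod p q, forall i, subpr i p q y = x i.
Proof.
move=> h; exists (qcl (pf_all I) (exist _ x h : sub_raw p q)) => i.
exact: qev_fun_cl.
Qed.

Lemma subprod_hom (T : mcx R n) (t : forall i, hom T (X i)) :
  (forall p q (x : T p q), P p q (fun i => t i p q x)) ->
  exists u : hom T subprod, forall i, hom_eq (hcomp (subpr i) u) (t i).
Proof.
move=> h; apply: (qev_hom (h := fun p q x => exist _ _ (h p q x) : sub_raw p q)).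
by [].
Qed.
End SubProducts.

Section Limits.
Variables (R : comPzRingType) (n : extnat).

Definition gsub_all (I : Type) (X : I -> mcx R n) : gsub X :=
  @GSub R n I X (fun _ _ _ => True) (fun _ _ => Logic.I)
    (fun _ _ _ _ _ _ => Logic.I) (fun _ _ _ _ _ => Logic.I) (fun _ _ _ _ _ => Logic.I).

Lemma mcx_products : has_products R n.
Proof.
move=> I X; exists (subprod (gsub_all X)), (@subpr _ _ _ _ (gsub_all X)) => T t; split; first exact: subprod_hom.
by move=> u v h p q x; apply: subpr_ext => i; apply: h.
Qed.

Lemma sub_mcx (A : mcx R n) (P : forall p q, A p q -> Prop) :
  (forall p q, P p q 0) -> (forall p q x y, P p q x -> P p q y -> P p q (x + y)) ->
  (forall p q a x, P p q x -> P p q (a *: x)) ->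
  (forall k p q x, P p q x -> P _ _ (md A k p q x)) ->
  exists (E : mcx R n) (e : hom E A), [/\ forall p q (x : E p q), P p q (e p q x),
    forall p q (x y : E p q), e p q x = e p q y -> x = y &
    forall (T : mcx R n) (t : hom T A), (forall p q x, P p q (t p q x)) ->
      exists u : hom T E, hom_eq (hcomp e u) t].
Proof.
move=> P0 PD PZ Pd.
pose P' := @GSub R n unit (fun _ => A) (fun p q x => P p q (x tt)) P0
  (fun _ _ _ _ => PD _ _ _ _) (fun _ _ _ _ => PZ _ _ _ _) (fun _ _ _ _ => Pd _ _ _ _).
exists (subprod P'), (subpr P' tt); split=> [p q x|p q x y e|T t h].
- exact: (subprP x).
- by apply: subpr_ext => -[].
have [//|u ue] := @subprod_hom _ _ _ _ P' T (fun _ => t).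
by exists u; apply: ue.
Qed.

Lemma mcx_equalizers : has_equalizers R n.
Proof.
move=> A B f g.
have [||||E [e [eP ei eu]]] := @sub_mcx A (fun p q x => f p q x = g p q x).
- by move=> p q; rewrite !linear0.
- by move=> p q x y ex ey; rewrite !linearD ex ey.
- by move=> p q a x ex; rewrite !linearZ /= ex.
- by move=> k p q x ex; rewrite !hcomm ex.
exists E, e; split=> [|T t h]; first exact: eP.
split; first exact: eu.
by move=> u v uv p q x; apply: ei; apply: uv.
Qed.

(** The two elementwise properties come with the universal one because series are compared and
    assembled coefficient by coefficient. *)
Lemma pullback_mcx (A B C : mcx R n) (f : hom A C) (g : hom B C) :
  exists (P : mcx R n) (pa : hom P A) (pb : hom P B), [/\ is_pullback pa pb f g,
    forall p q (x y : P p q), pa p q x = pa p q y -> pb p q x = pb p q y -> x = y &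
    forall p q x y, f p q x = g p q y -> exists2 z, pa p q z = x & pb p q z = y].
Proof.
pose X b := if b then A else B.
pose P p q (x : forall b, X b p q) := f p q (x true) = g p q (x false).
have P0 p q : P p q (fun _ => 0) by rewrite /P !linear0.
have PD p q x y : P p q x -> P p q y -> P p q (fun b => x b + y b).
  by rewrite /P => ex ey; rewrite !linearD ex ey.
have PZ p q a x : P p q x -> P p q (fun b => a *: x b).
  by rewrite /P => ex; rewrite !linearZ /= ex.
have Pd k p q x : P p q x -> P _ _ (fun b => md (X b) k p q (x b)).
  by rewrite /P => ex; rewrite !hcomm ex.
pose P' := GSub P0 PD PZ Pd.
exists (subprod P'), (subpr P' true), (subpr P' false); split.
- split=> [p q x|T ta tb e]; first exact: (subprP x).
  split=> [|u v ua ub p q x]; last by apply: subpr_ext => -[]; [apply: ua | apply: ub].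
  pose t b : hom T (X b) := if b as b return hom T (X b) then ta else tb.
  have [|u ue] := @subprod_hom _ _ _ _ P' T t; first exact: e.
  by exists u; split; [apply: (ue true) | apply: (ue false)].
- by move=> p q x y ea eb; apply: subpr_ext => -[].
move=> p q x y e.
have [|z ez] := @subprod_el _ _ _ _ P' p q (fun b => if b as b return X b p q then x else y); first exact: e.
by exists z; [apply: (ez true) | apply: (ez false)].
Qed.

Lemma hom_zero (A B : mcx R n) : exists f : hom A B, forall p q x, f p q x = 0.
Proof.
have c i p q (x : A p q) : (\0 : {linear A _ _ -> B _ _}) (md A i p q x) = md B i p q ((\0 : {linear A p q -> B p q}) x).
  by rewrite /= linear0.
by exists (@Hom R n A B (fun p q => \0) c).
Qed.
End Limits.

Section PullbackSeries.
Variables (R : comPzRingType) (n : extnat) (P A B C : mcx R n).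
Variables (pa : hom P A) (pb : hom P B) (f : hom A C) (g : hom B C).
Hypothesis Pinj : forall p q (x y : P p q), pa p q x = pa p q y -> pb p q x = pb p q y -> x = y.
Hypothesis Psurj : forall p q x y, f p q x = g p q y -> exists2 z, pa p q z = x & pb p q z = y.

Lemma pullback_ser (a : ser A) (b : ser B) : hser f a = hser g b ->
  exists2 c : ser P, hser pa c = a & hser pb c = b.
Proof.
move=> e; have /choice[c hc] (l : nat) : exists c : Tot P,
    forall p q, pa p q (c p q) = a l p q /\ pb p q (c p q) = b l p q.
  apply: (@choice2 (fun p q => P p q) (fun p q c => pa p q c = a l p q /\ pb p q c = b l p q)).
  move=> p q; have [|z za zb] := Psurj (x := a l p q) (y := b l p q); last by exists z.
  by rewrite -[LHS]/(hser f a l p q) e.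
by exists c; apply: ser_ext => l; apply: tot_ext => p q; case: (hc l p q).
Qed.

Lemma pullback_homog (c : ser P) l p q (x : P p q) :
  hser pa c l = homog (pa p q x) -> hser pb c l = homog (pb p q x) -> c l = homog x.
Proof.
move=> ea eb; apply: tot_ext => p' q'; rewrite /homog; apply: Pinj; rewrite hom_transp.
  by rewrite -[LHS]/(hser pa c l p' q') ea.
by rewrite -[LHS]/(hser pb c l p' q') eb.
Qed.

Lemma pullback_ord k (c : ser P) : ord_ge k (hser pa c) -> ord_ge k (hser pb c) -> ord_ge k c.
Proof.
move=> ha hb l lk; apply: tot_ext => p q; apply: Pinj; rewrite dfunE linear0.
  by rewrite -[LHS]/(hser pa c l p q) ha.
by rewrite -[LHS]/(hser pb c l p q) hb.
Qed.
End PullbackSeries.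

(** * Stability of weak equivalences under pullback along fibrations *)

Section RightProper.
Variables (R : comPzRingType) (n : extnat).

(** Both halves correct a pair of series until it lies in the pullback, by [lift_split] over C. For
    injectivity, witnesses a and b for the two projections of x have images differing by an
    (r+1)-cycle f(a') + g(b'), and (a - a', b + b') is a witness for x. For surjectivity, the image
    of a cycle b is f(a') + g(b'), and (a', b - b') is a cycle whose second component is b up to the
    boundary b'_0. *)
Lemma Er_qiso_pullback r (P A B C : mcx R n) (pa : hom P A) (pb : hom P B)
    (f : hom A C) (g : hom B C) :
  hom_eq (hcomp f pa) (hcomp g pb) ->
  (forall p q (x y : P p q), pa p q x = pa p q y -> pb p q x = pb p q y -> x = y) ->
  (forall p q x y, f p q x = g p q y -> exists2 z, pa p q z = x & pb p q z = y) ->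
  Er_qiso r f -> r_fib r g -> Er_qiso r pb.
Proof.
move=> sq Pinj Psurj [fi fs] /r_fib_lifts gl.
have Pser := pullback_ser Psurj; have Pord := pullback_ord Pinj.
have L := lift_split fs (gl r (leqnn r)).
split=> [p q x zx /BrP[b hb eb]|p q y /ZrP[b eb hb]].
  have /BrP[a ha ea] : Br r.+1 (pa p q x).
    apply: fi; first exact: Zr_hom.
    rewrite -[f p q _]/(hcomp f pa p q x) sq; apply: (Br_hom g).
    by apply/BrP; exists b.
  have [|a' [b' [_ [ha' hb' _ _ e]]]] := L (hser f a - hser g b).
    rewrite linearB /= !hser_d; apply: ord_geS.
      by apply: ord_geB; apply: ord_ge_hser.
    rewrite dfunE dfunNE (hser_homog f ea) (hser_homog g eb).
    by rewrite -[f p q _]/(hcomp f pa p q x) sq subrr.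
  have [|c ca cb] := Pser (a - a') (b + b').
    rewrite linearB linearD /=; move/eqP: e; rewrite subr_eq => /eqP ->.
    by rewrite addrC !addrA addNr add0r addrC.
  apply/BrP; exists c.
    apply: Pord; rewrite -hser_d ?ca ?cb.
      by rewrite linearB; apply: ord_geB => //; apply: ord_ge_le ha'.
    by rewrite linearD; apply: ord_geD => //; apply: ord_ge_le hb'.
  apply: (pullback_homog Pinj); rewrite -hser_d ?ca ?cb.
    by rewrite linearB /= dfunE dfunNE ha' // ea subr0.
  by rewrite linearD /= dfunE hb' // eb addr0.
have [|a' [b' [c' [ha' hb' hc' ec' e]]]] := L (hser g b).
  by rewrite hser_d; apply: ord_ge_hser.
have [|c ca cb] := Pser a' (b - b').
  by rewrite linearB /= e addrK.
exists (c 0%N p q); split.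
  apply: Zr_comp; apply: Pord; rewrite -hser_d ?ca ?cb //.
  by rewrite linearB; apply: ord_geB.
rewrite -[pb p q _]/(hser pb c 0%N p q) cb !dfunE eb homog_id addrAC subrr add0r ec'.
by apply: BrN; apply: Br_comp.
Qed.

Lemma iso_Er_qiso r (A B : mcx R n) (f : hom A B) (g : hom B A) :
  hom_eq (hcomp g f) (hid A) -> hom_eq (hcomp f g) (hid B) -> Er_qiso r f.
Proof.
move=> gf fg; split=> [p q x zx bx|p q y zy].
  by rewrite -[x](gf p q x); apply: (Br_hom g).
exists (g p q y); split; first exact: Zr_hom.
by rewrite [f p q _](fg p q y) [_ - _]subrr; apply: Br0.
Qed.

(** An abstract pullback has no elementwise description, so the result is transported along its
    isomorphism u with the concrete one. *)
Lemma mcx_right_proper r : right_proper (@Er_qiso R n r) (@r_fib R n r).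
Proof.
move=> P A B C pa pb f g [sq up] fW gF.
have [P' [pa' [pb' [[sq' up'] inj' surj']]]] := pullback_mcx f g.
have pb'W : Er_qiso r pb' := Er_qiso_pullback sq' inj' surj' fW gF.
have [[u [ua ub]] _] := up' _ _ _ sq; have [[v [va vb]] up1] := up _ _ _ sq'.
have [_ up0] := up _ _ _ sq; have [_ up2] := up' _ _ _ sq'.
have uW : Er_qiso r u.
  apply: (@iso_Er_qiso r _ _ u v).
    by apply: up0 => p q x /=; [rewrite -[LHS]/(hcomp pa v p q _) va; exact: ua
                               |rewrite -[LHS]/(hcomp pb v p q _) vb; exact: ub].
  by apply: up2 => p q x /=; [rewrite -[LHS]/(hcomp pa' u p q _) ua; exact: va
                             |rewrite -[LHS]/(hcomp pb' u p q _) ub; exact: vb].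
have [comp _ _] := @Er_iso_two_of_three R n r.+1 _ _ _ u pb'.
have [wi ws] := comp uW pb'W; split=> p q x zx.
  by move=> bx; apply: wi => //; rewrite ub.
by have [y [zy by_]] := ws _ _ _ zx; exists y; split=> //; rewrite -ub.
Qed.
End RightProper.

(** * Term models and colimits *)

Section Free.
Variables (R : comPzRingType) (n : extnat).

(* A class [aS] of models: multicomplexes with interpretations of the constants
   [aG] and of the (not necessarily linear) unary operations [aO]. *)
Record algsig := AlgSig {
  aS : Type;
  aU : aS -> mcx R n;
  aG : int -> int -> Type;
  aO : int -> int -> int -> int -> Type;
  aig : forall s p q, aG p q -> aU s p q;
  aio : forall s p q p' q', aO p q p' q' -> aU s p q -> aU s p' q'
}.

Variable L : algsig.

Inductive term : int -> int -> Type :=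
| Tgen p q : aG L p q -> term p q
| Top p q p' q' : aO L p q p' q' -> term p q -> term p' q'
| Tzero p q : term p q
| Tadd p q : term p q -> term p q -> term p q
| Tscale p q : R -> term p q -> term p q
| Td (i : nat) p q : term p q -> term (p - i%:Z) (q + 1 - i%:Z).

Fixpoint teval (s : aS L) p q (t : term p q) : aU s p q :=
  match t with
  | Tgen p q g => aig s g
  | Top p q p' q' o t => aio o (teval s t)
  | Tzero p q => 0
  | Tadd p q t u => teval s t + teval s u
  | Tscale p q a t => a *: teval s t
  | Td i p q t => md (aU s) i p q (teval s t)
  end.

Definition term_rawmod p q : rawmod (fun s : aS L => aU s p q) :=
  @RawMod R (aS L) (fun s => aU s p q) (term p q) (Tzero p q) (@Tadd p q) (@Tscale p q)
    (fun s t => teval s t) (fun _ => erefl) (fun _ _ _ => erefl) (fun _ _ _ => erefl).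

Definition term_raw : rawmcx (@aU L) :=
  @RawMcx R n (aS L) (@aU L) term_rawmod Td (fun _ _ _ _ _ => erefl).

(* The initial model: two terms are identified when they agree in every model. *)
Definition free_mcx : mcx R n := qmcx (pf_all (aS L)) term_raw.

Definition fev s : hom free_mcx (aU s) := qev term_raw s.

Definition fcl p q (t : term p q) : free_mcx p q := qcl (pf_all (aS L)) (t : term_raw p q).
Definition fgen p q (g : aG L p q) : free_mcx p q := fcl (Tgen g).
Definition fop p q p' q' (o : aO L p q p' q') (x : free_mcx p q) : free_mcx p' q' :=
  fcl (Top o (qrepr x)).

Lemma fev_cl s p q (t : term p q) : fev s p q (fcl t) = teval s t.
Proof. exact: (qev_fun_cl (M := term_raw) s t). Qed.

Lemma fev_gen s p q (g : aG L p q) : fev s p q (fgen g) = aig s g.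
Proof. exact: fev_cl. Qed.

Lemma fev_op s p q p' q' (o : aO L p q p' q') x :
  fev s p' q' (fop o x) = aio o (fev s p q x).
Proof. exact: fev_cl. Qed.

Lemma free_ext p q (x y : free_mcx p q) : (forall s, fev s p q x = fev s p q y) -> x = y.
Proof. exact: qev_ext. Qed.

Lemma free_ind (P : forall p q, free_mcx p q -> Prop) :
  (forall p q (g : aG L p q), P p q (fgen g)) ->
  (forall p q p' q' (o : aO L p q p' q') x, P p q x -> P p' q' (fop o x)) ->
  (forall p q, P p q 0) ->
  (forall p q x y, P p q x -> P p q y -> P p q (x + y)) ->
  (forall p q a x, P p q x -> P p q (a *: x)) ->
  (forall i p q x, P p q x -> P _ _ (md free_mcx i p q x)) ->
  forall p q x, P p q x.
Proof.
move=> Pg Po P0 PD PZ Pd p q x; have [t ->] := qclP x; move: p q t {x}.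
suff H p q (t : term p q) : P p q (fcl t) by move=> p q t; apply: H.
elim: t => {p q} [p q g|p q p' q' o t IH|p q|p q t IHt u IHu|p q a t IH|i p q t IH].
- exact: Pg.
- have -> : fcl (Top o t) = fop o (fcl t); last exact: Po.
  by apply: free_ext => s; rewrite fev_op !fev_cl.
- by have -> : fcl (Tzero p q) = 0 by [].
- have -> : fcl (Tadd t u) = fcl t + fcl u; last exact: PD.
  exact: (qpiD (pf_all (aS L)) (t : term_raw p q) u).
- have -> : fcl (Tscale a t) = a *: fcl t; last exact: PZ.
  exact: (qpiZ (pf_all (aS L)) a (t : term_raw p q)).
- have -> : fcl (Td i t) = md free_mcx i p q (fcl t); last exact: Pd.
  exact: (qcl_d (pf_all (aS L)) i (t : term_raw p q)).
Qed.

Lemma free_hom_eq (A : mcx R n) (f g : hom free_mcx A) :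
  (forall p q (c : aG L p q), f p q (fgen c) = g p q (fgen c)) ->
  (forall p q p' q' (o : aO L p q p' q') x, f p q x = g p q x ->
     f p' q' (fop o x) = g p' q' (fop o x)) ->
  hom_eq f g.
Proof.
move=> hg ho; apply: free_ind => //.
- by move=> p q; rewrite !linear0.
- by move=> p q x y ex ey; rewrite !linearD ex ey.
- by move=> p q a x ex; rewrite !linearZ /= ex.
- by move=> i p q x ex; rewrite !hcomm ex.
Qed.

Lemma free_hom (A : mcx R n) (t : forall s, hom A (aU s)) (h : forall p q, A p q -> aG L p q) :
  (forall s p q x, aig s (h p q x) = t s p q x) ->
  exists u : hom A free_mcx, forall p q x, u p q x = fgen (h p q x).
Proof.
move=> ht; have [u ue] := qev_hom (t := t) (h := fun p q x => Tgen (h p q x) : term_raw p q) ht.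
by exists u => p q x; apply: free_ext => s; rewrite fev_gen ht -(ue s).
Qed.
End Free.

Section Colimits.
Variables (R : comPzRingType) (n : extnat).

Definition noop (p q p' q' : int) : Type := False.
Definition noop_int (A : mcx R n) p q p' q' (o : noop p q p' q') (x : A p q) : A p' q' :=
  match o with end.

(** The models are the cocones under X, hence the initial model is the coproduct. Coequalizers arise
    in the same way from the maps t with t f = t g. *)
Lemma mcx_coproducts : has_coproducts R n.
Proof.
move=> I X.
pose L := @AlgSig R n {T : mcx R n & forall i, hom (X i) T} (fun s => projT1 s)
  (fun p q => {i : I & X i p q}) noop (fun s p q g => projT2 s (projT1 g) p q (projT2 g))
  (fun s => @noop_int (projT1 s)).
have hi i : exists u : hom (X i) (free_mcx L), forall p q x,
    u p q x = fgen (existT _ i x : aG L p q).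
  exact: (free_hom (L := L) (t := fun s => projT2 s i) (h := fun p q x => existT _ i x)).
have {}hi i := cid (hi i).
exists (free_mcx L), (fun i => projT1 (hi i)) => T t; split.
  exists (fev (existT _ T t : aS L)) => i p q x /=; case: (hi i) => /= u ->.
  exact: (fev_gen (existT _ T t : aS L)).
move=> u v h; apply: free_hom_eq => // p q [i x].
by have := h i p q x => /=; case: (hi i) => /= w ->.
Qed.

Lemma mcx_coequalizers : has_coequalizers R n.
Proof.
move=> A B f g.
pose L := @AlgSig R n {T : mcx R n & {t : hom B T | hom_eq (hcomp t f) (hcomp t g)}} (fun s => projT1 s)
  (fun p q => B p q) noop (fun s p q x => sval (projT2 s) p q x)
  (fun s => @noop_int (projT1 s)).
have [//|c ce] := free_hom (L := L) (t := fun s => sval (projT2 s)) (h := fun p q x => x).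
exists (free_mcx L), c; split.
  move=> p q x /=; rewrite !ce; apply: free_ext => s; rewrite !fev_gen.
  exact: (proj2_sig (projT2 s)).
move=> T t h; split.
  exists (fev (existT _ T (exist _ t h) : aS L)) => p q x /=; rewrite ce.
  exact: (fev_gen (existT _ T (exist _ t h) : aS L)).
move=> u v uv; apply: free_hom_eq => // p q x.
by have := uv p q x; rewrite /= ce.
Qed.

Lemma initial_ex : exists O : mcx R n, initial O.
Proof.
have [O [i h]] := @mcx_coproducts False (fun f => match f with end).
exists O => A; have [[u _] uniq] := h A (fun f => match f with end); split; first by exists u.
by move=> f g; apply: uniq.
Qed.
End Colimits.

(** * The representing objects as term models *)

Section Representing.
Variables (R : comPzRingType) (n : extnat).
Implicit Types A B : mcx R n.

Lemma zsum_eq A p q (x : A p q) a a' l :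
  (forall j, (1 <= j <= l)%N -> a j = a' j) -> zsum x a l = zsum x a' l.
Proof. by move=> e; rewrite /zsum; congr (_ + _); apply: eq_big_nat => j h; rewrite e. Qed.

Lemma hom_zsum A B (f : hom A B) p q (x : A p q) a l :
  f _ _ (zsum x a l) = zsum (f p q x) (fun j => f _ _ (a j)) l.
Proof.
rewrite /zsum linearD linearZ /= hcomm; congr (_ + _); rewrite linear_sum.
by apply: eq_bigr => j _; rewrite linearZ /= hom_transp hcomm.
Qed.

Lemma zrel_eq A p q k (x : A p q) a a' :
  (forall j, (1 <= j < k)%N -> a j = a' j) -> zrel k x a -> zrel k x a'.
Proof.
move=> e h l lk; rewrite -[RHS](h l lk); apply: zsum_eq => j /andP[j1 jl].
by rewrite e // j1 (leq_ltn_trans jl).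
Qed.

Section ZW.
Variables (k : nat) (p q : int).

Record zw_model := ZWModel {
  zwA : mcx R n;
  zwx : zwA p q;
  zwa : forall j : nat, zwA (p - j%:Z) (q - j%:Z);
  zwP : zrel k zwx zwa
}.

Definition zw_sig := @AlgSig R n zw_model zwA (fun _ _ => option nat) noop
  (fun s p' q' g => if g is Some j then
     (if (1 <= j < k)%N then transp (zwa s j) p' q' else 0) else transp (zwx s) p' q')
  (fun s => @noop_int R n (zwA s)).

Definition ZW : mcx R n := free_mcx zw_sig.
Definition ZW0 : ZW p q := fgen (None : aG zw_sig p q).
Definition ZWa (j : nat) : ZW (p - j%:Z) (q - j%:Z) := fgen (Some j : aG zw_sig _ _).

Lemma ZW_is_ZW : is_ZW k ZW0 ZWa.
Proof.
have ev0 s : fev s p q ZW0 = zwx s by rewrite fev_gen /= transp_id.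
have eva s (j : nat) : (1 <= j < k)%N -> fev s _ _ (ZWa j) = zwa s j.
  by move=> h; rewrite fev_gen /= h transp_id.
split.
- move=> l lk; apply: free_ext => s; rewrite hom_zsum linear0 ev0.
  rewrite (@zsum_eq _ _ _ _ _ (zwa s)); first exact: zwP.
  by move=> j /andP[j1 jl]; rewrite eva // j1 (leq_ltn_trans jl).
- move=> A a0 a h; exists (fev (ZWModel h : aS zw_sig)); split; first exact: (ev0 (ZWModel h)).
  by move=> j hj; exact: (eva (ZWModel h)).
move=> A f f' e0 ea; apply: free_hom_eq => // p' q' [j|]; last first.
  have -> : fgen (None : aG zw_sig p' q') = transp ZW0 p' q'.
    by apply: free_ext => s; rewrite fev_gen hom_transp ev0.
  by rewrite !hom_transp e0.
case h : (1 <= j < k)%N; last first.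
  have -> : fgen (Some j : aG zw_sig p' q') = 0; last by rewrite !linear0.
  by apply: free_ext => s; rewrite fev_gen /= h linear0.
have -> : fgen (Some j : aG zw_sig p' q') = transp (ZWa j) p' q'.
  by apply: free_ext => s; rewrite fev_gen hom_transp eva //= h.
by rewrite !hom_transp ea.
Qed.
End ZW.

Section BW.
Variables (s : nat) (p q : int).

Record bw_model := BWModel {
  bwA : mcx R n;
  bwe : bwA p (q - 1);
  bwb0 : bwA (p + s%:Z - 1) (q + s%:Z - 2);
  bwb : forall k : nat, bwA (p + s%:Z - 1 - k%:Z) (q + s%:Z - 2 - k%:Z);
  bwc0 : bwA (p - 1) (q - 1);
  bwc : forall k : nat, bwA (p - 1 - k%:Z) (q - 1 - k%:Z);
  bwP : (2 <= s)%N -> zrel s.-1 bwb0 bwb /\ zrel s.-1 bwc0 bwc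
}.

Inductive bw_gen := GE | GB0 | GB of nat | GC0 | GC of nat.

Definition bw_int (m : bw_model) p' q' (g : bw_gen) : bwA m p' q' :=
  match g with
  | GE => transp (bwe m) p' q'
  | GB0 => if (2 <= s)%N then transp (bwb0 m) p' q' else 0
  | GB k => if (2 <= s)%N && (1 <= k < s.-1)%N then transp (bwb m k) p' q' else 0
  | GC0 => if (2 <= s)%N then transp (bwc0 m) p' q' else 0
  | GC k => if (2 <= s)%N && (1 <= k < s.-1)%N then transp (bwc m k) p' q' else 0
  end.

Definition bw_sig := @AlgSig R n bw_model bwA (fun _ _ => bw_gen) noop bw_int
  (fun m => @noop_int R n (bwA m)).

Definition BW : mcx R n := free_mcx bw_sig.
Definition BWgen (g : bw_gen) p' q' : BW p' q' := fgen (g : aG bw_sig p' q').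

Lemma BWgen_transp g p0 q0 p' q' :
  (forall m, bw_int m p' q' g = transp (bw_int m p0 q0 g) p' q') ->
  BWgen g p' q' = transp (BWgen g p0 q0) p' q'.
Proof. by move=> h; apply: free_ext => m; rewrite hom_transp !fev_gen /= h. Qed.

Lemma BWgen0 g p' q' : (forall m, bw_int m p' q' g = 0) -> BWgen g p' q' = 0.
Proof. by move=> h; apply: free_ext => m; rewrite fev_gen /= h linear0. Qed.

Lemma BW_is_BW : is_BW (s := s) (p := p) (q := q) (BWgen GB0 _ _) (fun k => BWgen (GB k) _ _)
  (BWgen GE _ _) (BWgen GC0 _ _) (fun k => BWgen (GC k) _ _).
Proof.
split.
- move=> s2; have trunc A P Q (x : A P Q) (a : forall k : nat, A (P - k%:Z) (Q - k%:Z)) l :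
      (l < s.-1)%N -> zsum x (fun k => if (2 <= s)%N && (1 <= k < s.-1)%N then a k else 0) l = zsum x a l.
    move=> ls; apply: zsum_eq => j /andP[j1 jl].
    by rewrite s2 j1 (leq_ltn_trans jl).
  split=> l ls; apply: free_ext => m; rewrite linear0 hom_zsum fev_gen /= s2 transp_id.
    rewrite -[RHS]((bwP m s2).1 l ls) -[RHS]trunc //; apply: zsum_eq => j _.
    by rewrite fev_gen /= transp_id.
  rewrite -[RHS]((bwP m s2).2 l ls) -[RHS]trunc //; apply: zsum_eq => j _.
  by rewrite fev_gen /= transp_id.
- move=> A e b0 b c0 c h; exists (fev (BWModel e h : aS bw_sig)).
  split; first by rewrite fev_gen /= transp_id.
  by move=> s2; split=> [|k hk||k hk]; rewrite fev_gen /= s2 ?hk transp_id.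
move=> A f f' [ee eo].
suff H g p' q' : f p' q' (BWgen g p' q') = f' p' q' (BWgen g p' q').
  by apply: free_hom_eq => // p' q' g; apply: H.
case: g => [||k||k].
- by rewrite (@BWgen_transp _ p (q - 1)) ?hom_transp ?ee // => m /=; rewrite transp_id.
- case s2 : (2 <= s)%N; last by rewrite BWgen0 ?linear0 // => m /=; rewrite s2.
  have [e1 _ _ _] := eo s2.
  rewrite (@BWgen_transp _ (p + s%:Z - 1) (q + s%:Z - 2)) ?hom_transp ?e1 // => m /=.
  by rewrite s2 transp_id.
- case s2 : ((2 <= s) && (1 <= k < s.-1))%N; last by rewrite BWgen0 ?linear0 // => m /=; rewrite s2.
  have /andP[s2' hk] := s2; have [_ e1 _ _] := eo s2'.
  rewrite (@BWgen_transp _ (p + s%:Z - 1 - k%:Z) (q + s%:Z - 2 - k%:Z)) ?hom_transp ?e1 // => m /=.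
  by rewrite s2 transp_id.
- case s2 : (2 <= s)%N; last by rewrite BWgen0 ?linear0 // => m /=; rewrite s2.
  have [_ _ e1 _] := eo s2.
  rewrite (@BWgen_transp _ (p - 1) (q - 1)) ?hom_transp ?e1 // => m /=.
  by rewrite s2 transp_id.
- case s2 : ((2 <= s) && (1 <= k < s.-1))%N; last by rewrite BWgen0 ?linear0 // => m /=; rewrite s2.
  have /andP[s2' hk] := s2; have [_ _ _ e1] := eo s2'.
  rewrite (@BWgen_transp _ (p - 1 - k%:Z) (q - 1 - k%:Z)) ?hom_transp ?e1 // => m /=.
  by rewrite s2 transp_id.
Qed.
End BW.
End Representing.

(** * The generating maps *)

Section Strands.
Variables (R : comPzRingType) (n : extnat).
Implicit Types A B X Y : mcx R n.

Lemma strand_seq_of A p q (s : ser A) :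
  strand p q s = seq_of (s 0%N p q) (fun j => s j (p - j%:Z) (q - j%:Z)).
Proof.
apply: ser_ext => l; apply: tot_ext => p' q'; rewrite strandE.
case: l => [|l]; rewrite /= /homog (transp_fun (s _)) ?subr0 [p' == _]eq_sym [q' == _]eq_sym //.
Qed.

Lemma strand_on A p q (s : ser A) l :
  strand p q s l (p - l%:Z) (q - l%:Z) = s l (p - l%:Z) (q - l%:Z).
Proof. by rewrite strandE !eqxx. Qed.

Lemma strandK A p q (s : ser A) : strand p q (strand p q s) = strand p q s.
Proof. by apply: ser_ext => l; apply: tot_ext => p' q'; rewrite !strandE; case: (_ && _). Qed.

Lemma ord_ge_strand A p q k (s : ser A) : ord_ge k s -> ord_ge k (strand p q s).
Proof. by move=> h l lk; apply: tot_ext => p' q'; rewrite strandE h // !dfunE if_same. Qed.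

Lemma strand_homog A p q (s : ser A) l p' q' : p' = p - l%:Z -> q' = q - l%:Z ->
  strand p q s l = homog (s l p' q').
Proof.
move=> -> ->; apply: tot_ext => p1 q1; rewrite strandE /homog (transp_fun (s l)).
by rewrite [p1 == _]eq_sym [q1 == _]eq_sym.
Qed.

Lemma strand_trunc A p q k (s : ser A) :
  strand p q (ser_trunc k s) = ser_trunc k (strand p q s).
Proof.
apply: ser_ext => l; apply: tot_ext => p' q'; rewrite strandE /ser_trunc.
by case: ltnP => _; [rewrite strandE | case: ifP].
Qed.

Lemma hser_strand A B (f : hom A B) p q (s : ser A) :
  hser f (strand p q s) = strand p q (hser f s).
Proof.
apply: ser_ext => l; apply: tot_ext => p' q'; rewrite /hser !strandE.
by case: ifP => //; rewrite linear0.
Qed.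

Lemma ser_d_trunc A k (s : ser A) l : (l < k)%N -> ser_d (ser_trunc k s) l = ser_d s l.
Proof. by apply: ser_d_eq => j jk; rewrite /ser_trunc jk. Qed.

Lemma hser_seq_of A B (f : hom A B) p q (x : A p q) a :
  hser f (seq_of x a) = seq_of (f p q x) (fun j => f _ _ (a j)).
Proof.
apply: ser_ext => -[|l]; apply: tot_ext => p' q'; exact: hom_transp.
Qed.

Lemma hser_drop A B (f : hom A B) k (s : ser A) :
  hser f (ser_drop k s) = ser_drop k (hser f s).
Proof. by []. Qed.

Lemma seq_of0 A p q (x : A p q) a : seq_of x a 0%N p q = x.
Proof. exact: homog_id. Qed.

Lemma seq_ofS A p q (x : A p q) a j : (0 < j)%N ->
  seq_of x a j (p - j%:Z) (q - j%:Z) = a j.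
Proof. by case: j => // j _; apply: homog_id. Qed.

Section ZWhom.
Variables (k : nat) (p q : int) (Z : mcx R n) (g0 : Z p q).
Variables (g : forall j : nat, Z (p - j%:Z) (q - j%:Z)).
Hypothesis ZP : is_ZW k g0 g.

(** The generators are a_0, ..., a_(k-1) for k >= 1, while for k = 0 there is still a_0; hence the
    bound [maxn k 1]. *)
Lemma ZW_hom A (a : ser A) : ord_ge k (ser_d a) -> exists u : hom Z A,
  forall j, (j < maxn k 1)%N ->
    hser u (seq_of g0 g) j (p - j%:Z) (q - j%:Z) = a j (p - j%:Z) (q - j%:Z).
Proof.
have [_ ex _] := ZP; move=> ha.
have [|u [u0 ua]] := ex A (a 0%N p q) (fun j => a j (p - j%:Z) (q - j%:Z)).
  by apply: zrel_strand => l /ha ->.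
exists u => -[|j] jk; rewrite hser_seq_of.
  by rewrite !subr0 seq_of0.
by rewrite seq_ofS // ua //; lia.
Qed.

Lemma ZW_hom_eq A (u u' : hom Z A) :
  (forall j, (j < maxn k 1)%N ->
    hser u (seq_of g0 g) j (p - j%:Z) (q - j%:Z) = hser u' (seq_of g0 g) j (p - j%:Z) (q - j%:Z)) ->
  hom_eq u u'.
Proof.
have [_ _ un] := ZP; move=> h; apply: un.
  have := h 0%N; rewrite !hser_seq_of !subr0 !seq_of0; apply; lia.
move=> j jk; have := h j; rewrite !hser_seq_of !seq_ofS; try lia.
by apply; lia.
Qed.
End ZWhom.

(** What a lift against the map from 0 to ZW_k(p,q) provides: agreement on one strand, in the
    coefficients of the generators only. *)
Definition slifts k p q X Y (f : hom X Y) := forall b : ser Y, ord_ge k (ser_d b) ->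
  exists2 a : ser X, ord_ge k (ser_d a) &
    forall l, (l < maxn k 1)%N -> hser f a l (p - l%:Z) (q - l%:Z) = b l (p - l%:Z) (q - l%:Z).

(** The strandwise lifts glue to a series whose image differs from b by O(t^k). This error lifts
    coefficientwise by surjectivity, and a correction of order k does not disturb the cycle
    condition. *)
Lemma slifts_lifts k X Y (f : hom X Y) :
  lifts 0 f -> (forall p q, slifts k p q f) -> lifts k f.
Proof.
move=> f0 fk b hb.
have /(@choice2 (fun _ _ => ser X)) [a ha] p q : exists a : ser X,
    ord_ge k (ser_d a) /\ forall l p' q', (l < maxn k 1)%N ->
    p' = p - l%:Z -> q' = q - l%:Z -> hser f a l p' q' = b l p' q'.
  by have [a h1 h2] := fk p q b hb; exists a; split=> // l p' q' lk -> ->; apply: h2.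
pose A := glue a.
have hA : ord_ge k (ser_d A).
  move=> l lk; apply: tot_ext => p q; rewrite ser_d_glue.
  by have [h _] := ha (p + l%:Z) (q - 1 + l%:Z); rewrite h.
have hd : ord_ge k (b - hser f A).
  move=> l lk; apply: tot_ext => p q; rewrite !dfunE.
  have [_ h] := ha (p + l%:Z) (q + l%:Z); apply/eqP; rewrite subr_eq0 eq_sym; apply/eqP.
  by apply: (h l p q); lia.
have [//|c _ ec] := f0 (b - hser f A).
pose c' : ser X := fun l => if (l < k)%N then 0 else c l.
have hc' : ord_ge k c' by move=> l lk; rewrite /c' lk.
exists (A + c'); first by rewrite linearD; apply: ord_geD => //; apply: ser_d_ord.
rewrite linearD /=; have -> : hser f c' = b - hser f A; last by rewrite addrC subrK.
apply: ser_ext => l; rewrite -ec; case: (ltnP l k) => lk; apply: tot_ext => p q.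
  by rewrite ec hd // /hser /c' lk !dfunE linear0.
by rewrite /hser /c' ltnNge lk.
Qed.

Lemma slifts0 X Y (f : hom X Y) : (forall p q, slifts 0 p q f) -> lifts 0 f.
Proof.
move=> h; apply/lifts0 => p q y; have [//|a _ ea] := h p q (fun _ => homog y).
exists (a 0%N p q); have := ea 0%N; rewrite !subr0 homog_id; exact.
Qed.

Lemma llp_zeroP k p q (O Z : mcx R n) (g0 : Z p q) g (z : hom O Z) X Y (f : hom X Y) :
  initial O -> is_ZW k g0 g -> llp z f <-> slifts k p q f.
Proof.
move=> Oi ZP; split=> [h b hb|h u v sq].
  have [v hv] := ZW_hom ZP hb; have [[u _] _] := Oi X.
  have [|w [_ w2]] := h u v; first by have [_ uniq] := Oi Y; apply: uniq.
  exists (hser w (seq_of g0 g)).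
    by rewrite hser_d; apply: ord_ge_hser; apply/zrelP; case: ZP.
  by move=> l lk; rewrite -hv // /hser -w2.
have [|a ha ea] := h (hser v (seq_of g0 g)).
  by rewrite hser_d; apply: ord_ge_hser; apply/zrelP; case: ZP.
have [w hw] := ZW_hom ZP ha; exists w; split; first by have [_ uniq] := Oi X; apply: uniq.
apply: (ZW_hom_eq ZP) => j jk; rewrite -ea //.
by rewrite /hser /= -[w _ _ _]/(hser w (seq_of g0 g) j _ _) hw.
Qed.
End Strands.

(** * The lifting property against iota, in terms of series *)

Section Iota.
Variables (R : comPzRingType) (n : extnat) (r : nat) (p q : int).
Local Notation P0 := (p + r.+1%:Z - 1).
Local Notation Q0 := (q + r.+1%:Z - 2).

Section Series.
Variables (A : mcx R n) (b0 : A P0 Q0) (b : forall k : nat, A (P0 - k%:Z) (Q0 - k%:Z)).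
Variables (e : A p (q - 1)) (c0 : A (p - 1) (q - 1)).
Variable c : forall k : nat, A (p - 1 - k%:Z) (q - 1 - k%:Z).

(** The generator e continues the b_k: its bidegree is that of a coefficient of t^r on the strand of
    b_0. *)
Definition bhat : ser A :=
  fun k => if (k < r)%N then seq_of b0 b k else if k == r then homog e else 0.
Definition chat : ser A := if (0 < r)%N then seq_of c0 c else 0.

(** In coefficient r + j of D applied to [bhat], the summands with i < j vanish because [bhat] stops
    at r, i = j gives d_j e, and i > j gives the b-part. In this form the relations for the images
    of the a_j follow from [ser_d_neg_drop] and the relations of the c_k. *)
Lemma iota_imgE j P Q : iota_img b0 b e c0 c j P Q =
  (ser_neg (ser_drop r (ser_d bhat)) + ser_shift chat) j P Q.
Proof.
rewrite /iota_img dfunE dfunE dfunE /ser_neg dfunE dfunE /ser_drop ser_dE transp_md.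
rewrite -(big_mkord xpredT (fun i => (-1) ^+ i *: delta i (bhat (r + j - i)%N) P Q)).
pose F i := (-1) ^+ i *: delta i (bhat (r + j - i)%N) P Q; rewrite -/(F _).
have -> : \sum_(0 <= i < (r + j).+1) F i = (-1) ^+ j *: delta j (homog e) P Q +
    \sum_(j.+1 <= i < (r + j).+1) F i.
  rewrite (big_cat_nat (n := j)) //=; last by lia.
  rewrite big_nat big1 ?add0r; last first.
    move=> i /andP[_ ij]; have h1 : (r + j - i < r)%N = false by lia.
    have h2 : ((r + j - i)%N == r) = false by lia.
    by rewrite /F /bhat h1 h2 linear0 !dfunE scaler0.
  by rewrite big_ltn; [rewrite {1}/F /bhat addnK ltnn eqxx | lia].
rewrite scalerDr scalerA -expr2 sqrr_sign scale1r -[RHS]addrA.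
congr (_ + _); rewrite /chat ltnS; case: ltnP => r0; last first.
  rewrite big_geq ?scaler0 ?add0r; last by lia.
  by case: (j).
congr (_ *: _ + _).
  rewrite !big_nat; apply: eq_bigr => i /andP[ji ir]; congr (_ *: _).
  have h : (r + j - i < r)%N by lia.
  rewrite addSn subn1 /= /F /bhat h.
  by case: (r + j - i)%N => [|k] /=; rewrite transp_md.
by case: (j) => [|[|j']].
Qed.

Lemma strand_bhat : strand P0 Q0 bhat = bhat.
Proof.
apply: ser_ext => l; apply: tot_ext => p' q'; rewrite strandE /bhat.
case: ltnP => lr; first by rewrite -[in RHS]strand_seq strandE.
case: (l =P r) => [el|_]; last by case: ifP.
case: ifP => // ne; rewrite /homog transp_neq //.
by apply: contraFN ne; subst l; lia.
Qed.

Lemma ord_bhat : ((0 < r)%N -> zrel r b0 b) -> ord_ge r (ser_d bhat).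
Proof.
move=> h l lr; have /zrelP h' := h (leq_ltn_trans (leq0n _) lr).
rewrite -[RHS](h' l lr); apply: (ser_d_eq (k := r)) => // k kr.
by rewrite /bhat kr.
Qed.

Lemma ord_chat : ((0 < r)%N -> zrel r c0 c) -> ord_ge r (ser_d chat).
Proof.
rewrite /chat; case: ifP => [_ h|_ _]; first by apply/zrelP; apply: h.
by rewrite linear0.
Qed.

Lemma bhatE k : (k < r)%N -> bhat k = seq_of b0 b k.
Proof. by move=> kr; rewrite /bhat kr. Qed.

Lemma bhat_last : bhat r = homog e.
Proof. by rewrite /bhat ltnn eqxx. Qed.

Lemma bhat_gt k : (r < k)%N -> bhat k = 0.
Proof. by move=> rk; rewrite /bhat !ifF //; lia. Qed.
End Series.

Lemma hser_bhat (A B : mcx R n) (f : hom A B) b0 b e :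
  hser f (bhat b0 b e) = bhat (f _ _ b0) (fun k => f _ _ (b k)) (f _ _ e).
Proof.
apply: ser_ext => k; rewrite {2}/bhat; case: ltnP => kr.
  by rewrite -hser_seq_of; apply: tot_ext => p' q'; rewrite /hser bhatE.
apply: tot_ext => p' q'; rewrite /hser /bhat ltnNge kr /=; case: ifP => _.
  exact: hom_transp.
by rewrite !dfunE linear0.
Qed.

Lemma hser_chat (A B : mcx R n) (f : hom A B) c0 c :
  hser f (chat c0 c) = chat (f _ _ c0) (fun k => f _ _ (c k)).
Proof. by rewrite /chat; case: ifP => _; rewrite ?hser_seq_of ?linear0. Qed.

Lemma iota_zrel (A : mcx R n) (b0 : A P0 Q0) b e c0 c :
  ((2 <= r.+1)%N -> zrel r b0 b /\ zrel r c0 c) ->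
  zrel r.+1 (iota_img b0 b e c0 c 0 p q)
    (fun j => iota_img b0 b e c0 c j (p - j%:Z) (q - j%:Z)).
Proof.
move=> h; pose s := ser_neg (ser_drop r (ser_d (bhat b0 b e))) + ser_shift (chat c0 c).
rewrite iota_imgE -/s.
apply: (zrel_eq (a := fun j => s j (p - j%:Z) (q - j%:Z))); first by move=> j _; rewrite iota_imgE.
apply: zrel_strand => l lr; rewrite /s linearD /= ser_d_neg_drop ?add0r ?ser_d_shift.
  rewrite (ord_ge_shift (k := r)) //; apply: ord_chat => r0.
  by case: (h r0).
by apply: ord_bhat => r0; case: (h r0).
Qed.

Section BWhom.
Variables (Bo : mcx R n) (b0 : Bo P0 Q0) (b : forall k : nat, Bo (P0 - k%:Z) (Q0 - k%:Z)).
Variables (e : Bo p (q - 1)) (c0 : Bo (p - 1) (q - 1)).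
Variable c : forall k : nat, Bo (p - 1 - k%:Z) (q - 1 - k%:Z).
Hypothesis BP : is_BW (s := r.+1) b0 b e c0 c.
Local Notation bh := (bhat b0 b e).
Local Notation ch := (chat c0 c).

Lemma BW_ord_bhat : ord_ge r (ser_d bh).
Proof. by apply: ord_bhat => r0; case: BP => h _ _; case: (h r0). Qed.

Lemma BW_hom (A : mcx R n) (a s : ser A) : (forall k, (r < k)%N -> a k = 0) -> strand P0 Q0 a = a ->
  ord_ge r (ser_d a) -> ord_ge r (ser_d s) ->
  exists v : hom Bo A, hser v bh = a /\ forall k, (k < r)%N ->
    hser v ch k (p - 1 - k%:Z) (q - 1 - k%:Z) = s k (p - 1 - k%:Z) (q - 1 - k%:Z).
Proof.
case: BP => _ ex _ at_ ast ha hs.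
have [|v [ve vo]] := ex A (a r p (q - 1)) (a 0%N P0 Q0) (fun k => a k (P0 - k%:Z) (Q0 - k%:Z))
   (s 0%N (p - 1) (q - 1)) (fun k => s k (p - 1 - k%:Z) (q - 1 - k%:Z)).
  by move=> _; split; apply: zrel_strand => l lr; rewrite ?ha ?hs.
exists v; split=> [|k kr]; last first.
  have r0 : (0 < r)%N by lia.
  have [_ _ vc0 vc] := vo r0.
  rewrite hser_chat /chat r0; case: k kr => [|k] kr; first by rewrite !subr0 seq_of0.
  by rewrite seq_ofS // vc //; lia.
rewrite hser_bhat; apply: ser_ext => k; rewrite /bhat; case: ltnP => kr.
  have r0 : (0 < r)%N by lia.
  have [vb0 vb _ _] := vo r0.
  rewrite -ast strand_seq_of; case: k kr => [|k] kr /=; first by rewrite vb0.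
  by rewrite vb //; lia.
case: eqP => [->|ne]; last by rewrite at_ //; lia.
by rewrite ve -[in RHS]ast; apply/esym; apply: strand_homog; lia.
Qed.

Lemma BW_hom_eq (A : mcx R n) (v v' : hom Bo A) : hser v bh = hser v' bh ->
  (forall k, (k < r)%N -> hser v ch k (p - 1 - k%:Z) (q - 1 - k%:Z) =
                          hser v' ch k (p - 1 - k%:Z) (q - 1 - k%:Z)) ->
  hom_eq v v'.
Proof.
case: BP => _ _ un eb ec; apply: un; split.
  have := congr1 (fun s : ser A => s r p (q - 1)) eb.
  by rewrite /hser bhat_last homog_id.
move=> r0; have {}r0 : (0 < r)%N := r0; split=> [|k kr||k kr].
- have := congr1 (fun s : ser A => s 0%N P0 Q0) eb.
  by rewrite /hser bhatE // seq_of0.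
- have := congr1 (fun s : ser A => s k (P0 - k%:Z) (Q0 - k%:Z)) eb.
  by rewrite /hser bhatE ?seq_ofS //; lia.
- by have := ec 0%N r0; rewrite /hser /chat r0 !subr0 seq_of0.
- have := ec k; rewrite /hser /chat r0 seq_ofS; last by lia.
  by apply; lia.
Qed.

Variables (Z : mcx R n) (g0 : Z p q) (g : forall j : nat, Z (p - j%:Z) (q - j%:Z)).
Variable i : hom Z Bo.
Hypotheses (ZP : is_ZW r.+1 g0 g) (iP : is_iota g0 g b0 b e c0 c i).

Lemma iota_ser j : (j <= r)%N -> hser i (seq_of g0 g) j (p - j%:Z) (q - j%:Z) =
  (ser_neg (ser_drop r (ser_d bh)) + ser_shift ch) j (p - j%:Z) (q - j%:Z).
Proof.
case: iP => i0 ij; rewrite hser_seq_of; case: j => [|j] jr.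
  by rewrite !subr0 seq_of0 i0 iota_imgE.
by rewrite seq_ofS // ij // iota_imgE.
Qed.

Lemma hom_iota_ser (A : mcx R n) (v : hom Bo A) j : (j <= r)%N ->
  hser (hcomp v i) (seq_of g0 g) j (p - j%:Z) (q - j%:Z) =
  (ser_neg (ser_drop r (ser_d (hser v bh))) + ser_shift (hser v ch)) j (p - j%:Z) (q - j%:Z).
Proof.
move=> jr; rewrite -[LHS]/(v _ _ (hser i _ j _ _)) iota_ser // hser_d -hser_shift -hser_drop.
by rewrite -hser_neg -linearD.
Qed.

(* The images of a_j, e and b_k under a map out of BW force those of the c_k. *)
Lemma iota_rest (A : mcx R n) (a be : ser A) : ord_ge r.+1 (ser_d a) -> ord_ge r (ser_d be) ->
  ser_d be r = a 0%N ->
  exists2 s : ser A, ord_ge r (ser_d s) & a = ser_neg (ser_drop r (ser_d be)) + ser_shift s.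
Proof.
move=> ha hb e0; pose d := a - ser_neg (ser_drop r (ser_d be)).
have d0 : d 0%N = 0 by rewrite /d !dfunE ser_neg0 /ser_drop addn0 e0 subrr.
exists (ser_drop 1 d); last by rewrite ser_drop1K // /d addrC subrK.
by apply: ser_d_drop1 => //; rewrite /d linearB /= ser_d_neg_drop // subr0.
Qed.

(** The cycle a defines the upper map of a square, and be, with the c-part forced by [iota_rest],
    the lower one. The filler is the image of [bhat] under the diagonal. *)
Lemma llp_iota_fill (X Y : mcx R n) (f : hom X Y) : llp i f ->
  forall (a : ser X) (be : ser Y), ord_ge r.+1 (ser_d a) -> ord_ge r (ser_d be) ->
  ser_d be r p q = f p q (a 0%N p q) ->
  exists al : ser X, [/\ ord_ge r (ser_d al), ser_d al r = homog (a 0%N p q) &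
    forall l, (l <= r)%N ->
      hser f al l (P0 - l%:Z) (Q0 - l%:Z) = be l (P0 - l%:Z) (Q0 - l%:Z)].
Proof.
move=> lf a be ha hbe e0.
(* Maps out of BW see one strand with coefficients 0 to r. Cutting be down to these changes no
   coefficient up to r of D on that strand. *)
pose be' := ser_trunc r.+1 (strand P0 Q0 be); pose a' := strand p q a.
have dbe' l : (l < r.+1)%N -> ser_d be' l = strand P0 (Q0 + 1) (ser_d be) l.
  by move=> lr; rewrite ser_d_trunc // ser_d_strand.
have hbe' : ord_ge r (ser_d be').
  by move=> l lr; rewrite dbe' 1?ltnW //; apply: (@ord_ge_strand _ _ _ _ _ r).
have ha' : ord_ge r.+1 (ser_d a') by rewrite ser_d_strand; apply: ord_ge_strand.
have [|||s hs es] := @iota_rest Y (hser f a') be'.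
- by rewrite hser_d; apply: ord_ge_hser.
- exact: hbe'.
- rewrite dbe' // (@strand_homog _ _ _ P0 (Q0 + 1) (ser_d be) r p q); try lia.
  rewrite e0; apply/esym/hser_homog; apply: strand_homog; lia.
have [||//|//|v [vb vc]] := @BW_hom Y be' s.
- by move=> k rk; rewrite /be' /ser_trunc ltnS leqNgt rk.
- by rewrite /be' strand_trunc strandK.
have [u hu] := ZW_hom ZP ha'.
have [|w [w1 w2]] := lf u v.
  apply: (ZW_hom_eq ZP) => j jr; have {}jr : (j <= r)%N by lia.
  rewrite hom_iota_ser // vb.
  rewrite -[LHS]/(f _ _ (hser u (seq_of g0 g) j _ _)) hu; last by lia.
  rewrite -[LHS]/(hser f a' j _ _) es !dfunE; congr (_ + _).
  case: j jr => [|j] jr //=.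
  have := vc j jr.
  have -> : p - 1 - j%:Z = p - j.+1%:Z by lia.
  by have -> : q - 1 - j%:Z = q - j.+1%:Z by lia.
exists (hser w bh); split.
- by rewrite hser_d; apply: ord_ge_hser; apply: BW_ord_bhat.
- rewrite hser_d -[in LHS]strand_bhat ser_d_strand.
  rewrite hser_strand (@strand_homog _ _ _ P0 (Q0 + 1) _ r p q); try lia.
  congr homog; have h0 : (0 < maxn r.+1 1)%N by lia.
  have := hu _ h0; rewrite !subr0 /a' strandE !subr0 !eqxx /= => <-.
  have := @hom_iota_ser X w 0%N (leq0n _).
  rewrite !subr0 dfunE dfunE dfunE ser_neg0 /= dfunE addr0 /ser_drop addn0 hser_d => <-.
  by rewrite /hser /= -w1.
move=> l lr; have -> : hser f (hser w bh) = be'.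
  by rewrite -vb; apply: ser_ext => k; apply: tot_ext => p' q'; apply: w2.
by rewrite /be' /ser_trunc ltnS lr strand_on.
Qed.

(** The filler along the image of [bhat] prescribes the diagonal on the b_k and e, and [iota_rest]
    then prescribes it on the c_k. The lower triangle commutes on the c_k because the b-parts cancel
    from the commutation of the square. *)
Lemma fill_llp_iota (X Y : mcx R n) (f : hom X Y) : fills r f -> llp i f.
Proof.
move=> ff u v sq; pose a := hser u (seq_of g0 g); pose be := hser v bh.
have ha : ord_ge r.+1 (ser_d a).
  by rewrite hser_d; apply: ord_ge_hser; apply/zrelP; case: ZP.
have hbe : ord_ge r (ser_d be) by rewrite hser_d; apply: ord_ge_hser; apply: BW_ord_bhat.
have ea0 : a 0%N = homog (a 0%N p q).
  by rewrite /a hser_seq_of /= homog_id.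
have sqj j : (j <= r)%N -> hser f a j (p - j%:Z) (q - j%:Z) =
    (ser_neg (ser_drop r (ser_d be)) + ser_shift (hser v ch)) j (p - j%:Z) (q - j%:Z).
  by move=> jr; rewrite -hom_iota_ser //; apply: sq.
have [|||al [fal hal al0]] := ff p q (a 0%N p q) be.
- exact: Zr_comp.
- exact: hbe.
- rewrite /be hser_d -[in LHS]strand_bhat ser_d_strand.
  rewrite hser_strand (@strand_homog _ _ _ P0 (Q0 + 1) _ r p q); try lia.
  congr homog; have := sqj 0%N (leq0n _).
  by rewrite !subr0 dfunE dfunE dfunE ser_neg0 /= dfunE addr0 /ser_drop addn0 /be hser_d => <-.
pose al' := ser_trunc r.+1 (strand P0 Q0 al).
have dal l : (l < r.+1)%N -> ser_d al' l = strand P0 (Q0 + 1) (ser_d al) l.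
  by move=> lr; rewrite ser_d_trunc // ser_d_strand.
have hal' : ord_ge r (ser_d al').
  by move=> l lr; rewrite dal 1?ltnW //; apply: (@ord_ge_strand _ _ _ _ _ r).
have fal' : hser f al' = be.
  have -> : hser f al' = ser_trunc r.+1 (strand P0 Q0 (hser f al)).
    apply: ser_ext => l; apply: tot_ext => p' q'; rewrite /hser /al' /ser_trunc.
    case: ifP => _; last by rewrite !dfunE linear0.
    by rewrite -[RHS](congr1 (fun z : ser Y => z l p' q') (hser_strand f P0 Q0 al)).
  rewrite fal /be hser_bhat strand_bhat; apply: ser_ext => l; rewrite /ser_trunc.
  by case: ltnP => // lr; rewrite bhat_gt.
have [|s hs es] := @iota_rest X a al' ha hal'.
  rewrite dal // (@strand_homog _ _ _ P0 (Q0 + 1) _ r p q); try lia.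
  by rewrite al0 homog_id -ea0.
have [||//|//|w [wb wc]] := @BW_hom X al' s.
- by move=> k rk; rewrite /al' /ser_trunc ltnS leqNgt rk.
- by rewrite /al' strand_trunc strandK.
exists w; split.
  apply: (ZW_hom_eq ZP) => j jr; have {}jr : (j <= r)%N by lia.
  rewrite hom_iota_ser // wb -/a es !dfunE; congr (_ + _).
  case: j jr => [|j] jr //=.
  have := wc j jr.
  have -> : p - 1 - j%:Z = p - j.+1%:Z by lia.
  by have -> : q - 1 - j%:Z = q - j.+1%:Z by lia.
apply: BW_hom_eq; first by rewrite -[LHS]/(hser f (hser w bh)) wb fal'.
move=> k kr; rewrite -[LHS]/(f _ _ (hser w ch k _ _)) wc //.
have := sqj k.+1 kr; rewrite es linearD /= hser_neg hser_shift.
rewrite hser_drop -hser_d fal' !dfunE => /addrI /=.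
have -> : p - 1 - k%:Z = p - k.+1%:Z by lia.
by have -> : q - 1 - k%:Z = q - k.+1%:Z by lia.
Qed.
End BWhom.
End Iota.

(** * Compactness *)

Section DirectedColimit.
Variables (R : comPzRingType) (n : extnat).
Variables (I : Type) (le : I -> I -> Prop) (X : I -> mcx R n).
Variables (t : forall i j, le i j -> hom (X i) (X j)) (Cl : mcx R n) (c : forall i, hom (X i) Cl).
Hypothesis inh : exists i : I, True.
Hypothesis le_refl : forall i, le i i.
Hypothesis le_tr : forall i j k, le i j -> le j k -> le i k.
Hypothesis dir : forall i j, exists k, le i k /\ le j k.
Hypothesis t_comp : forall i j k (e1 : le i j) (e2 : le j k) (e3 : le i k),
  hom_eq (t e3) (hcomp (t e2) (t e1)).
Hypothesis ct : forall i j (e : le i j), hom_eq (hcomp (c j) (t e)) (c i).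
Hypothesis univ : forall (T : mcx R n) (s : forall i, hom (X i) T),
  (forall i j (e : le i j), hom_eq (hcomp (s j) (t e)) (s i)) ->
  (exists u : hom Cl T, forall i, hom_eq (hcomp u (c i)) (s i)) /\
  (forall u v : hom Cl T, (forall i, hom_eq (hcomp u (c i)) (hcomp v (c i))) -> hom_eq u v).

(* The images of the X_i form a subcomplex through which the identity factors. *)
Lemma colim_surj p q (y : Cl p q) : exists i (x : X i p q), c i p q x = y.
Proof.
pose P p q (y : Cl p q) := exists i (x : X i p q), c i p q x = y.
have [||||E [e [eP ei eu]]] := @sub_mcx R n Cl P.
- by move=> p' q'; case: inh => i _; exists i, 0; rewrite linear0.
- move=> p' q' _ _ [i [x <-]] [j [x' <-]]; have [k [ik jk]] := dir i j.
  exists k, (t ik _ _ x + t jk _ _ x'); rewrite linearD.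
  by congr (_ + _); apply: ct.
- by move=> p' q' a _ [i [x <-]]; exists i, (a *: x); rewrite linearZ.
- by move=> k p' q' _ [i [x <-]]; exists i, (md (X i) k p' q' x); rewrite hcomm.
have hi i : exists u : hom (X i) E, hom_eq (hcomp e u) (c i).
  by apply: eu => p' q' x; exists i, x.
pose s i := projT1 (cid (hi i)).
have es i : hom_eq (hcomp e (s i)) (c i) by rewrite /s; case: cid.
have [|[u us] _] := @univ E s.
  move=> i j ij p' q' x; apply: ei.
  by rewrite -[LHS]/(hcomp e (s j) p' q' _) es -[RHS]/(hcomp e (s i) p' q' _) es; apply: ct.
have [_ uniq] := @univ Cl c (fun i j e => ct e).
have idE : hom_eq (hcomp e u) (hid Cl).
  apply: uniq => i p' q' x /=.
  by rewrite -[u _ _ _]/(hcomp u (c i) p' q' x) us; apply: es.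
by have := eP _ _ (u p q y); rewrite -[e _ _ _]/(hcomp e u p q y) idE.
Qed.

Definition tail (P : I -> Prop) := exists i, forall j, le i j -> P j.

Lemma tailT : tail (fun _ => True).
Proof. by case: inh => i _; exists i. Qed.

Lemma tailI P Q : tail P -> tail Q -> tail (fun i => P i /\ Q i).
Proof.
move=> [i hi] [j hj]; have [k [ik jk]] := dir i j; exists k => l kl.
by split; [apply: hi; apply: le_tr kl | apply: hj; apply: le_tr kl].
Qed.

Lemma tailS (P Q : I -> Prop) : (forall i, P i -> Q i) -> tail P -> tail Q.
Proof. by move=> PQ [i hi]; exists i => j ij; apply: PQ; apply: hi. Qed.

Definition tails : pfilter I := PFilter tailT tailI tailS.

(* The product of the X_i modulo eventual equality receives a cocone that
   detects the elements which never vanish. *)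
Lemma colim_inj i p q (x : X i p q) : c i p q x = 0 ->
  exists j (e : le i j), t e p q x = 0.
Proof.
pose M := sub_raw (gsub_all X).
(* An element of X_i is transported to the later stages and set to 0 elsewhere; linearity and
   compatibility hold on the tail above i. *)
pose rep i p q (x : X i p q) : M p q := exist _ (fun j =>
  match pselect (le i j) with left e => t e p q x | right _ => 0 end) Logic.I.
have hs j : exists s : hom (X j) (qmcx tails M), forall p q y, s p q y = qcl tails (rep j p q y).
  apply: qmcx_hom => [a p' q' y y'|k p' q' y]; exists j => l jl /=;
    case: pselect => // e; by rewrite ?linearP ?hcomm.
pose s j := projT1 (cid (hs j)).
have sE j p' q' y : s j p' q' y = qcl tails (rep j p' q' y) by rewrite /s; case: cid.
have [|[u us] _] := @univ _ s.
  move=> j k jk p' q' y /=; rewrite !sE; apply/qpiP; exists k => l kl /=.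
  case: pselect => // kl'; case: pselect => [jl|nle]; last by case: nle; apply: le_tr kl.
  exact/esym/(t_comp jk kl' jl).
move=> cx; have : s i p q x = 0.
  by rewrite -us /= cx linear0.
rewrite sE => /(@qpiP _ _ tails) [j hj]; have [k [ik jk]] := dir i j.
exists k, ik; have /= := hj k jk; case: pselect => // e.
by rewrite (Prop_irrelevance e ik).
Qed.

Lemma colim_bound (P : nat -> I -> Prop) m :
  (forall j i i', le i i' -> P j i -> P j i') ->
  (forall j, (j < m)%N -> exists i, P j i) -> exists i, forall j, (j < m)%N -> P j i.
Proof.
move=> Pm; elim: m => [_|m IH h]; first by case: inh => i _; exists i.
have [|i hi] := IH; first by move=> j jm; apply: h; apply: ltnW.
have [i' hi'] := h m (leqnn _); have [k [ik i'k]] := dir i i'.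
exists k => j; rewrite ltnS leq_eqVlt => /orP[/eqP->|jm]; first exact: Pm i'k hi'.
by apply: Pm ik _; apply: hi.
Qed.

Variables (k : nat) (p q : int) (Z : mcx R n) (g0 : Z p q).
Variables (g : forall j : nat, Z (p - j%:Z) (q - j%:Z)).
Hypothesis ZP : is_ZW k g0 g.
Local Notation gs := (seq_of g0 g).

(** The finitely many generators have preimages at a common stage i, and the finitely many
    relations, true in the colimit, become true at a later stage i'. *)
Lemma ZW_colim_surj (v : hom Z Cl) : exists i (h : hom Z (X i)), hom_eq (hcomp (c i) h) v.
Proof.
pose a := hser v gs.
have ha : ord_ge k (ser_d a).
  by rewrite hser_d; apply: ord_ge_hser; apply/zrelP; case: ZP.
have [||i hi] := @colim_bound (fun j i => exists x : X i (p - j%:Z) (q - j%:Z),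
    c i _ _ x = a j (p - j%:Z) (q - j%:Z)) (maxn k 1).
- by move=> j i i' ii' [x <-]; exists (t ii' _ _ x); apply: ct.
- by move=> j _; apply: colim_surj.
have hx (j : nat) : exists x : X i (p - j%:Z) (q - j%:Z), (j < maxn k 1)%N ->
    c i _ _ x = a j (p - j%:Z) (q - j%:Z).
  case: (boolP (j < maxn k 1)%N) => [/hi[x hx]|]; first by exists x.
  by exists 0.
pose a1 : ser (X i) := fun j => homog (projT1 (cid (hx j))).
have ca1 j : (j < maxn k 1)%N ->
    hser (c i) a1 j (p - j%:Z) (q - j%:Z) = a j (p - j%:Z) (q - j%:Z).
  by move=> jk; rewrite /hser /a1 homog_id; case: cid => /= x ->.
have da1 l : (l < k)%N -> c i _ _ (ser_d a1 l (p - l%:Z) (q + 1 - l%:Z)) = 0.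
  move=> lk; rewrite -[LHS]/(hser (c i) (ser_d a1) l _ _) -hser_d -(strand_on p (q + 1)).
  rewrite -ser_d_strand (@ser_d_eq _ _ _ k _ (strand p q a)) //.
    by rewrite ser_d_strand strand_on ha.
  move=> j jk; rewrite !(@strand_homog _ _ _ p q _ j (p - j%:Z) (q - j%:Z)) // ca1 //.
  by lia.
(* The bound is k + 1 so that the index k, with no relation to satisfy, provides a transition from i
   to i' even for k = 0. *)
have [||i' hi'] := @colim_bound (fun l i' => exists e : le i i', (l < k)%N ->
    t e _ _ (ser_d a1 l (p - l%:Z) (q + 1 - l%:Z)) = 0) k.+1.
- move=> j i1 i2 i12 [e he]; exists (le_tr e i12) => jk.
  by rewrite (t_comp e i12) /= he // linear0.
- move=> l _; case: (boolP (l < k)%N) => lk; last by exists i, (le_refl i).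
  by have [i' [e he]] := colim_inj (da1 l lk); exists i', e.
have [e _] := hi' k (leqnn _).
pose a2 := strand p q (hser (t e) a1).
have ha2 : ord_ge k (ser_d a2).
  move=> l lk; rewrite /a2 ser_d_strand (@strand_homog _ _ _ p (q + 1) _ l _ _ erefl erefl) hser_d.
  have [e' /(_ lk) h] := hi' l (ltnW lk).
  by rewrite /hser (Prop_irrelevance e e') h linear0.
have [h hh] := ZW_hom ZP ha2; exists i', h.
apply: (ZW_hom_eq ZP) => j jk; rewrite -/a -ca1 //.
rewrite -[LHS]/(c i' _ _ (hser h gs j _ _)) hh // /a2 strand_on.
exact: (ct e).
Qed.

Lemma ZW_colim_inj i (h h' : hom Z (X i)) : hom_eq (hcomp (c i) h) (hcomp (c i) h') ->
  exists j (e : le i j), hom_eq (hcomp (t e) h) (hcomp (t e) h').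
Proof.
move=> hh'; pose x j := (hser h gs - hser h' gs) j (p - j%:Z) (q - j%:Z).
have cx j : c i _ _ (x j) = 0.
  by rewrite /x !dfunE linearB; apply/eqP; rewrite subr_eq0; apply/eqP; apply: hh'.
have [||i' hi'] := @colim_bound (fun j i' => exists e : le i i', t e _ _ (x j) = 0) (maxn k 1).
- by move=> j i1 i2 i12 [e he]; exists (le_tr e i12); rewrite (t_comp e i12) /= he linear0.
- by move=> j _; apply: colim_inj (cx j).
have [|e _] := hi' 0%N; first by lia.
exists i', e; apply: (ZW_hom_eq ZP) => j jk; have [e' he'] := hi' j jk.
move: he'; rewrite (Prop_irrelevance e' e) /x !dfunE linearB => /eqP.
by rewrite subr_eq0 => /eqP.
Qed.
End DirectedColimit.

Lemma ZW_compact (R : comPzRingType) (n : extnat) k p q (Z : mcx R n) (g0 : Z p q) g :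
  is_ZW k g0 g -> compact Z.
Proof.
move=> ZP I le X t Cl c inh lr ltr dir _ tc ct univ; split=> [v|i h h' e].
  exact: (ZW_colim_surj inh lr ltr dir tc ct univ ZP).
exact: (ZW_colim_inj inh ltr dir tc univ ZP e).
Qed.

Lemma initial_compact (R : comPzRingType) (n : extnat) (O : mcx R n) :
  initial O -> compact O.
Proof.
move=> Oi I le X t Cl c [i _] lr _ _ _ _ _ _; split=> [v|j h h' _].
  have [[h _] _] := Oi (X i); exists i, h.
  by have [_ uniq] := Oi Cl; apply: uniq.
by exists j, (lr j); have [_ uniq] := Oi (X j); apply: uniq.
Qed.

(** * The generating sets and the lifting properties that they detect *)

Section Generators.
Variables (R : comPzRingType) (n : extnat) (r : nat).

Lemma gen_data_ex : exists G : gen_data R n r, gen_data_ok G.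
Proof.
have [O Oi] := initial_ex R n.
have hz k p q : exists z : hom O (ZW R n k p q), True by have [h _] := Oi (ZW R n k p q).
pose b0 p q : BW R n r.+1 p q _ _ := BWgen R n r.+1 p q GB0 (p + r.+1%:Z - 1) (q + r.+1%:Z - 2).
pose b p q (k : nat) : BW R n r.+1 p q _ _ :=
  BWgen R n r.+1 p q (GB k) (p + r.+1%:Z - 1 - k%:Z) (q + r.+1%:Z - 2 - k%:Z).
pose e p q : BW R n r.+1 p q _ _ := BWgen R n r.+1 p q GE p (q - 1).
pose c0 p q : BW R n r.+1 p q _ _ := BWgen R n r.+1 p q GC0 (p - 1) (q - 1).
pose c p q (k : nat) : BW R n r.+1 p q _ _ :=
  BWgen R n r.+1 p q (GC k) (p - 1 - k%:Z) (q - 1 - k%:Z).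
have hi p q : exists i : hom (ZW R n r.+1 p q) (BW R n r.+1 p q),
    is_iota (ZW0 R n r.+1 p q) (ZWa R n r.+1 p q) (b0 p q) (b p q) (e p q) (c0 p q) (c p q) i.
  have [_ ex _] := ZW_is_ZW R n r.+1 p q; have [rel _ _] := BW_is_BW R n r.+1 p q.
  have [i [i0 ij]] := ex _ _ _ (iota_zrel (e p q) rel).
  by exists i.
exists (@GenData R n r O (ZW R n) (fun k p q => ZW0 R n k p q) (fun k p q => ZWa R n k p q)
  (BW R n r.+1) b0 b e c0 c (fun k p q => projT1 (cid (hz k p q))) (fun p q => projT1 (cid (hi p q)))).
split=> //=.
- by move=> k p q; apply: ZW_is_ZW.
- by move=> p q; apply: BW_is_BW.
- by move=> p q; case: cid.
Qed.

Variables (G : gen_data R n r) (GP : gen_data_ok G).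
Variables (X Y : mcx R n) (f : hom X Y).

Lemma llp_zero_slifts k p q : llp (gd_zero G k p q) f <-> slifts k p q f.
Proof. by case: GP => Oi ZP _ _; apply: llp_zeroP. Qed.

Lemma lifts_slifts k p q : lifts k f -> slifts k p q f.
Proof. by move=> h b /h[a ha <-]; exists a. Qed.

Lemma rlp_JP : rlp (J_prime G) f <-> forall k, (k <= r)%N -> lifts k f.
Proof.
split=> h; last first.
  move=> [[[k p] q] /= kr]; apply/llp_zero_slifts; apply: lifts_slifts.
  exact: h.
have sl k p q : (k <= r)%N -> slifts k p q f.
  by move=> kr; apply/llp_zero_slifts; apply: (h (exist _ (k, p, q) kr)).
have l0 : lifts 0 f by apply: slifts0 => p q; apply: sl.
by move=> k kr; apply: slifts_lifts => // p q; apply: sl.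
Qed.

Lemma rlp_I_fill : rlp (I_prime G) f ->
  forall P Q (a : ser X) (be : ser Y), ord_ge r.+1 (ser_d a) -> ord_ge r (ser_d be) ->
  ser_d be r (P - r%:Z) (Q + 1 - r%:Z) = hser f a 0%N (P - r%:Z) (Q + 1 - r%:Z) ->
  exists al : ser X, [/\ ord_ge r (ser_d al),
    ser_d al r = homog (a 0%N (P - r%:Z) (Q + 1 - r%:Z)) &
    forall l, (l <= r)%N -> hser f al l (P - l%:Z) (Q - l%:Z) = be l (P - l%:Z) (Q - l%:Z)].
Proof.
case: GP => _ ZP BP iP h P Q a be ha hbe e.
have hl : llp (gd_iota G (P - r%:Z) (Q + 1 - r%:Z)) f := h (inr (P - r%:Z, Q + 1 - r%:Z)).
have [al [h1 h2 h3]] := llp_iota_fill (BP _ _) (ZP _ _ _) (iP _ _) hl ha hbe e.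
exists al; split=> // l /h3.
have -> : P - r%:Z + r.+1%:Z - 1 - l%:Z = P - l%:Z by lia.
by have -> : Q + 1 - r%:Z + r.+1%:Z - 2 - l%:Z = Q - l%:Z by lia.
Qed.

(** The set contains the J_k for 1 <= k <= r-1 only. Lifting of k-cycles for k = 0, r and r+1 is
    extracted from iota. *)
Lemma rlp_IP : rlp (I_prime G) f <->
  ((forall k, (k <= r.+1)%N -> lifts k f) /\ fills r f).
Proof.
split=> [h|[lf ff] [[[[k p] q] kr]|[p q]]]; last 2 first.
- apply/llp_zero_slifts; apply: lifts_slifts; apply: lf; move: kr => /=; lia.
- by case: GP => _ ZP BP iP; apply: (fill_llp_iota (BP p q) (ZP _ p q) (iP p q)).
have fill := rlp_I_fill h.
(* An (r+1)-cycle is a witness that 0 is a boundary, so it lifts as a filler for a = 0. *)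
have slS p q : slifts r.+1 p q f.
  move=> be hbe; have [|||al [h1 h2 h3]] := fill p q 0 be.
  - by rewrite linear0.
  - exact: ord_ge_le hbe.
  - by rewrite hbe // !linear0.
  exists al; last by move=> l lr; apply: h3; lia.
  by apply: ord_geS => //; rewrite h2 !dfunE linear0.
(* The r-th differential of an r-cycle is a cycle of every length and lifts by [slS]. Then be is a
   witness that its image is a boundary, and iota lifts be. *)
have cyc p q (be : ser Y) : ord_ge r (ser_d be) -> exists al : ser X, ord_ge r (ser_d al) /\
    forall l, (l <= r)%N -> hser f al l (p - l%:Z) (q - l%:Z) = be l (p - l%:Z) (q - l%:Z).
  move=> hbe; have [|a ha ea] := slS (p - r%:Z) (q + 1 - r%:Z) (ser_neg (ser_drop r (ser_d be))).
    by rewrite ser_d_neg_drop.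
  have [|al [h1 _ h3]] := fill p q a be ha hbe; last by exists al.
  have := ea 0%N; rewrite !subr0 ser_neg0 /ser_drop addn0 => -> //; lia.
have l0 : lifts 0 f.
  (* Placed as the coefficient of t^r, an arbitrary element y belongs to an r-cycle. *)
  apply/lifts0 => p q y; pose be : ser Y := fun k => if k == r then homog y else 0.
  have [|al [_ h3]] := cyc (p + r%:Z) (q + r%:Z) be.
    by apply: ser_d_ord => l lr; rewrite /be ltn_eqF.
  exists (al r p q); have := h3 r (leqnn r); rewrite !addrK /be eqxx homog_id; exact.
have lf k : (k <= r.+1)%N -> lifts k f.
  case: k => [//|k] kr; apply: slifts_lifts => // p q.
  case: (ltngtP k.+1 r) kr => [kr _|rk kr|-> _].
  - apply/llp_zero_slifts.
    have kr' : (1 <= k.+1 <= r.-1)%N by lia.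
    exact: (h (inl (exist _ (k.+1, p, q) kr'))).
  - by have -> : k.+1 = r.+1 by lia.
  move=> be /(cyc p q)[al [h1 h3]]; exists al => // l lr; apply: h3.
  by lia.
split=> // p q x b /ZrP[a ea ha] hb eb.
have [|al [h1 h2 _]] := fill (p + r%:Z) (q - 1 + r%:Z) a b ha hb.
  have -> : p + r%:Z - r%:Z = p by ring.
  have -> : q - 1 + r%:Z + 1 - r%:Z = q by ring.
  by rewrite eb (hser_homog f ea).
(* The filler matches b on one strand and up to coefficient r only. The remaining error is an
   (r+1)-cycle, whose lift leaves the boundary unchanged. *)
have [|c hc ec] := lf r.+1 (leqnn _) (b - hser f al).
  rewrite linearB /= hser_d; apply: ord_geS.
    by apply: ord_geB => //; apply: ord_ge_hser.
  have e2 : ser_d al r = homog x.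
    rewrite h2; have -> : p + r%:Z - r%:Z = p by ring.
    have -> : q - 1 + r%:Z + 1 - r%:Z = q by ring.
    by rewrite ea homog_id.
  by rewrite !dfunE eb (hser_homog f e2) subrr.
exists (al + c); split.
- by rewrite linearD /= ec addrC subrK.
- by rewrite linearD; apply: ord_geD => //; apply: ord_ge_le hc.
rewrite linearD /= dfunE hc // addr0 h2; have -> : p + r%:Z - r%:Z = p by ring.
have -> : q - 1 + r%:Z + 1 - r%:Z = q by ring.
by rewrite ea homog_id.
Qed.

Lemma J_compact t : compact (@ms_dom R n (J_prime G) t).
Proof. by case: GP => Oi _ _ _; apply: initial_compact. Qed.

Lemma I_compact t : compact (@ms_dom R n (I_prime G) t).
Proof.
case: GP => Oi ZP _ _; case: t => [t|[p q]]; first exact: initial_compact.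
exact: ZW_compact (ZP _ p q).
Qed.
End Generators.

(** * The cone of length r *)

Section InternalGrading.
Variables (R : comPzRingType) (n : extnat) (V : lmodType R).
Variables (vd : nat -> {linear V -> V}) (mu : int -> int -> {linear V -> V}).
Hypothesis mu_id : forall p q v, mu p q (mu p q v) = mu p q v.
Hypothesis vd_mu : forall i p q v, vd i (mu p q v) = mu (p - i%:Z) (q + 1 - i%:Z) (vd i v).
Hypothesis vd_vanish : forall i v, ext_le n i -> vd i v = 0.
Hypothesis vd_rel : forall l v,
  \sum_(j < l.+1) (-1) ^+ (l - j) *: vd (l - j) (vd j v) = 0.

(** The component in bidegree (p,q) is the image of the projection [mu p q], encoded as V modulo
    equality of projections. A multicomplex can thus be specified by ungraded differentials on V. *)
Definition int_raw p q : rawmod (fun _ : unit => V) :=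
  @RawMod R unit (fun _ => V) V 0 +%R *:%R (fun _ v => mu p q v)
    (fun _ => linear0 (mu p q)) (fun _ => linearD (mu p q)) (fun _ a => linearZ_LR (mu p q) a).

Definition iobj p q : lmodType R := qmod (pf_all unit) (int_raw p q).
Definition icl p q (v : V) : iobj p q := qpi (pf_all unit) (v : int_raw p q).
Definition ival p q (x : iobj p q) : V := mu p q (qrepr x : V).

Lemma ival_cl p q v : ival (icl p q v) = mu p q v.
Proof. exact: (qrepr_pi (pf_all unit) (v : int_raw p q) tt). Qed.

Lemma ival_inj p q : injective (@ival p q).
Proof. by move=> x y e; apply: (qrep_inj _ (qrep_refl y)) => s; apply: e. Qed.

Lemma ival_is_linear p q : linear (@ival p q).
Proof.
move=> a x y; have := qrepD (qrepZ a (qrep_refl x)) (qrep_refl y).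
by move=> /(_ tt).
Qed.
HB.instance Definition _ p q :=
  GRing.isLinear.Build R (iobj p q) V _ (@ival p q) (@ival_is_linear p q).

Lemma mu_ival p q (x : iobj p q) : mu p q (ival x) = ival x.
Proof. exact: mu_id. Qed.

Definition imd i p q (x : iobj p q) : iobj (p - i%:Z) (q + 1 - i%:Z) := icl _ _ (vd i (ival x)).

Lemma ival_d i p q (x : iobj p q) : ival (imd i x) = vd i (ival x).
Proof. by rewrite /imd ival_cl -vd_mu mu_ival. Qed.

Lemma imd_is_linear i p q : linear (@imd i p q).
Proof. by move=> a x y; apply: ival_inj; rewrite ival_d !linearP /= !ival_d. Qed.
HB.instance Definition _ i p q :=
  GRing.isLinear.Build R (iobj p q) (iobj (p - i%:Z) (q + 1 - i%:Z)) _ (@imd i p q) (@imd_is_linear i p q).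

Lemma ival_transp p q (x : iobj p q) p' q' : p = p' -> q = q' ->
  ival (transp x p' q') = ival x.
Proof. by move=> <- <-; rewrite transp_id. Qed.

Program Definition imcx : mcx R n := @Mcx R n iobj (fun i p q => @imd i p q) _ _.
Next Obligation. by apply: ival_inj; rewrite ival_d vd_vanish // linear0. Qed.
Next Obligation.
apply: ival_inj; rewrite linear0 linear_sum -[RHS](vd_rel l (ival x)).
apply: eq_bigr => j _; rewrite linearZ /=; congr (_ *: _).
by rewrite ival_transp ?ival_d //; have := ltn_ord j; lia.
Qed.

Definition iv p q (x : imcx p q) : V := ival x.

Definition iser (v : nat -> V) l : V :=
  \sum_(i < l.+1) (-1) ^+ i *: vd i (v (l - i)%N).

Lemma iv_ser_d (s : ser imcx) l p q : iv (ser_d s l p q) =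
  \sum_(i < l.+1) (-1) ^+ i *: vd i (iv (s (l - i)%N (p + i%:Z) (q - 1 + i%:Z))).
Proof.
rewrite ser_dE /iv linear_sum; apply: eq_bigr => i _; rewrite linearZ /=; congr (_ *: _).
by rewrite /delta ival_transp ?ival_d //; lia.
Qed.

Lemma iv_ser_d_strand (s : ser imcx) l p q :
  iv (ser_d s l (p - l%:Z) (q + 1 - l%:Z)) = iser (fun j => iv (s j (p - j%:Z) (q - j%:Z))) l.
Proof.
rewrite iv_ser_d; apply: eq_bigr => i _; congr (_ *: vd _ _).
have le := ltn_ord i.
have -> : p - l%:Z + i%:Z = p - (l - i)%N%:Z by lia.
by have -> : q + 1 - l%:Z - 1 + i%:Z = q - (l - i)%N%:Z by lia.
Qed.

Definition icls (v : nat -> V) : ser imcx := fun l p q => icl p q (v l).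

Lemma iv_ser_d_cls (v : nat -> V) l p q :
  iv (ser_d (icls v) l p q) = mu p q (iser v l).
Proof.
rewrite iv_ser_d /iser linear_sum; apply: eq_bigr => i _; rewrite linearZ /=; congr (_ *: _).
rewrite /iv ival_cl vd_mu.
have -> : p + i%:Z - i%:Z = p by ring.
by have -> : q - 1 + i%:Z + 1 - i%:Z = q by ring.
Qed.
End InternalGrading.

Section SeriesPowers.
Variables (R : comPzRingType) (n : extnat) (A : mcx R n).

Definition ser_mulX k (s : ser A) : ser A := fun l => if (k <= l)%N then s (l - k)%N else 0.

Lemma ser_mulX_is_linear k : linear (ser_mulX k).
Proof.
move=> a s t; apply: ser_ext => l; rewrite /ser_mulX !dfunE.
by case: ifP => _; rewrite ?scaler0 ?addr0.
Qed.
HB.instance Definition _ k :=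
  GRing.isLinear.Build R (ser A) (ser A) _ (ser_mulX k) (ser_mulX_is_linear k).

Lemma ser_mulXS k (s : ser A) : ser_mulX k.+1 s = ser_shift (ser_mulX k s).
Proof. by apply: ser_ext => -[|l]. Qed.

Lemma ser_mulX0 (s : ser A) : ser_mulX 0 s = s.
Proof. by apply: ser_ext => l; rewrite /ser_mulX subn0. Qed.

Lemma ser_mulXD j k (s : ser A) : ser_mulX j (ser_mulX k s) = ser_mulX (j + k) s.
Proof. by elim: j => [|j IH]; rewrite ?ser_mulX0 // addSn !ser_mulXS IH. Qed.

Lemma ser_d_mulX k (s : ser A) : ser_d (ser_mulX k s) = ser_mulX k (ser_d s).
Proof. by elim: k => [|k IH]; rewrite ?ser_mulX0 // !ser_mulXS ser_d_shift IH. Qed.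

Lemma ser_neg_mulX k (s : ser A) : ser_neg (ser_mulX k s) = (-1) ^+ k *: ser_mulX k (ser_neg s).
Proof.
apply: ser_ext => l; rewrite /ser_neg /ser_mulX !dfunE; case: ifP => kl; last by rewrite !scaler0.
by rewrite scalerA -exprD subnKC.
Qed.

Lemma ord_ge_mulX k m (s : ser A) : ord_ge m s -> ord_ge m (ser_mulX k s).
Proof.
move=> h l lm; rewrite /ser_mulX; case: ifP => // _; apply: h.
exact: leq_ltn_trans (leq_subr _ _) lm.
Qed.

Lemma ord_ge_mulXl k (s : ser A) : ord_ge k (ser_mulX k s).
Proof. by move=> l lk; rewrite /ser_mulX leqNgt lk. Qed.

Lemma ser_mulX_self k (s : ser A) : ser_mulX k s k = s 0%N.
Proof. by rewrite /ser_mulX leqnn subnn. Qed.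

Lemma ord_geZ k a (s : ser A) : ord_ge k s -> ord_ge k (a *: s).
Proof. by move=> h l lk; rewrite dfunE h // scaler0. Qed.

Lemma ord_ge_neg k (s : ser A) : ord_ge k s -> ord_ge k (ser_neg s).
Proof. by move=> h l lk; rewrite /ser_neg h // scaler0. Qed.

Lemma ord_ge_sum k (J : Type) (rs : seq J) (F : J -> ser A) :
  (forall j, ord_ge k (F j)) -> ord_ge k (\sum_(j <- rs) F j).
Proof.
move=> h; elim/big_ind: _ => [|s t hs ht|j _]; [exact: ord_ge0 | exact: ord_geD | exact: h].
Qed.
End SeriesPowers.

Section Sums.
Variables (R : pzRingType) (W : lmodType R).

Lemma sum_if_eq l k (F : nat -> W) :
  \sum_(j < l.+1) (if j == k :> nat then F j else 0) = if (k <= l)%N then F k else 0.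
Proof.
rewrite -big_mkcond /=; case: leqP => kl.
  by rewrite (big_pred1 (Ordinal (kl : (k < l.+1)%N))) // => j.
by rewrite big_pred0 // => j; apply/negbTE; rewrite ltn_eqF // (leq_ltn_trans _ kl) // -ltnS.
Qed.

Lemma sum_if_subn l k (F : nat -> W) :
  \sum_(j < l.+1) (if (l - j)%N == k then F j else 0) = if (k <= l)%N then F (l - k)%N else 0.
Proof.
rewrite (reindex_inj rev_ord_inj) /= -(sum_if_eq l k (fun j => F (l - j)%N)).
apply: eq_bigr => j _; rewrite subSS subKn //; exact: ltn_ord j.
Qed.

Lemma sum_telescope w (T : nat -> W) :
  \sum_(m < w.+1) (T m - (if (m < w)%N then T m.+1 else 0)) = T 0%N.
Proof.
rewrite sumrB big_ord_recl [X in _ - X]big_ord_recr /= ltnn addr0.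
rewrite [X in _ - X](eq_bigr (fun m : 'I_w => T m.+1)); last by move=> m _; rewrite ltn_ord.
by rewrite addrK.
Qed.
End Sums.

Lemma deltaD (R : comPzRingType) (n : extnat) (A : mcx R n) i (x y : Tot A) :
  delta i (x + y) = delta i x + delta i y.
Proof. exact: linearD. Qed.

Lemma deltaZ (R : comPzRingType) (n : extnat) (A : mcx R n) i c (x : Tot A) :
  delta i (c *: x) = c *: delta i x.
Proof. exact: linearZ_LR. Qed.

Section Cone.
Variables (R : comPzRingType) (n : extnat) (r : nat) (M : mcx R n).
Hypothesis n2 : two_le n.

Local Notation rho := (nat_of_bool (0 < r)%N).

(* M tensored with the staircase of bicomplexes
     b_0 -d1-> w_0 <-d0- b_1 -d1-> ... <-d0- b_(r-1) -d1-> w_(r-1)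
   (if r = 0, with b_0 -d0-> w_0); the first component holds the coefficients
   of the b_a and the second those of the w_a. To avoid bounds on indices, the
   pairs (b_a, w_a) with a >= r are kept as separate arrows. *)
Definition coneV : lmodType R := (ser M * ser M)%type.

(** The arrow from b_a to w_a has index rho: it is d_1, or d_0 if r = 0. The arrow from b_(a+1) to
    w_a is d_0. The signs make the two composites of d_i with an arrow cancel in [cone_d_rel]. *)
Definition cone_d i (v : coneV) : coneV :=
  ((fun a => (-1) ^+ a *: delta i (v.1 a)) : ser M,
   (fun a => (-1) ^+ (1 + rho + a + i) *: delta i (v.2 a) +
     ((if i == rho then v.1 a else 0) +
      (if (i == 0%N) && (a.+1 < r)%N then v.1 a.+1 else 0))) : ser M).

Lemma coneV_ext (u v : coneV) : (forall a, u.1 a = v.1 a) -> (forall a, u.2 a = v.2 a) -> u = v.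
Proof.
by case: u v => [u1 u2] [v1 v2] /= h1 h2; congr (_, _); apply: ser_ext.
Qed.

Lemma cone_d_is_linear i : linear (cone_d i).
Proof.
have e (b : bool) c (x y : Tot M) : (if b then c *: x + y else 0) =
    c *: (if b then x else 0) + (if b then y else 0) by case: b; rewrite // scaler0 addr0.
move=> c u v; apply: coneV_ext => a /=; rewrite !dfunE linearP /=.
  by rewrite scalerDr !scalerA mulrC.
rewrite !e !scalerDr !scalerA [c * _]mulrC [X in _ + X = _]addrACA.
by rewrite [LHS]addrACA.
Qed.
HB.instance Definition _ i :=
  GRing.isLinear.Build R coneV coneV _ (cone_d i) (cone_d_is_linear i).

(** This places b_a in bidegree (-a,-a) and w_a in (-a-rho,1-a-rho), as the bidegrees of d_0 and d_1
    require. *)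
Definition cone_mu p q (v : coneV) : coneV :=
  ((fun (a : nat) p' q' => if (p' == p + a%:Z) && (q' == q + a%:Z) then v.1 a p' q' else 0) : ser M,
   (fun (a : nat) p' q' => if (p' == p + a%:Z + rho%:Z) && (q' == q + a%:Z + rho%:Z - 1)
      then v.2 a p' q' else 0) : ser M).

Lemma cone_mu_is_linear p q : linear (cone_mu p q).
Proof.
by move=> c u v; apply: coneV_ext => a; apply: tot_ext => p' q' /=; rewrite !dfunE;
  case: ifP; rewrite // scaler0 addr0.
Qed.
HB.instance Definition _ p q :=
  GRing.isLinear.Build R coneV coneV _ (cone_mu p q) (cone_mu_is_linear p q).

Lemma cone_mu_id p q v : cone_mu p q (cone_mu p q v) = cone_mu p q v.
Proof. by apply: coneV_ext => a; apply: tot_ext => p' q' /=; case: (_ && _). Qed.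

Lemma delta_if i (b : int -> int -> bool) (b' : bool) (x : Tot M) p q :
  b (p + i%:Z) (q - 1 + i%:Z) = b' ->
  delta i (fun p q => if b p q then x p q else 0) p q = if b' then delta i x p q else 0.
Proof. by move=> e; rewrite /delta e; case: b' {e} => //; rewrite linear0 transp0. Qed.

Lemma cone_d_mu i p q v : cone_d i (cone_mu p q v) = cone_mu (p - i%:Z) (q + 1 - i%:Z) (cone_d i v).
Proof.
apply: coneV_ext => a; apply: tot_ext => p' q' /=; rewrite !dfunE.
  rewrite (delta_if (b' := (p' == p - i%:Z + a%:Z) && (q' == q + 1 - i%:Z + a%:Z))); last by lia.
  by case: ifP; rewrite // scaler0.
set C := (p' == p - i%:Z + a%:Z + rho%:Z) && (q' == q + 1 - i%:Z + a%:Z + rho%:Z - 1).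
have ia (b : bool) (x : Tot M) : (if b then x else 0) p' q' = if b then x p' q' else 0.
  by case: b.
rewrite (delta_if (b' := C)); last by rewrite /C; lia.
rewrite !ia /=.
have -> : (if i == rho then if (p' == p + a%:Z) && (q' == q + a%:Z) then v.1 a p' q' else 0 else 0)
    = if C then (if i == rho then v.1 a p' q' else 0) else 0.
  case: (i =P rho) => [e|_]; last by case: C.
  by rewrite (_ : (p' == p + _) && _ = C) // /C e; lia.
have -> : (if (i == 0%N) && (a.+1 < r)%N
      then if (p' == p + a.+1%:Z) && (q' == q + a.+1%:Z) then v.1 a.+1 p' q' else 0 else 0)
    = if C then (if (i == 0%N) && (a.+1 < r)%N then v.1 a.+1 p' q' else 0) else 0.
  case: (boolP ((i == 0%N) && (a.+1 < r)%N)) => [/andP[/eqP e ar]|_]; last by case: C.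
  rewrite (_ : (p' == p + _) && _ = C) // /C e.
  by have -> : rho = 1%N; [case: (r) ar | lia].
by case: C; rewrite // scaler0 !addr0.
Qed.

Lemma cone_d_vanish i v : ext_le n i -> cone_d i v = 0.
Proof.
move=> h; have i2 : (1 < i)%N by case: (n) n2 h => // m /= m2 mi; apply: leq_trans mi.
have e1 : (i == rho) = false by case: (r) i2 => [|?] /=; lia.
have e2 : (i == 0%N) = false by lia.
apply: coneV_ext => a /=; rewrite delta_vanish // scaler0 //.
by rewrite e1 e2 !addr0.
Qed.

Lemma coneV_sum1 (J : Type) (rs : seq J) (F : J -> coneV) a :
  (\sum_(j <- rs) F j).1 a = \sum_(j <- rs) (F j).1 a.
Proof. by elim: rs => [|j rs IH]; rewrite ?big_nil // !big_cons -IH. Qed.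

Lemma coneV_sum2 (J : Type) (rs : seq J) (F : J -> coneV) a :
  (\sum_(j <- rs) F j).2 a = \sum_(j <- rs) (F j).2 a.
Proof. by elim: rs => [|j rs IH]; rewrite ?big_nil // !big_cons -IH. Qed.

Lemma cone_d_rel l v : \sum_(j < l.+1) (-1) ^+ (l - j) *: cone_d (l - j) (cone_d j v) = 0.
Proof.
apply: coneV_ext => a; rewrite ?coneV_sum1 ?coneV_sum2 /=.
  rewrite -[RHS](delta_rel l (v.1 a)); apply: eq_bigr => j _; rewrite !dfunE deltaZ.
  by rewrite !scalerA -mulrA -expr2 sqrr_sign mulr1.
pose s := (-1) ^+ (1 + rho + a) : R.
have dif (b : bool) i (x : Tot M) : delta i (if b then x else 0) = if b then delta i x else 0.
  by case: b; rewrite // linear0.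
transitivity (\sum_(j < l.+1) ((-1) ^+ l *: ((-1) ^+ (l - j) *: delta (l - j) (delta j (v.2 a))) +
   ((if j == rho :> nat then s *: delta (l - j) (v.1 a) else 0) +
    (if j == 0%N :> nat then (if (a.+1 < r)%N then s *: delta (l - j) (v.1 a.+1) else 0) else 0) +
    ((if (l - j)%N == rho then (-1) ^+ (rho + a) *: delta j (v.1 a) else 0) +
     (if (l - j)%N == 0%N then (if (a.+1 < r)%N then (-1) ^+ a.+1 *: delta j (v.1 a.+1) else 0) else 0))))).
  apply: eq_bigr => j _; have lj : (j <= l)%N := ltn_ord j.
  rewrite !dfunE !deltaD !deltaZ !dif !scalerDr !scalerA -!addrA.
  congr (_ + _).
    rewrite -!exprD -[in LHS]signr_odd -[in RHS]signr_odd; congr ((-1) ^+ nat_of_bool _ *: _); lia.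
  rewrite !addrA; congr (_ + _ + _ + _).
  - case: ifP => _; last by rewrite !scaler0.
    by rewrite -!exprD /s -[in LHS]signr_odd -[in RHS]signr_odd; congr ((-1) ^+ nat_of_bool _ *: _); lia.
  - case: (j == 0%N :> nat) => /=; last by rewrite scaler0.
    case: ifP => _; last by rewrite !scaler0.
    by rewrite -!exprD /s -[in LHS]signr_odd -[in RHS]signr_odd; congr ((-1) ^+ nat_of_bool _ *: _); lia.
  - case: eqP => [e|_]; last by rewrite scaler0.
    by rewrite scalerA -exprD e.
  - case: eqP => [e|_] /=; last by rewrite scaler0.
    case: ifP => _; last by rewrite scaler0.
    by rewrite scalerA -exprD e.
rewrite !big_split /= -scaler_sumr delta_rel scaler0 add0r.
rewrite (sum_if_eq l rho (fun j => s *: delta (l - j) (v.1 a))).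
rewrite (sum_if_eq l 0 (fun j => if (a.+1 < r)%N then s *: delta (l - j) (v.1 a.+1) else 0)).
rewrite (sum_if_subn l rho (fun j => (-1) ^+ (rho + a) *: delta j (v.1 a))).
rewrite (sum_if_subn l 0 (fun j => if (a.+1 < r)%N then (-1) ^+ a.+1 *: delta j (v.1 a.+1) else 0)).
rewrite addrACA /= !subn0.
have -> : s = - (-1) ^+ (rho + a) by rewrite /s -addnA exprS mulN1r.
case: (boolP (a.+1 < r)%N) => [ar|_]; last by case: ifP => _; rewrite ?scaleNr ?addNr !addr0.
have -> : rho = 1%N by case: (r) ar.
by rewrite add1n; case: ifP => _; rewrite !scaleNr !addNr ?addr0.
Qed.

Definition cone : mcx R n := imcx cone_mu_id cone_d_mu cone_d_vanish cone_d_rel.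
End Cone.

(** * Lifting along the projection of the cone, and acyclicity of the cone *)

Section ConeProperties.
Variables (R : comPzRingType) (n : extnat) (r : nat) (M : mcx R n).
Hypothesis n2 : two_le n.

Local Notation rho := (nat_of_bool (0 < r)%N).
Local Notation K := (cone r M n2).
Local Notation vser := (iser (fun i => cone_d r i : {linear coneV M -> coneV M})).

Definition cval p q (x : K p q) : coneV M := ival x.

Lemma cval_inj p q (x y : K p q) : cval x = cval y -> x = y.
Proof. exact: ival_inj. Qed.

Lemma cval0 p q : cval (0 : K p q) = 0.
Proof. exact: (linear0 (@ival _ _ _ p q)). Qed.

Lemma ser_negE (A : mcx R n) (s : ser A) l : ser_neg (ser_d (ser_neg s)) l =
  \sum_(i < l.+1) delta i (s (l - i)%N).
Proof.
rewrite /ser_neg /ser_d scaler_sumr; apply: eq_bigr => i _; have le := ltn_ord i.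
rewrite deltaZ !scalerA -!exprD -signr_odd (_ : odd _ = false) ?scale1r //; lia.
Qed.

Lemma vser1 v l a : (vser v l).1 a = (-1) ^+ a *: ser_d (fun j => (v j).1 a : Tot M) l.
Proof.
rewrite coneV_sum1 /ser_d scaler_sumr; apply: eq_bigr => i _ /=; rewrite !dfunE.
by rewrite !scalerA mulrC.
Qed.

Lemma vser2 v l a : (vser v l).2 a =
  ((-1) ^+ (1 + rho + a) *: ser_neg (ser_d (ser_neg (fun j => (v j).2 a : Tot M))) +
   ((-1) ^+ rho *: ser_mulX rho (fun j => (v j).1 a : Tot M) +
    (if (a.+1 < r)%N then (fun j => (v j).1 a.+1 : Tot M) : ser M else 0))) l.
Proof.
rewrite coneV_sum2 !dfunE ser_negE scaler_sumr.
transitivity (\sum_(i < l.+1) ((-1) ^+ (1 + rho + a) *: delta i ((v (l - i)%N).2 a) +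
   ((if i == rho :> nat then (-1) ^+ i *: (v (l - i)%N).1 a else 0) +
    (if i == 0%N :> nat then (if (a.+1 < r)%N then (v (l - i)%N).1 a.+1 else 0) else 0)))).
  apply: eq_bigr => i _ /=; rewrite !dfunE !scalerDr !scalerA -exprD; congr (_ *: _ + (_ + _)).
  - by rewrite -[in LHS]signr_odd -[in RHS]signr_odd; congr (_ ^+ nat_of_bool _); lia.
  - by case: ifP => _; rewrite ?scaler0.
  - case: (i =P 0%N :> nat) => [->|_] /=; last by rewrite scaler0.
    by case: ifP; rewrite ?scaler0 // expr0 scale1r.
rewrite !big_split /=; congr (_ + (_ + _)).
  rewrite (sum_if_eq l rho (fun i => (-1) ^+ i *: (v (l - i)%N).1 a)) /ser_mulX.
  by case: ifP => _; rewrite ?scaler0.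
rewrite (sum_if_eq l 0 (fun i => if (a.+1 < r)%N then (v (l - i)%N).1 a.+1 else 0)) /= subn0.
by case: ifP.
Qed.

Definition cone_pr_fun p q (x : K p q) : M p q := (cval x).1 0%N p q.

Lemma cone_pr_is_linear p q : linear (@cone_pr_fun p q).
Proof. by move=> c x y; rewrite /cone_pr_fun /cval linearP /= !dfunE. Qed.
HB.instance Definition _ p q :=
  GRing.isLinear.Build R (K p q) (M p q) _ (@cone_pr_fun p q) (@cone_pr_is_linear p q).

Lemma cval_d i p q (x : K p q) : cval (md K i p q x) = cone_d r i (cval x).
Proof. exact: (ival_d (@cone_mu_id R n r M) (@cone_d_mu R n r M)). Qed.

Program Definition cone_pr : hom K M := @Hom R n K M (fun p q => @cone_pr_fun p q) _.
Next Obligation.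
by rewrite /cone_pr_fun cval_d /= !dfunE expr0 scale1r -md_delta.
Qed.

(** The lift of m has coefficient t^a m at b_a. At w_a with a + 1 < r the two arrows contribute
    -t^(a+1) m and t^(a+1) m. At the remaining w_a only a multiple of t^r m is left. *)
Lemma cone_pr_lifts k : (k <= r)%N -> lifts k cone_pr.
Proof.
move=> kr m hm.
pose v l : coneV M := ((fun a => ser_mulX a m l) : ser M, 0).
have v1 a : (fun j => (v j).1 a : Tot M) = ser_mulX a m by [].
have v2 a : (fun j => (v j).2 a : Tot M) = 0 :> ser M by [].
have v0 l : (l < k)%N -> vser v l = 0.
  move=> lk; apply: coneV_ext => a.
    by rewrite vser1 v1 ser_d_mulX (ord_ge_mulX a hm) // scaler0.
  rewrite vser2 v1 v2 !linear0 ?scaler0 add0r ser_mulXD.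
  case: (ltnP a.+1 r) => ar.
    by rewrite v1; have -> : rho = 1%N; [case: (r) ar | rewrite expr1 scaleN1r add1n addNr].
  rewrite addr0 dfunE ord_ge_mulXl ?scaler0 //; apply: leq_trans lk _.
  by apply: leq_trans kr _; case: (r) ar => //= r' ar; lia.
exists (icls _ _ _ _ v : ser K).
  move=> l lk; apply: tot_ext => p q; apply: cval_inj.
  by rewrite [cval _]iv_ser_d_cls v0 // cval0; apply: linear0.
apply: ser_ext => l; apply: tot_ext => p q.
by rewrite /hser /= /cone_pr_fun /cval ival_cl /= !addr0 !eqxx /= ser_mulX0.
Qed.

(** The solution of the recursion in [xi_y], found from the last arrow backwards. For r > 0 every
    step divides by -t, and the exponent r - rho - m stays nonnegative because m <= r - 1. *)
Definition xi (y : nat -> ser M) a : ser M := (-1) ^+ rho *: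
  \sum_(m < (r.-1 - a).+1) ser_mulX (r - rho - m) (ser_neg (y (a + m)%N)).

Lemma xi_y y a : (-1) ^+ rho *: ser_mulX rho (xi y a) +
  (if (a.+1 < r)%N then xi y a.+1 else 0) = ser_mulX r (ser_neg (y a)).
Proof.
rewrite /xi linearZ_LR scalerA -expr2 sqrr_sign scale1r linear_sum /=.
case: (ltnP a.+1 r) => ar; last first.
  have -> : (r.-1 - a = 0)%N by lia.
  rewrite big_ord1 addr0 addn0 ser_mulXD subn0; congr ser_mulX.
  by case: (r) => //= r'; lia.
have r1 : rho = 1%N by case: (r) ar.
rewrite r1 expr1 scaleN1r; have -> : (r.-1 - a = (r.-1 - a.+1).+1)%N by lia.
rewrite big_ord_recl /= addn0 ser_mulXD -addrA.
rewrite (eq_bigr (fun m : 'I_(r.-1 - a.+1).+1 =>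
  ser_mulX (r - 1 - m) (ser_neg (y (a.+1 + m)%N)))) ?subrr ?addr0.
  by congr ser_mulX; lia.
move=> m _; rewrite ser_mulXD /bump /= add1n addnS addSn; congr (ser_mulX _ (ser_neg (y _))).
by have := ltn_ord m; lia.
Qed.

(** The hypothesis is the w-part of the cycle condition after t -> -t. It turns D of each summand of
    [xi] into consecutive terms T m and T (m+1) modulo t^(r+1), and the sum telescopes. *)
Lemma xi_x (x y : nat -> ser M) a :
  (forall a, ord_ge r.+1 (ser_d (ser_neg (y a)) - (-1) ^+ (a + rho) *:
     (ser_mulX rho (ser_neg (x a)) + (if (a.+1 < r)%N then ser_neg (x a.+1) else 0)))) ->
  ord_ge r.+1 ((-1) ^+ a *: ser_d (xi y a) - ser_mulX r (ser_neg (x a))).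
Proof.
move=> h; pose w := (r.-1 - a)%N.
pose T m := (-1) ^+ m *: ser_mulX (r - m) (ser_neg (x (a + m)%N)).
have -> : ser_mulX r (ser_neg (x a)) = \sum_(m < w.+1) (T m - (if (m < w)%N then T m.+1 else 0)).
  by rewrite sum_telescope /T expr0 scale1r subn0 addn0.
rewrite /xi -/w linearZ_LR linear_sum /= scalerA -exprD scaler_sumr -sumrB.
apply: ord_ge_sum => m.
have mw : (m <= w)%N := ltn_ord m.
have wr : (w <= r - rho)%N by rewrite /w; case: (r) => //= r'; lia.
have := ord_geZ ((-1) ^+ (a + rho)) (ord_ge_mulX (r - rho - m) (h (a + m)%N)).
pose f : {linear ser M -> ser M} := ser_mulX (r - rho - m).
rewrite (linearB f) (linearZ_LR f) (linearD f) /= scalerBr scalerA -exprD ser_mulXD.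
rewrite -ser_d_mulX; congr (ord_ge _ (_ - _)).
have -> : (-1) ^+ (a + rho + (a + m + rho)) = (-1) ^+ m :> R.
  by rewrite -[in LHS]signr_odd -[in RHS]signr_odd; congr (_ ^+ nat_of_bool _); lia.
rewrite scalerDr /T; congr (_ + _).
  by congr (_ *: ser_mulX _ _); lia.
have -> : ((a + m).+1 < r)%N = (m < w)%N by rewrite /w; lia.
case: ifP => mw'; last by rewrite linear0 scaler0 oppr0.
have r0 : (0 < r)%N by move: mw' (erefl w); rewrite {2}/w; lia.
rewrite r0 /=.
by rewrite exprS mulN1r scaleNr opprK addnS; congr (_ *: ser_mulX _ _); lia.
Qed.

(** Let X and Y be the b- and w-parts of an (r+1)-cycle starting at x. The series with b-part [xi Y]
    and no w-part has D equal to t^r (X(-t), Y(-t)) modulo t^(r+1), by [xi_x] and [xi_y], and x is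
    the coefficient of t^r. *)
Lemma cone_acyclic p q (x : K p q) : Zr r.+1 x -> Br r.+1 x.
Proof.
move=> /ZrP[s es hs].
pose v j := cval (s j (p - j%:Z) (q - j%:Z)).
have dv l : (l < r.+1)%N -> vser v l = 0.
  move=> lr; have := hs l lr.
  move=> /(congr1 (fun z : Tot K => cval (z (p - l%:Z) (q + 1 - l%:Z)))).
  by rewrite [LHS]iv_ser_d_strand !dfunE cval0.
have v0 : v 0%N = cval x by rewrite /v es !subr0 homog_id.
pose X a : ser M := fun j => (v j).1 a; pose Y a : ser M := fun j => (v j).2 a.
have hE a : ord_ge r.+1 (ser_d (ser_neg (Y a)) - (-1) ^+ (a + rho) *:
     (ser_mulX rho (ser_neg (X a)) + (if (a.+1 < r)%N then ser_neg (X a.+1) else 0))).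
  have h : ord_ge r.+1 ((-1) ^+ (1 + rho + a) *: ser_neg (ser_d (ser_neg (Y a))) +
     ((-1) ^+ rho *: ser_mulX rho (X a) + (if (a.+1 < r)%N then X a.+1 else 0))).
    by move=> l lr; rewrite -[LHS](vser2 v) dv.
  have := ord_geZ ((-1) ^+ (1 + rho + a)) (ord_ge_neg h); congr (ord_ge _ _).
  pose g : {linear ser M -> ser M} := @ser_neg R n M.
  rewrite (linearD g) (linearZ_LR g) (linearD g) (linearZ_LR g) /= ser_negK ser_neg_mulX.
  rewrite [in LHS]scalerDr !scalerA -expr2 sqrr_sign.
  rewrite -expr2 sqrr_sign !scale1r -scaleNr; congr (_ + _ *: (_ + _)).
    by rewrite -addnA exprS mulN1r addnC.
  by case: ifP => _; rewrite ?linear0.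
pose be l : coneV M := ((fun a => xi Y a l) : ser M, 0).
have be1 a : (fun j => (be j).1 a : Tot M) = xi Y a by [].
have be2 a : (fun j => (be j).2 a : Tot M) = 0 :> ser M by [].
have vbe1 l a : (l <= r)%N -> (vser be l).1 a = ser_mulX r (ser_neg (X a)) l.
  move=> lr; rewrite vser1 be1; have := xi_x a hE lr.
  by rewrite !dfunE => /eqP; rewrite subr_eq0 => /eqP.
have vbe2 l a : (vser be l).2 a = ser_mulX r (ser_neg (Y a)) l.
  rewrite vser2 be1 be2 !linear0 ?scaler0 add0r -xi_y.
  by case: (a.+1 < r)%N.
have vbr : vser be r = cval x.
  rewrite -v0; apply: coneV_ext => a; rewrite ?vbe1 ?vbe2 // ser_mulX_self ser_neg0 //.
pose b : ser K := icls _ _ _ _ be.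
have hb : ord_ge r (ser_d b).
  move=> l lr; apply: tot_ext => p' q'; apply: cval_inj.
  rewrite [cval _]iv_ser_d_cls (_ : vser be l = 0) ?cval0; first exact: linear0.
  by apply: coneV_ext => a; rewrite ?vbe1 ?vbe2 ?ord_ge_mulXl // ltnW.
have -> : x = ser_d b r p q; last exact: Br_comp.
apply: cval_inj; rewrite [RHS]iv_ser_d_cls vbr; apply/esym.
exact: (mu_ival (@cone_mu_id R n r M)).
Qed.
End ConeProperties.

(** * Factorizations *)

Lemma homZ (R : comPzRingType) (n : extnat) (A B : mcx R n) (f : hom A B) p q a (x : A p q) :
  f p q (a *: x) = a *: f p q x.
Proof. exact: linearZ_LR. Qed.

Section FactorizationJ.
Variables (R : comPzRingType) (n : extnat) (r : nat) (A B : mcx R n) (f : hom A B).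
Hypothesis n2 : two_le n.

(** The initial model is A with a k-cycle freely adjoined for each k-cycle b of B, k <= r. Its map
    to B is evaluation in the model B, where every b is its own lift. *)
Record jmodel := JModel {
  jX : mcx R n;
  ju : hom A jX;
  jL : nat -> ser B -> ser jX;
  jLP : forall k b, (k <= r)%N -> ord_ge k (ser_d b) -> ord_ge k (ser_d (jL k b))
}.

Definition jsig := @AlgSig R n jmodel jX (fun p q => (A p q + nat * ser B * nat)%type) noop
  (fun s p q g => match g with inl a => ju s p q a | inr (k, b, l) => jL s k b l p q end)
  (fun s => @noop_int R n (jX s)).

Definition jlift k (b : ser B) : ser (free_mcx jsig) :=
  fun l p q => fgen (inr (k, b, l) : aG jsig p q).

Lemma fev_jlift s k b : hser (fev s) (jlift k b) = jL s k b.
Proof. by apply: ser_ext => l; apply: tot_ext => p q; apply: fev_gen. Qed.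

Lemma jliftP k b : (k <= r)%N -> ord_ge k (ser_d b) -> ord_ge k (ser_d (jlift k b)).
Proof.
move=> kr hb l lk; apply: tot_ext => p q; apply: free_ext => s.
rewrite -[LHS]/(hser (fev s) _ l p q) -hser_d fev_jlift jLP // !dfunE.
by rewrite linear0.
Qed.

Lemma jfactor : exists (M : mcx R n) (i : hom A M) (p : hom M B),
  hom_eq (hcomp p i) f /\
  [/\ forall (X Y : mcx R n) (g : hom X Y), r_fib r g -> llp i g, Er_qiso r i & r_fib r p].
Proof.
have [//|i ie] := free_hom (L := jsig) (t := fun s => ju s) (h := fun p q x => inl x).
pose mB : aS jsig := @JModel B f (fun k b => b) (fun k b _ h => h).
have fevi (s : aS jsig) p q x : fev s p q (i p q x) = ju s p q x by rewrite ie fev_gen.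
have relift (X Y : mcx R n) (g : hom X Y) (v : hom (free_mcx jsig) Y) : r_fib r g ->
    exists L : nat -> ser B -> ser X, forall k b, hser g (L k b) = hser v (jlift k b) /\
      ((k <= r)%N -> ord_ge k (ser_d b) -> ord_ge k (ser_d (L k b))).
  move=> /r_fib_lifts gl.
  have /choice[L hL] (kb : nat * ser B) : exists a : ser X, hser g a = hser v (jlift kb.1 kb.2) /\
      ((kb.1 <= r)%N -> ord_ge kb.1 (ser_d kb.2) -> ord_ge kb.1 (ser_d a)).
    case: kb => k b /=; case: (pselect ((k <= r)%N /\ ord_ge k (ser_d b))) => [[kr hb]|no].
      have [|a ha ea] := gl k kr (hser v (jlift k b)); last by exists a.
      by rewrite hser_d; apply: ord_ge_hser; apply: jliftP.
    (* When b is no k-cycle, the adjoined series is still a family of generators over which the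
       diagonal must lift v, so a coefficientwise lift is chosen. *)
    have [//|a _ ea] := gl 0%N (leq0n _) (hser v (jlift k b)).
    by exists a; split=> // kr hb; case: no.
  by exists (fun k b => L (k, b)) => k b; apply: hL.
have llpi (X Y : mcx R n) (g : hom X Y) : r_fib r g -> llp i g.
  move=> gF u v sq; have [L hL] := relift X Y g v gF.
  pose m : aS jsig := @JModel X u L (fun k b => (hL k b).2).
  exists (fev m); split; first by move=> p q x; exact: (fevi m p q x).
  apply: free_hom_eq => // p q [x|[[k b] l]].
    rewrite /= fev_gen /= -[RHS]/(v p q (fgen (inl x : aG jsig p q))) -ie.
    exact: sq.
  rewrite /= fev_gen /=.
  have [e _] := hL k b; exact: (congr1 (fun s : ser Y => s l p q) e).
exists (free_mcx jsig), i, (fev mB); split; first by move=> p q x; exact: (fevi mB p q x).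
split=> //; last first.
  apply/r_fib_lifts => k kr b hb; exists (jlift k b); first exact: jliftP.
  exact: (fev_jlift mB k b).
have z0 k (b : ser B) : (k <= r)%N -> ord_ge k (ser_d b) -> ord_ge k (ser_d (0 : ser A)).
  by rewrite linear0.
(* Sending the adjoined series to 0 makes A a model, and evaluation there is a retraction of i. *)
pose mA : aS jsig := @JModel A (hid A) (fun k b => 0) z0.
have [z zE] := hom_zero A (cone r (free_mcx jsig) n2).
have [|L hL] := relift _ _ (cone_pr r (free_mcx jsig) n2) (hid _).
  by apply/r_fib_lifts => k kr; apply: cone_pr_lifts.
pose mC : aS jsig := @JModel _ z L (fun k b => (hL k b).2).
(* Both sides vanish on A and fix the adjoined generators. Acyclicity of the cone then makes the
   retraction inverse to i on the page r+1. *)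
have split_id p q x : cone_pr r (free_mcx jsig) n2 p q (fev mC p q x) = x - i p q (fev mA p q x).
  move: p q x; apply: free_ind.
  - move=> p q [x|[[k b] l]]; rewrite !fev_gen.
      rewrite [X in cone_pr _ _ _ p q X]zE linear0; apply/esym/eqP; rewrite subr_eq0.
      by rewrite [X in i p q X]/= ie.
    rewrite [X in i p q X]/= !dfunE linear0 subr0.
    by have [e _] := hL k b; exact: (congr1 (fun s : ser _ => s l p q) e).
  - by [].
  - by move=> p q; rewrite !linear0 ?oppr0 ?addr0.
  - by move=> p q x y ex ey; rewrite !linearD ex ey ?opprD addrACA.
  - by move=> p q a x ex; rewrite !homZ ex scalerBr.
  - by move=> k p q x ex; rewrite !hcomm ex linearB.
split=> [p q x zx bx|p q y zy].
  by rewrite -[x](fevi mA); apply: Br_hom.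
exists (fev mA p q y); split; first exact: Zr_hom.
rewrite -opprB -split_id; apply: BrN; apply: Br_hom.
by apply: cone_acyclic; apply: Zr_hom.
Qed.
End FactorizationJ.

(** * Factorization through a trivial fibration *)

Section FactorizationI.
Variables (R : comPzRingType) (n : extnat) (r : nat) (A B : mcx R n) (f : hom A B).

(* Chosen lifts and fillers over B. The equations [igL] and [igF] are required
   for all arguments, even meaningless ones, so that [ig_fev] holds. *)
Record imodel := IModel {
  iX : mcx R n;
  ig : hom iX B;
  iu : hom A iX;
  igu : hom_eq (hcomp ig iu) f;
  iL : nat -> ser B -> ser iX;
  igL : forall k b, hser ig (iL k b) = b;
  iLP : forall k b, (k <= r.+1)%N -> ord_ge k (ser_d b) -> ord_ge k (ser_d (iL k b));
  iF : forall p q, iX p q -> ser B -> ser iX;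
  igF : forall p q (x : iX p q) b, hser ig (iF x b) = b;
  iFP : forall p q (x : iX p q) b, Zr r.+1 x -> ord_ge r (ser_d b) ->
    ser_d b r = homog (ig p q x) ->
    ord_ge r (ser_d (iF x b)) /\ ser_d (iF x b) r = homog x
}.

Definition isig := @AlgSig R n imodel iX (fun p q => (A p q + nat * ser B * nat)%type)
  (fun _ _ _ _ => (ser B * nat)%type)
  (fun s p q g => match g with inl a => iu s p q a | inr (k, b, l) => iL s k b l p q end)
  (fun s p q p' q' o x => iF x o.1 o.2 p' q').

Local Notation M := (free_mcx isig).

Definition ilift k (b : ser B) : ser M := fun l p q => fgen (inr (k, b, l) : aG isig p q).
Definition ifill p q (x : M p q) (b : ser B) : ser M :=
  fun l p' q' => fop ((b, l) : aO isig p q p' q') x.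

Lemma fev_ilift s k b : hser (fev s) (ilift k b) = iL s k b.
Proof. by apply: ser_ext => l; apply: tot_ext => p q; apply: fev_gen. Qed.

Lemma fev_ifill s p q (x : M p q) b : hser (fev s) (ifill x b) = iF (fev s p q x) b.
Proof. by apply: ser_ext => l; apply: tot_ext => p' q'; apply: fev_op. Qed.

Lemma free_ser_ext (l l' : nat) (s t : ser M) :
  (forall m, hser (fev m) s l = hser (fev m) t l') -> s l = t l'.
Proof.
move=> h; apply: tot_ext => p q; apply: free_ext => m.
exact: (congr1 (fun z : Tot (iX m) => z p q) (h m)).
Qed.

Definition imodelB : aS isig :=
  @IModel B (hid B) f (fun _ _ _ => erefl) (fun k b => b) (fun _ _ => erefl)
    (fun _ _ _ h => h) (fun _ _ _ b => b) (fun _ _ _ _ => erefl)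
    (fun _ _ _ _ _ h e => conj h e).

Definition ipr : hom M B := fev imodelB.

(** Evaluation is a map over B. A filling problem posed over [ipr] is therefore a filling problem in
    every model, which is what [ifillP] checks. *)
Lemma ig_fev (s : imodel) p q (x : M p q) : ig s p q (fev (s : aS isig) p q x) = ipr p q x.
Proof.
move: p q x; apply: free_ind.
- move=> p q [x|[[k b] l]]; rewrite !fev_gen /=; first exact: igu.
  exact: (congr1 (fun z : ser B => z l p q) (igL s k b)).
- move=> p q p' q' [b l] x _; rewrite !fev_op /=.
  exact: (congr1 (fun z : ser B => z l p' q') (igF (fev (s : aS isig) p q x) b)).
- by move=> p q; rewrite !linear0.
- by move=> p q x y ex ey; rewrite !linearD ex ey.
- by move=> p q a x ex; rewrite !homZ ex.
- by move=> i p q x ex; rewrite !hcomm ex.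
Qed.

Lemma iliftP k b : (k <= r.+1)%N -> ord_ge k (ser_d b) -> ord_ge k (ser_d (ilift k b)).
Proof.
move=> kr hb l lk; apply: (@free_ser_ext l l _ 0) => m.
by rewrite -hser_d fev_ilift iLP // linear0.
Qed.

Lemma ifillP p q (x : M p q) b : Zr r.+1 x -> ord_ge r (ser_d b) ->
  ser_d b r = homog (ipr p q x) ->
  ord_ge r (ser_d (ifill x b)) /\ ser_d (ifill x b) r = homog x.
Proof.
move=> zx hb eb.
have hm m : ord_ge r (ser_d (iF (fev (m : aS isig) p q x) b)) /\
    ser_d (iF (fev (m : aS isig) p q x) b) r = homog (fev m p q x).
  by apply: iFP => //; [apply: Zr_hom | rewrite ig_fev].
split.
  move=> l lr; apply: (@free_ser_ext l l _ 0) => m.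
  by rewrite -hser_d fev_ifill (hm m).1 // linear0.
apply: (@free_ser_ext r 0 _ (fun _ => homog x)) => m.
rewrite -hser_d fev_ifill (hm m).2; apply/esym; exact: hser_homog.
Qed.

(** To lift against a trivial fibration g, pull g back along v to P over M. Lifts and fillers in P
    can be chosen above those of M, so P is a model and evaluation in it is a section of [pb] by
    initiality. *)
Lemma ifactor : exists (M : mcx R n) (i : hom A M) (p : hom M B),
  hom_eq (hcomp p i) f /\
  [/\ forall (X Y : mcx R n) (g : hom X Y), Er_qiso r g -> r_fib r g -> llp i g,
      Er_qiso r p & r_fib r p].
Proof.
have [//|i ie] := free_hom (L := isig) (t := fun s => iu s) (h := fun p q x => inl x).
have fevi (s : aS isig) p q x : fev s p q (i p q x) = iu s p q x by rewrite ie fev_gen.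
have prL k b : hser ipr (ilift k b) = b by exact: (fev_ilift imodelB k b).
have prF p q (x : M p q) b : hser ipr (ifill x b) = b by exact: (fev_ifill imodelB x b).
have [prW prFib] : Er_qiso r ipr /\ r_fib r ipr.
  apply/triv_fibP; split=> [k kr b hb|p q x b zx hb eb].
    by exists (ilift k b); [apply: iliftP | apply: prL].
  have [h1 h2] := ifillP zx hb eb.
  by exists (ifill x b); split.
exists M, i, ipr; split; first by move=> p q x; exact: (fevi imodelB p q x).
split=> // X Y g gW gF u v sq.
have [gl gfill] : (forall k, (k <= r.+1)%N -> lifts k g) /\ fills r g by apply/triv_fibP.
have [P [pa [pb [[psq pu] Pinj Psurj]]]] := pullback_mcx g v.
have [[w [wa wb]] _] := pu A u i sq.
have relift (b : ser M) : exists2 c : ser P, hser pb c = b &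
    forall k, (k <= r.+1)%N -> ord_ge k (ser_d b) -> exists2 c : ser P, hser pb c = b & ord_ge k (ser_d c).
  have [//|a _ ea] := gl 0%N (leq0n _) (hser v b).
  have [c _ cb] := pullback_ser Psurj ea; exists c => // k kr hb.
  have [|a' ha' ea'] := gl k kr (hser v b); first by rewrite hser_d; apply: ord_ge_hser.
  have [c' ca' cb'] := pullback_ser Psurj ea'; exists c' => //.
  by apply: (pullback_ord Pinj); rewrite -hser_d ?ca' ?cb'.
have /choice[L hL] (kb : nat * ser B) : exists c : ser P, hser pb c = ilift kb.1 kb.2 /\
    ((kb.1 <= r.+1)%N -> ord_ge kb.1 (ser_d kb.2) -> ord_ge kb.1 (ser_d c)).
  case: kb => k b /=; have [c cb hc] := relift (ilift k b).
  case: (pselect ((k <= r.+1)%N /\ ord_ge k (ser_d b))) => [[kr hb]|no].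
    by have [c' c'b hc'] := hc k kr (iliftP kr hb); exists c'.
  by exists c; split=> // kr hb; case: no.
(* A filler in P is a pair: the chosen filler in M and a filler in X of its image in Y, the latter
   supplied by [fills] for g. *)
have hF p q (x : P p q) (b : ser B) : exists c : ser P, hser pb c = ifill (pb p q x) b /\
    (Zr r.+1 x -> ord_ge r (ser_d b) -> ser_d b r = homog (hcomp ipr pb p q x) ->
      ord_ge r (ser_d c) /\ ser_d c r = homog x).
  have [c cb _] := relift (ifill (pb p q x) b).
  case: (pselect [/\ Zr r.+1 x, ord_ge r (ser_d b) & ser_d b r = homog (hcomp ipr pb p q x)])
    => [[zx hb eb]|no]; last by exists c; split=> // zx hb eb; case: no.
  have [h1 h2] := ifillP (Zr_hom pb zx) hb eb.
  have [|||a [ga ha ea]] := gfill p q (pa p q x) (hser v (ifill (pb p q x) b)).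
  - exact: Zr_hom.
  - by rewrite hser_d; apply: ord_ge_hser.
  - by rewrite hser_d (hser_homog v h2); congr homog; apply/esym/psq.
  have [c' ca' cb'] := pullback_ser Psurj ga; exists c'; split=> // _ _ _; split.
    by apply: (pullback_ord Pinj); rewrite -hser_d ?ca' ?cb'.
  by apply: (pullback_homog Pinj); rewrite -hser_d ?ca' ?cb'.
pose F p q (x : P p q) b := projT1 (cid (hF p q x b)).
have FP p q (x : P p q) b : hser pb (F p q x b) = ifill (pb p q x) b /\
    (Zr r.+1 x -> ord_ge r (ser_d b) -> ser_d b r = homog (hcomp ipr pb p q x) ->
      ord_ge r (ser_d (F p q x b)) /\ ser_d (F p q x b) r = homog x).
  by rewrite /F; case: cid.
have e1 : hom_eq (hcomp (hcomp ipr pb) w) f.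
  by move=> p q x; rewrite -[LHS]/(ipr p q (hcomp pb w p q x)) wb; exact: (fevi imodelB p q x).
have e2 k b : hser (hcomp ipr pb) (L (k, b)) = b.
  by rewrite -[LHS]/(hser ipr (hser pb _)) (hL (k, b)).1 prL.
have e3 p q (x : P p q) b : hser (hcomp ipr pb) (F p q x b) = b.
  by rewrite -[LHS]/(hser ipr (hser pb _)) (FP p q x b).1 prF.
pose mP : aS isig := @IModel P (hcomp ipr pb) w e1 (fun k b => L (k, b)) e2
  (fun k b => (hL (k, b)).2) F e3 (fun p q x b => (FP p q x b).2).
have idM : hom_eq (hcomp pb (fev mP)) (hid M).
  apply: free_hom_eq => [p q [x|[[k b] l]]|p q p' q' [b l] x ex].
  - rewrite /= fev_gen -[RHS]/(fgen (inl x : aG isig p q)) -ie; exact: wb.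
  - rewrite /= fev_gen; exact: (congr1 (fun z : ser M => z l p q) (hL (k, b)).1).
  - rewrite /= fev_op /=.
    have := congr1 (fun z : ser M => z l p' q') (FP p q (fev mP p q x) b).1.
    by rewrite /hser => ->; rewrite -[pb p q _]/(hcomp pb (fev mP) p q x) ex.
exists (hcomp pa (fev mP)); split=> p q x /=.
  by rewrite fevi; apply: wa.
rewrite -[LHS]/(hcomp g pa p q (fev mP p q x)) psq /=.
by rewrite -[pb p q _]/(hcomp pb (fev mP) p q x) idM.
Qed.
End FactorizationI.

Lemma Er_qiso_eq (R : comPzRingType) (n : extnat) r (A B : mcx R n) (f g : hom A B) :
  hom_eq f g -> Er_qiso r f -> Er_qiso r g.
Proof.
move=> e [fi fs]; split=> [p q x zx bx|p q y zy].
  by apply: fi => //; rewrite e.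
by have [x [zx bx]] := fs p q y zy; exists x; split=> //; rewrite -e.
Qed.

Theorem mainTheorem10 (R : comPzRingType) (n : extnat) (r : nat) :
  two_le n ->
  exists G : gen_data R n r,
    gen_data_ok G /\
    exists C : hclass R n,
      cofibrantly_generated (@Er_qiso R n r) C (@r_fib R n r)
                            (I_prime G) (J_prime G) /\
      right_proper (@Er_qiso R n r) (@r_fib R n r).
Proof.
move=> n2; have [G GP] := gen_data_ex R n r; exists G; split=> //.
exists (fun A B i => forall (X Y : mcx R n) (g : hom X Y), Er_qiso r g -> r_fib r g -> llp i g).
split; last exact: mcx_right_proper.
split.
- split.
  + exact: (conj (conj (@mcx_products R n) (@mcx_equalizers R n))
                 (conj (@mcx_coproducts R n) (@mcx_coequalizers R n))).
  + exact: Er_iso_two_of_three.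
  + split; first exact: Er_qiso_retract.
    split; last exact: r_fib_retract.
    move=> A B C D i j ret hj X Y g gW gF; apply: llp_retract ret _; exact: hj.
  + split; first by move=> A B X Y i g hi gW gF; apply: hi.
    move=> A B X Y i g hi iW gF.
    (* The retract argument: in i = p j the map p is a weak equivalence by two-out-of-three, so i
       lifts against p and is a retract of j. *)
    have [M [j [p [pj [jl jW pF]]]]] := jfactor r i n2.
    have pW : Er_qiso r p.
      have [_ h _] := @Er_iso_two_of_three R n r.+1 _ _ _ j p.
      apply: h => //; apply: Er_qiso_eq iW => a b x; exact/esym/pj.
    have [|w [wi pw]] := hi _ _ p pW pF j (hid B); first exact: pj.
    apply: (llp_retract (j := j)); last exact: jl.
    by exists (hid A), (hid A), w, p; split.
  + split=> A B f; first exact: ifactor.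
    have [M [j [p [pj [jl jW pF]]]]] := jfactor r f n2.
    exists M, j, p; split=> //; split=> // X Y g _; exact: jl.
- exact: I_compact.
- exact: J_compact.
- move=> X Y g; rewrite (rlp_JP GP); exact: r_fib_lifts.
- move=> X Y g; rewrite (rlp_IP GP); exact: triv_fibP.
Qed.
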